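(* Suppose $(S,T)$ is a triangulated closed surface with vertex set $V$ and edge set $E$, and $\lambda\in\mathbb R$. (a) The map $\Phi_\lambda:P_{\mathbb S^2}(S,T)\to\mathbb R^E$ is a local diffeomorphism. It is a smooth embedding if $\lambda\ge 0$ or $\lambda\le -1$. (b) The map $\Phi_\lambda:P_{\mathbb E^2}(S,T)/\mathbb R_{>0}\to\mathbb R^E$ is an immersion. (c) If $\lambda\le -1$, then $\Phi_\lambda:P_{\mathbb E^2}(S,T)/\mathbb R_{>0}\to\mathbb R^E$ is a smooth embedding. (d) For any $\lambda\in\mathbb R$, $K_\lambda:CP_{\mathbb H^2}(S,T)\to\mathbb R^V$ is a smooth embedding. (e) For any $\lambda\in\mathbb R$, $K_\lambda:CP_{\mathbb E^2}(S,T)/\mathbb R_{>0}\to\mathbb R^V$ is a smooth embedding. (f) The map $\Psi_\lambda:P_{\mathbb H^2}(S,T)\to\mathbb R^E$ is a local diffeomorphism. If $\lambda\le -1$ or $\lambda\ge 0$, it is a smooth embedding.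
   Context: A closed triangulated surface $(S,T)$ is a connected closed surface obtained from a finite disjoint union of triangles by identifying all edges in pairs by homeomorphisms; $T$ is the resulting cell structure (cells need not be embedded). Each triangle is counted as having three vertices, edges and corners (with multiplicity); each edge is faced by exactly two corners. For $K^2=\mathbb E^2,\mathbb S^2,\mathbb H^2$ (curvature $0,1,-1$), $P_{K^2}(S,T)\subset\mathbb R_{>0}^E$ is the open set of $K^2$ polyhedral metrics: functions $l:E\to\mathbb R_{>0}$ such that for each triangle with edges $e_i,e_j,e_k$ the numbers $l(e_i),l(e_j),l(e_k)$ are the edge lengths of a (non-degenerate) triangle in $K^2$. Such $l$ determines all inner angles. $CP_{K^2}(S,T)$ is the space of circle packing metrics: those $l$ of the form $l(e)=r(v)+r(v')$ ($v,v'$ the end points of $e$) for some $r:V\to\mathbb R_{>0}$; for $K^2=\mathbb E^2,\mathbb H^2$ it is identified with $\mathbb R_{>0}^V$ via $r$. $\mathbb R_{>0}$ acts on $P_{\mathbb E^2}(S,T)$ and $CP_{\mathbb E^2}(S,T)$ by scaling and the quotients are spaces of metrics modulo scaling; the maps below are invariant under scaling in the Euclidean case and induce maps on the quotients, denoted by the same symbols. $\Phi_\lambda$ sends a metric to $\phi_\lambda\in\mathbb R^E$, $\phi_\lambda(e)=\int_{\pi/2}^{a}\sin^\lambda(t)\,dt+\int_{\pi/2}^{a'}\sin^\lambda(t)\,dt$, where $a,a'$ are the inner angles facing $e$. $\Psi_\lambda$ sends a metric to $\psi_\lambda\in\mathbb R^E$, $\psi_\lambda(e)=\int_0^{(b+c-a)/2}\cos^\lambda(t)\,dt+\int_0^{(b'+c'-a')/2}\cos^\lambda(t)\,dt$,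 where $b,c$ (resp. $b',c'$) are the other two angles of the triangle containing $a$ (resp. $a'$). $K_\lambda$ sends a metric to $k_\lambda\in\mathbb R^V$, $k_\lambda(v)=\sum_{i=1}^m\int_{\pi/2}^{\theta_i}\tan^\lambda(t/2)\,dt$, where $\theta_1,\dots,\theta_m$ are all the inner angles at $v$. *)

(* Defs.v *)
From HB Require Import structures.
From mathcomp Require Import all_boot all_order all_algebra.
From mathcomp Require Import all_classical all_reals all_analysis.

Set Implicit Arguments.
Unset Strict Implicit.
Unset Printing Implicit Defensive.

Import Order.TTheory GRing.Theory Num.Theory.
Import numFieldNormedType.Exports.

Local Open Scope classical_set_scope.
Local Open Scope ring_scope.

(** * Closed triangulated surfaces *)

(* The pair (f, i) stands both for the i-th corner of the triangle f and for
   the side of f opposite to that corner: the corner facing a side is the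
   corner with the same name.  The end points of the side (f, i) are the
   corners (f, i + 1) and (f, i + 2), indices mod 3. *)
Definition next_corner (F : finType) (c : F * 'I_3) : F * 'I_3 :=
  (c.1, ordS c.2).
Definition prev_corner (F : finType) (c : F * 'I_3) : F * 'I_3 :=
  (c.1, ord_pred c.2).

(* A homeomorphism between two sides is determined up to isotopy by what it
   does to the end points, which is recorded by [aligned]: if it is true the
   i + 1 end goes to the i + 1 end; if it is false the i + 1 end goes to the
   i + 2 end.  Both values are allowed, so that the surface need not be
   orientable. *)
Record closed_surface := ClosedSurface {
  face : finType;
  gluing : face * 'I_3 -> face * 'I_3;
  aligned : face * 'I_3 -> bool;
  gluingK : involutive gluing;
  gluing_neq : forall s, gluing s != s;
  aligned_gluing : forall s, aligned (gluing s) = aligned s;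
  face_gt0 : (0 < #|face|)%N;
  face_connected : forall f g : face,
    connect [rel f1 f2 | [exists i, (gluing (f1, i)).1 == f2]] f g
}.

Definition corner (S : closed_surface) : finType := (face S * 'I_3)%type.

Definition edge_class (S : closed_surface) (s : corner S) : {set corner S} :=
  [set s; gluing s]%SET.

Definition edge (S : closed_surface) : finType :=
  {e : {set corner S} | e \in codom (@edge_class S)}.

Definition edge_of (S : closed_surface) (s : corner S) : edge S :=
  exist _ (edge_class s) (codom_f (@edge_class S) s).

(* [c] and [d] are identified by the gluing of a side having [c] as an end. *)
Definition glued_corners (S : closed_surface) : rel (corner S) :=
  fun c d => [exists s : corner S,
    let n := next_corner (gluing s) in
    let p := prev_corner (gluing s) in
    ((c == next_corner s) && (d == if aligned s then n else p)) ||
    ((c == prev_corner s) && (d == if aligned s then p else n))].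

Definition vertex_class (S : closed_surface) (c : corner S) :
    {set corner S} :=
  [set d | connect (@glued_corners S) c d]%SET.

Definition vertex (S : closed_surface) : finType :=
  {v : {set corner S} | v \in codom (@vertex_class S)}.

Definition vertex_of (S : closed_surface) (c : corner S) : vertex S :=
  exist _ (vertex_class c) (codom_f (@vertex_class S) c).

(** * Triangles in the model planes *)

Inductive geometry := Euclidean | Spherical | Hyperbolic.

Definition curvature (R : realType) (K : geometry) : R :=
  match K with Euclidean => 0 | Spherical => 1 | Hyperbolic => -1 end.

(* The model planes lie in R^3, with coordinates (x0, x1, x2): the Euclidean
   plane is the affine plane x0 = 1, the sphere is the unit sphere and the
   hyperbolic plane is the upper sheet of the hyperboloid <x, x> = -1 for the
   Lorentzian form. *)
Definition ambient_form (R : realType) (K : geometry) (x y : 'rV[R]_3) : R :=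
  curvature R K * x 0 0 * y 0 0 + x 0 1 * y 0 1 + x 0 2 * y 0 2.

Definition plane (R : realType) (K : geometry) : set 'rV[R]_3 :=
  match K with
  | Euclidean => [set x | x 0 0 = 1]
  | Spherical => [set x | ambient_form K x x = 1]
  | Hyperbolic => [set x | ambient_form K x x = -1 /\ 0 < x 0 0]
  end.

Definition arcosh (R : realType) (t : R) : R :=
  ln (t + Num.sqrt (t ^+ 2 - 1)).

Definition dist (R : realType) (K : geometry) (x y : 'rV[R]_3) : R :=
  match K with
  | Euclidean => Num.sqrt (ambient_form K (y - x) (y - x))
  | Spherical => acos (ambient_form K x y)
  | Hyperbolic => arcosh (- ambient_form K x y)
  end.

(* A vector tangent at [x] to the geodesic segment from [x] to [y]; in the
   curved cases it is the projection of [y] to the tangent plane at [x]. *)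
Definition direction (R : realType) (K : geometry) (x y : 'rV[R]_3) :
    'rV[R]_3 :=
  match K with
  | Euclidean => y - x
  | _ => y - (curvature R K * ambient_form K x y) *: x
  end.

Definition angle_at (R : realType) (K : geometry) (x y z : 'rV[R]_3) : R :=
  let u := direction K x y in
  let w := direction K x z in
  acos (ambient_form K u w /
    (Num.sqrt (ambient_form K u u) * Num.sqrt (ambient_form K w w))).

(* Three points of the plane lie on a common geodesic if and only if they are
   linearly dependent in R^3. *)
Definition nondegenerate_triangle (R : realType) (x y z : 'rV[R]_3) : Prop :=
  \det (\matrix_(i < 3) nth 0 [:: x; y; z] i) != 0.

(* [x y z] is a triangle whose sides opposite to x, y, z have lengths
   a, b, c. *)
Definition triangle_with (R : realType) (K : geometry) (a b c : R)
    (x y z : 'rV[R]_3) : Prop :=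
  [/\ plane K x, plane K y & plane K z] /\ nondegenerate_triangle x y z /\
  [/\ dist K y z = a, dist K z x = b & dist K x y = c].

(* The angle opposite to the side of length a in the triangle with side
   lengths a, b, c. *)
Definition inner_angle (R : realType) (K : geometry) (a b c : R) : R :=
  xget 0 [set theta | exists x y z : 'rV[R]_3,
    triangle_with K a b c x y z /\ theta = angle_at K x y z].

(** * Polyhedral and circle packing metrics *)

(* R^E and R^V are spaces of row vectors indexed by the canonical enumeration
   of the finite types E and V. *)
Definition side_length (R : realType) (S : closed_surface)
    (l : 'rV[R]_#|edge S|) (s : corner S) : R :=
  l 0 (enum_rank (edge_of s)).

Definition polyhedral (R : realType) (S : closed_surface) (K : geometry) :
    set 'rV[R]_#|edge S| :=
  [set l : 'rV[R]_#|edge S| | (forall e, 0 < l 0 e) /\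
    forall s : corner S, exists x y z : 'rV[R]_3,
      triangle_with K (side_length l s) (side_length l (next_corner s))
        (side_length l (prev_corner s)) x y z].

Definition corner_angle (R : realType) (S : closed_surface) (K : geometry)
    (l : 'rV[R]_#|edge S|) (c : corner S) : R :=
  inner_angle K (side_length l c) (side_length l (next_corner c))
    (side_length l (prev_corner c)).

Definition radii (R : realType) (S : closed_surface) : set 'rV[R]_#|vertex S| :=
  [set r : 'rV[R]_#|vertex S| | forall v, 0 < r 0 v].

(* The circle packing metric with radii [r].  The value at an edge is read off
   on one of its two sides; both have the same end points in V. *)
Definition packing_metric (R : realType) (S : closed_surface)
    (r : 'rV[R]_#|vertex S|) : 'rV[R]_#|edge S| :=
  \row_(i < #|edge S|)
    let s := iinv (valP (enum_val i)) in
    r 0 (enum_rank (vertex_of (next_corner s))) +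
    r 0 (enum_rank (vertex_of (prev_corner s))).

(** * The curvatures *)

Definition oriented_integral (R : realType) (a b : R) (f : R -> R) : R :=
  if a <= b then \int[@lebesgue_measure R]_(t in `[a, b]) f t
  else - \int[@lebesgue_measure R]_(t in `[b, a]) f t.

Definition Phi (R : realType) (S : closed_surface) (K : geometry) (lambda : R)
    (l : 'rV[R]_#|edge S|) : 'rV[R]_#|edge S| :=
  \row_(i < #|edge S|) \sum_(c in val (enum_val i))
    oriented_integral (pi / 2) (corner_angle K l c)
      (fun t => sin t `^ lambda).

Definition Psi (R : realType) (S : closed_surface) (K : geometry) (lambda : R)
    (l : 'rV[R]_#|edge S|) : 'rV[R]_#|edge S| :=
  \row_(i < #|edge S|) \sum_(c in val (enum_val i))
    oriented_integral 0
      ((corner_angle K l (next_corner c) + corner_angle K l (prev_corner c)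
        - corner_angle K l c) / 2)
      (fun t => cos t `^ lambda).

Definition Kcurv (R : realType) (S : closed_surface) (K : geometry) (lambda : R)
    (l : 'rV[R]_#|edge S|) : 'rV[R]_#|vertex S| :=
  \row_(i < #|vertex S|) \sum_(c in val (enum_val i))
    oriented_integral (pi / 2) (corner_angle K l c)
      (fun t => tan (t / 2) `^ lambda).

(** * Smooth maps between open sets of R^n and R^m *)

(* f is C^k on U, for an open set U: the derivatives in all fixed directions v
   (in particular the partial derivatives) are C^(k-1). *)
Fixpoint C_on (R : realType) (n m : nat) (k : nat) (U : set 'rV[R]_n)
    (f : 'rV[R]_n -> 'rV[R]_m) : Prop :=
  match k with
  | 0 => forall x, U x -> {for x, continuous f}
  | k'.+1 => (forall x, U x -> differentiable f x) /\
             (forall v, C_on k' U ('D_v f))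
  end.

Definition smooth_on (R : realType) (n m : nat) (U : set 'rV[R]_n)
    (f : 'rV[R]_n -> 'rV[R]_m) : Prop :=
  open U /\ forall k, C_on k U f.

Definition local_diffeomorphism (R : realType) (n m : nat) (U : set 'rV[R]_n)
    (f : 'rV[R]_n -> 'rV[R]_m) : Prop :=
  open U /\ forall x, U x -> exists W : set 'rV[R]_n,
    [/\ W x, W `<=` U, smooth_on W f &
        exists g : 'rV[R]_m -> 'rV[R]_n,
          smooth_on (f @` W) g /\ forall y, W y -> g (f y) = y].

(* An injective immersion which is a homeomorphism onto its image. *)
Definition smooth_embedding (R : realType) (n m : nat) (U : set 'rV[R]_n)
    (f : 'rV[R]_n -> 'rV[R]_m) : Prop :=
  [/\ smooth_on U f,
      forall x v, U x -> 'd f x v = 0 -> v = 0 &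
      exists g : 'rV[R]_m -> 'rV[R]_n,
        (forall x, U x -> g (f x) = x) /\ {within f @` U, continuous g}].

(** * The quotient of an open cone by scaling *)

Definition scaling_orbit (R : realType) (n : nat) (x : 'rV[R]_n) :
    set 'rV[R]_n :=
  [set c *: x | c in [set c : R | 0 < c]].

Definition orbits (R : realType) (n : nat) (U : set 'rV[R]_n) :
    set (set 'rV[R]_n) :=
  @scaling_orbit R n @` U.

(* Open sets of the quotient topology on U / R_{>0}, for an open set U which
   is invariant under scaling. *)
Definition open_orbits (R : realType) (n : nat) (U : set 'rV[R]_n)
    (O : set (set 'rV[R]_n)) : Prop :=
  O `<=` orbits U /\ open (\bigcup_(o in O) o).

Definition induced_on_orbits (R : realType) (n m : nat) (U : set 'rV[R]_n)
    (f : 'rV[R]_n -> 'rV[R]_m) (fbar : set 'rV[R]_n -> 'rV[R]_m) : Prop :=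
  forall x, U x -> fbar (scaling_orbit x) = f x.

(* The map induced by f on the manifold U / R_{>0} is well defined, smooth
   (equivalently, f is smooth), and its differentials are injective.  The
   tangent space of the quotient at the class of x is R^n / (R x), since R x
   is tangent to the orbit of x; the differential of the induced map is the
   map induced by 'd f x. *)
Definition immersion_mod_scaling (R : realType) (n m : nat)
    (U : set 'rV[R]_n) (f : 'rV[R]_n -> 'rV[R]_m) : Prop :=
  [/\ forall c x, 0 < c -> U x -> U (c *: x),
      exists fbar, induced_on_orbits U f fbar,
      smooth_on U f &
      forall x v, U x -> 'd f x v = 0 -> exists c : R, v = c *: x].

Definition smooth_embedding_mod_scaling (R : realType) (n m : nat)
    (U : set 'rV[R]_n) (f : 'rV[R]_n -> 'rV[R]_m) : Prop :=
  immersion_mod_scaling U f /\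
  exists fbar : set 'rV[R]_n -> 'rV[R]_m,
    [/\ induced_on_orbits U f fbar,
        forall o1 o2, orbits U o1 -> orbits U o2 ->
          fbar o1 = fbar o2 -> o1 = o2 &
        forall O, O `<=` orbits U ->
          (open_orbits U O <-> exists2 W : set 'rV[R]_m,
             open W & fbar @` O = W `&` (fbar @` orbits U))].

(* Main.v *)
Require Import Defs.
From HB Require Import structures.
From mathcomp Require Import all_boot all_order all_algebra.
From mathcomp Require Import all_classical all_reals all_analysis.
From mathcomp Require Import ring lra.

Set Implicit Arguments.
Unset Strict Implicit.
Unset Printing Implicit Defensive.

Import Order.TTheory GRing.Theory Num.Theory.
Import numFieldNormedType.Exports.
Local Open Scope ring_scope.
Local Open Scope classical_set_scope.

(** Give an edge of length l the coordinate t with dt = sn(l)^(-lambda-1) dl and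
    an angle theta the coordinate u with du = sin(theta)^lambda dtheta.  By the
    sine rule the sum of dt du over the three pairs of opposite sides and angles
    of a triangle is a positive multiple of a quadratic form in the dl, which is
    positive definite on the sphere and, in the Euclidean plane, positive
    semidefinite with kernel the infinitesimal scalings.  Summing over the faces
    gives sum_e dt_e dphi_e, so Phi is an immersion.  If lambda <= -1, two
    triangles are joined by a path of triangles which is affine in the t: at an
    interior minimum where a triangle inequality fails, the second derivative of
    the difference of its two sides would be negative.  The mean value theorem along the path turns the
    infinitesimal inequality into (Delta t).(Delta phi) >= 0, with equality only
    for equal (or proportional) metrics, hence injectivity.  Polar duality of
    spherical triangles exchanges lambda and -lambda-1 and gives lambda >= 0.

    For Psi take dt = tanh(l/2)^(-lambda-1) dl and du = cos(x)^lambda dx, where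
    x = (b+c-a)/2 for the angles a, b, c and l is opposite to a: the quotient
    cos(x) / tanh(l/2) is the same for the three sides of a hyperbolic triangle, which again produces a (negative) definite form.  The path
    is affine in the t if lambda <= -1 and affine in the u if lambda >= 0.

    For circle packings a maximum principle suffices: at a vertex where the
    ratio sn(r')/sn(r) of two packings is maximal, all angles are smaller for r'.

    Modulo scaling, f + rho.(1, ..., 1), with rho a suitable function of the
    scale, is an injective immersion between spaces of equal dimension; by the
    inverse function theorem it is open, and the embedding property of f on the
    quotient follows. *)

(** * Smooth maps and the inverse function theorem *)

(** The weight sn^(-lambda-1) is forced. The derivative of an angle is its sine times a linear
    combination L of the dl, and sin(theta) = m sn(l) with the same m at the three corners, so
    sin(theta)^lambda dtheta = (m sn(l))^(lambda+1) L; the weight cancels the only power that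
    depends on the corner. What is left, the sum of the dl L, is indefinite in the hyperbolic plane,
    whence the different coordinates for Psi.

    Definiteness yields injectivity only along a path inside the domain, and the set of triangles
    need not be convex in these coordinates. The convexity argument for the path wants a density
    with nonnegative exponent: -lambda-1 for paths in t, lambda for paths in u or for polar
    triangles. Between -1 and 0 neither is available, which is where the restriction on lambda comes
    from. The maximum principle compares two packings without any path and so admits every lambda.

    Angles, defined through a chosen triangle and acos, are replaced by the half-angle formula 2
    atan(sqrt(...)) in the semi-perimeter deficits, which is smooth and has a simple logarithmic
    derivative. *)

Section differentiable_eps.
Variables (R : realType) (V W : normedModType R).
Implicit Types (f g : V -> W) (x : V).

Lemma differentiable_epsP f x : differentiable f x ->
  forall e : R, 0 < e -> \forall h \near (0 : V),
    `|f (h + x) - f x - 'd f x h| <= e * `|h|.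
Proof.
move=> /diff_locallyP[_ /eqaddoP H] e e0.
have := H _ e0; apply: filterS => h.
by rewrite /= opprD addrA.
Qed.

Lemma is_diff_eps f (A : {linear V -> W}) x : continuous A ->
  (forall e : R, 0 < e -> \forall h \near (0 : V),
    `|f (h + x) - f x - A h| <= e * `|h|) -> is_diff x f A.
Proof.
move=> cA H.
have dxf : f \o shift x = cst (f x) + A +o_ 0 id.
  apply/eqaddoP => e e0; have := H e e0; apply: filterS => h.
  by rewrite /= opprD addrA.
have dA := diff_unique cA dxf.
apply: DiffDef; last exact: dA.
apply/diff_locallyP; split; first by rewrite dA.
by rewrite dA.
Qed.

Lemma near_eq_differentiable f g x :
  (\near x, f x = g x) -> differentiable f x -> differentiable g x.
Proof.
move=> fg df.
suff : is_diff x g ('d f x) by case.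
apply: is_diff_eps => [|e e0]; first exact: diff_continuous.
have fgx : f x = g x := nbhs_singleton fg.
have fg0 : \forall h \near (0 : V), f (h + x) = g (h + x).
  by move: fg; rewrite (near_shift 0 x); apply: filterS => h; rewrite /= subr0.
near=> h.
have <- : f (h + x) = g (h + x) by near: h.
by rewrite -fgx; near: h; exact: differentiable_epsP.
Unshelve. all: by end_near. Qed.

End differentiable_eps.

(** * Continuously differentiable real functions of several variables *)

Section Ck.
Variables (R : realType) (n : nat).
Implicit Types (U : set 'rV[R]_n) (f g : 'rV[R]_n -> R) (k : nat).

(** Real-valued counterpart of [C_on], for which products, quotients and compositions make sense;
    [C_on_coord] returns to vector-valued maps coordinate by coordinate. *)
Fixpoint Ck k U f : Prop :=
  match k with
  | 0 => forall x, U x -> {for x, continuous f}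
  | k'.+1 => (forall x, U x -> differentiable f x) /\ forall v, Ck k' U ('D_v f)
  end.

Lemma near_open (P : 'rV[R]_n -> Prop) U x : open U -> U x ->
  (forall y, U y -> P y) -> \forall y \near x, P y.
Proof.
by move=> oU Ux fg; apply: filterS (open_nbhs_nbhs (conj oU Ux)).
Qed.

(** On an open set, agreement at every point is agreement near every point, and so passes to
    derivatives. *)
Lemma Ck_eq k U f g : open U -> (forall x, U x -> f x = g x) ->
  Ck k U f -> Ck k U g.
Proof.
move=> oU; elim: k f g => [|k IH] f g fg /=.
  move=> cf x Ux; have fgn := near_open oU Ux fg.
  rewrite /prop_for /continuous_at -(fg _ Ux); apply: cvg_trans (cf x Ux).
  exact: (near_eq_cvg fgn).
move=> [df Df]; split=> [x Ux|v].
  by apply: near_eq_differentiable (df x Ux); exact: near_open fg.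
apply: IH (Df v) => x Ux.
by apply: near_eq_derive; exact: near_open fg.
Qed.

Lemma Ck_sub k U U' f : U' `<=` U -> Ck k U f -> Ck k U' f.
Proof.
move=> sU; elim: k f => [|k IH] f /=; first by move=> h x /sU /h.
by move=> [h1 h2]; split=> [x /sU /h1//|v]; exact: IH.
Qed.

Lemma Ck_pred k U f : Ck k.+1 U f -> Ck k U f.
Proof.
elim: k f => [|k IH] f [df Df].
  by move=> x Ux; apply: differentiable_continuous; exact: df.
by split=> // v; exact: IH.
Qed.

Lemma Ck_cst k U (c : R) : Ck k U (fun=> c).
Proof.
elim: k c => [|k IH] c /=; first by move=> x _; exact: cst_continuous.
split=> [x _|v]; first exact: differentiable_cst.
by rewrite (_ : 'D_v _ = fun=> 0)//; apply/funext => x; exact: derive_cst.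
Qed.

Lemma Ck_coord k U i : Ck k U (fun x => x 0 i).
Proof.
case: k => [x _|k].
  by apply: differentiable_continuous; exact: differentiable_coord.
split=> [x _|v]; first exact: differentiable_coord.
rewrite (_ : 'D_v _ = fun=> v 0 i); first exact: Ck_cst.
apply/funext => x; rewrite deriveE; last exact: differentiable_coord.
pose g (y : 'rV[R]_n) := y 0 i.
have lg : linear g by move=> a b c; rewrite /g !mxE.
pose gL : {linear 'rV[R]_n -> R} := HB.pack g
  (GRing.isLinear.Build _ _ _ _ _ lg).
rewrite -[LHS]/('d gL x v) diff_lin//.
by move=> y; apply: differentiable_continuous; exact: differentiable_coord.
Qed.

Lemma CkD k U f g : open U -> Ck k U f -> Ck k U g ->
  Ck k U (fun x => f x + g x).
Proof.
move=> oU; elim: k f g => [|k IH] f g /=.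
  by move=> cf cg x Ux; apply: continuousD; [exact: cf|exact: cg].
move=> [df Df] [dg Dg]; split=> [x Ux|v].
  by apply: differentiableD; [exact: df|exact: dg].
apply: (Ck_eq oU _ (IH _ _ (Df v) (Dg v))) => x Ux.
by rewrite deriveD//; apply: diff_derivable; [exact: df|exact: dg].
Qed.

Lemma CkM k U f g : open U -> Ck k U f -> Ck k U g ->
  Ck k U (fun x => f x * g x).
Proof.
move=> oU; elim: k f g => [|k IH] f g.
  by move=> cf cg x Ux; apply: continuousM; [exact: cf|exact: cg].
move=> /[dup] /Ck_pred Cf [df Df] /[dup] /Ck_pred Cg [dg Dg].
split=> [x Ux|v].
  by apply: differentiableM; [exact: df|exact: dg].
apply: (Ck_eq oU _ (CkD oU (IH _ _ Cf (Dg v)) (IH _ _ Cg (Df v)))) => x Ux.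
by rewrite deriveM//; apply: diff_derivable; [exact: df|exact: dg].
Qed.

Lemma CkN k U f : open U -> Ck k U f -> Ck k U (fun x => - f x).
Proof.
move=> oU Cf; apply: (Ck_eq oU _ (CkM oU (Ck_cst _ _ (-1)) Cf)) => x _.
by rewrite mulN1r.
Qed.

Lemma CkB k U f g : open U -> Ck k U f -> Ck k U g ->
  Ck k U (fun x => f x - g x).
Proof. by move=> oU Cf Cg; apply: CkD => //; exact: CkN. Qed.

Lemma Ck_sum k U (I : Type) (r : seq I) (P : pred I) (F : I -> 'rV[R]_n -> R) :
  open U -> (forall i, P i -> Ck k U (F i)) ->
  Ck k U (fun x => \sum_(i <- r | P i) F i x).
Proof.
move=> oU CF; elim: r => [|i r IH].
  by apply: (Ck_eq oU _ (Ck_cst k U 0)) => x _; rewrite big_nil.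
have [Pi|Pi] := boolP (P i).
  by apply: (Ck_eq oU _ (CkD oU (CF i Pi) IH)) => x _; rewrite big_cons Pi.
by apply: (Ck_eq oU _ IH) => x _; rewrite big_cons (negbTE Pi).
Qed.

Lemma Ck_prod k U (I : Type) (r : seq I) (P : pred I) (F : I -> 'rV[R]_n -> R) :
  open U -> (forall i, P i -> Ck k U (F i)) ->
  Ck k U (fun x => \prod_(i <- r | P i) F i x).
Proof.
move=> oU CF; elim: r => [|i r IH].
  by apply: (Ck_eq oU _ (Ck_cst k U 1)) => x _; rewrite big_nil.
have [Pi|Pi] := boolP (P i).
  by apply: (Ck_eq oU _ (CkM oU (CF i Pi) IH)) => x _; rewrite big_cons Pi.
by apply: (Ck_eq oU _ IH) => x _; rewrite big_cons (negbTE Pi).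
Qed.

Lemma is_derive_comp1 (phi : R -> R) f x v (a b : R) :
  is_derive (f x) 1 phi a -> differentiable f x -> is_derive x v f b ->
  is_derive x v (phi \o f) (a * b).
Proof.
move=> [dphi <-] df [_ <-].
have dphi' : differentiable phi (f x) by apply/derivable1_diffP.
have dc : differentiable (phi \o f) x by exact: differentiable_comp.
apply: DeriveDef; first exact: diff_derivable.
rewrite !deriveE// diff_comp//= -[X in 'd phi _ X = _]mulr1.
by rewrite [LHS]linearZ mulrC.
Qed.

(** One step of the chain rule, which gains one order. The regularity of [psi] along [f] is a
    separate premise, so that for an elementary [phi] it can be supplied by induction on k. *)
Lemma Ck_comp k U f (phi psi : R -> R) : open U ->
  (forall x, U x -> is_derive (f x) 1 phi (psi (f x))) ->
  Ck k.+1 U f -> Ck k U (fun x => psi (f x)) -> Ck k.+1 U (fun x => phi (f x)).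
Proof.
move=> oU dphi [df Df] Cpsi; split=> [x Ux|v].
  apply: differentiable_comp; first exact: df.
  by apply/derivable1_diffP; case: (dphi _ Ux).
apply: (Ck_eq oU _ (CkM oU Cpsi (Df v))) => x Ux.
have dv : is_derive x v f ('D_v f x).
  by apply: derivableP; apply: diff_derivable; exact: df.
by have [_ ->//] := is_derive_comp1 (dphi _ Ux) (df _ Ux) dv.
Qed.

Lemma Ck_comp0 U f (phi : R -> R) :
  (forall x, U x -> {for f x, continuous phi}) ->
  Ck 0 U f -> Ck 0 U (fun x => phi (f x)).
Proof.
move=> cphi cf x Ux; apply: continuous_comp; [exact: cf|exact: cphi].
Qed.

Lemma is_derive_continuous (phi : R -> R) (y a : R) :
  is_derive y 1 phi a -> {for y, continuous phi}.
Proof.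
by move=> [d _]; apply: differentiable_continuous; apply/derivable1_diffP.
Qed.

End Ck.

Section Ck_functions.
Variables (R : realType) (n : nat).
Implicit Types (U : set 'rV[R]_n) (f g : 'rV[R]_n -> R) (k : nat).

Definition smooth U f := forall k, Ck k U f.

Lemma Ck_inv k U f : open U -> (forall x, U x -> f x != 0) ->
  Ck k U f -> Ck k U (fun x => (f x)^-1).
Proof.
move=> oU f0; have di (y : R) : y != 0 -> is_derive y 1 (@GRing.inv R) (- (y^-1 * y^-1)).
  move=> y0; have := @is_deriveV R id y 1 1 y0 (is_derive_id _ _).
  rewrite /= => h; apply: is_derive_eq h _.
  by rewrite /= scaleNr -exprVn /GRing.scale/= mulr1 expr2.
elim: k => [|k IH] Cf.
  apply: Ck_comp0 Cf => x /f0 fx0.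
  exact: is_derive_continuous (di _ fx0).
apply: (Ck_comp oU (psi := fun y => - (y^-1 * y^-1))) => //.
  by move=> x /f0; exact: di.
by apply: CkN => //; apply: CkM => //; apply: IH; exact: Ck_pred.
Qed.

Lemma Ck_div k U f g : open U -> (forall x, U x -> g x != 0) ->
  Ck k U f -> Ck k U g -> Ck k U (fun x => f x / g x).
Proof. by move=> oU g0 Cf Cg; apply: CkM => //; exact: Ck_inv. Qed.

Lemma Ck_expR k U f : open U -> Ck k U f -> Ck k U (fun x => expR (f x)).
Proof.
move=> oU; elim: k => [|k IH] Cf.
  by apply: Ck_comp0 Cf => x _; exact: continuous_expR.
apply: (Ck_comp oU (psi := expR)) => //; apply: IH; exact: Ck_pred.
Qed.

Lemma Ck_ln k U f : open U -> (forall x, U x -> 0 < f x) ->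
  Ck k U f -> Ck k U (fun x => ln (f x)).
Proof.
move=> oU f0; case: k => [|k] Cf.
  by apply: Ck_comp0 Cf => x /f0; exact: continuous_ln.
apply: (Ck_comp oU (psi := fun y => y^-1)) => //.
  by move=> x /f0 ?; exact: is_derive1_ln.
apply: Ck_inv => //; last exact: Ck_pred.
by move=> x /f0 /gt_eqF ->.
Qed.

Lemma Ck_sqrt k U f : open U -> (forall x, U x -> 0 < f x) ->
  Ck k U f -> Ck k U (fun x => Num.sqrt (f x)).
Proof.
move=> oU f0; elim: k => [|k IH] Cf.
  apply: Ck_comp0 Cf => x /f0 fx0.
  by apply: is_derive_continuous (is_derive1_sqrt fx0).
apply: (Ck_comp oU (psi := fun y => (2 * Num.sqrt y)^-1)) => //.
  by move=> x /f0 ?; exact: is_derive1_sqrt.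
apply: Ck_inv => //.
  by move=> x /f0 ?; rewrite mulf_neq0// gt_eqF// sqrtr_gt0.
by apply: CkM => //; [exact: Ck_cst|apply: IH; exact: Ck_pred].
Qed.

Lemma Ck_sin_cos k U f : open U -> Ck k U f ->
  Ck k U (fun x => sin (f x)) /\ Ck k U (fun x => cos (f x)).
Proof.
move=> oU; elim: k => [|k IH] Cf.
  by split; apply: Ck_comp0 Cf => x _; [exact: continuous_sin|exact: continuous_cos].
have [Cs Cc] := IH (Ck_pred Cf); split.
  exact: (Ck_comp oU (psi := cos)).
apply: (Ck_comp oU (psi := fun y => - sin y)) => //.
exact: CkN.
Qed.

Lemma Ck_atan k U f : open U -> Ck k U f -> Ck k U (fun x => atan (f x)).
Proof.
move=> oU; case: k => [|k] Cf.
  by apply: Ck_comp0 Cf => x _; exact: continuous_atan.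
apply: (Ck_comp oU (psi := fun y => (1 + y ^+ 2)^-1)) => //.
apply: Ck_inv => //.
  by move=> x _; rewrite gt_eqF// ltr_pwDl// sqr_ge0.
apply: CkD => //; first exact: Ck_cst.
by under eq_fun do rewrite expr2; apply: CkM => //; exact: Ck_pred.
Qed.

Lemma Ck_powR k U f (p : R) : open U -> (forall x, U x -> 0 < f x) ->
  Ck k U f -> Ck k U (fun x => f x `^ p).
Proof.
move=> oU f0 Cf; have Ce := Ck_expR oU (CkM oU (Ck_cst k U p) (Ck_ln oU f0 Cf)).
by apply: Ck_eq Ce => // x /f0 fx0; rewrite /powR gt_eqF.
Qed.

End Ck_functions.

Section vector_valued.
Variables (R : realType).

Lemma coord_norm_le n (v : 'rV[R]_n) i : `|v 0 i| <= `|v|.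
Proof. by rewrite [leRHS]/Num.Def.normr/= mx_normrE; exact: (le_bigmax _ _ (0, i)). Qed.

Lemma norm_le_coord n (v : 'rV[R]_n) e : 0 <= e -> (forall i, `|v 0 i| <= e) ->
  `|v| <= e.
Proof.
move=> e0 h; rewrite [leLHS]/Num.Def.normr/= mx_normrE; apply: bigmax_le => //.
by case=> i j _; rewrite /= ord1.
Qed.

Lemma rV_continuous (T : topologicalType) n (f : T -> 'rV[R]_n) x :
  (forall i, {for x, continuous (fun x => f x 0 i)}) -> {for x, continuous f}.
Proof.
move=> cf; apply/cvgrPdist_le => e e0.
near=> y; apply: norm_le_coord; first exact: ltW.
move=> i; rewrite !mxE; move: i; near: y; apply: filter_forall => i.
by have /cvgrPdist_le/(_ _ e0) := cf i.
Unshelve. all: by end_near. Qed.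

Lemma rV_differentiable (V : normedModType R) n (f : V -> 'rV[R]_n) x :
  (forall i, differentiable (fun x => f x 0 i) x) -> differentiable f x.
Proof.
move=> df; pose A (v : V) : 'rV[R]_n := \row_i 'd (fun x => f x 0 i) x v.
have lA : linear A.
  by move=> a u v; apply/rowP => i; rewrite !mxE linearP.
pose AL : {linear V -> 'rV[R]_n} := HB.pack A
  (GRing.isLinear.Build _ _ _ _ _ lA).
suff : is_diff x f AL by case.
apply: is_diff_eps.
  move=> v; apply: rV_continuous => i.
  rewrite (_ : (fun _ => _) = 'd (fun x => f x 0 i) x).
    exact: (diff_continuous (df i)).
  by apply/funext => y; rewrite mxE.
move=> e e0; near=> h; apply: norm_le_coord; first by rewrite mulr_ge0// ltW.
move=> i; rewrite !mxE; move: i; near: h; apply: filter_forall => i.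
exact: differentiable_epsP.
Unshelve. all: by end_near. Qed.

Lemma derivable_coord (V : normedModType R) n (f : V -> 'rV[R]_n) x v i :
  derivable f x v -> 'D_v (fun x => f x 0 i) x = ('D_v f x) 0 i.
Proof. by move=> df; rewrite derive_mx// mxE. Qed.

Lemma C_on_coord n m k (U : set 'rV[R]_n) (f : 'rV[R]_n -> 'rV[R]_m) : open U ->
  C_on k U f <-> forall i, Ck k U (fun x => f x 0 i).
Proof.
move=> oU; elim: k f => [|k IH] f; split.
- move=> cf i x Ux; apply: (@continuous_comp _ _ _ f (fun y : 'rV_m => y 0 i)).
    exact: cf.
  exact: coord_continuous.
- by move=> cf x Ux; apply: rV_continuous => i; exact: cf.
- move=> [df Df] i; split=> [x Ux|v].
    apply: (@differentiable_comp _ _ _ _ f (fun y : 'rV_m => y 0 i)).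
      exact: df.
    exact: differentiable_coord.
  have [+ _] := IH ('D_v f) => /(_ (Df v) i).
  apply: Ck_eq => // x Ux; rewrite derivable_coord//.
  by apply: diff_derivable; exact: df.
- move=> Cf; have df x : U x -> differentiable f x.
    by move=> Ux; apply: rV_differentiable => i; have [h _] := Cf i; exact: h.
  split=> // v; apply/IH => i; have [_ /(_ v)] := Cf i.
  apply: Ck_eq => // x Ux; rewrite derivable_coord//.
  by apply: diff_derivable; exact: df.
Qed.

Lemma smooth_on_coord n m (U : set 'rV[R]_n) (f : 'rV[R]_n -> 'rV[R]_m) :
  open U -> (forall i, smooth U (fun x => f x 0 i)) -> smooth_on U f.
Proof. by move=> oU h; split=> // k; apply/C_on_coord => // i; exact: h. Qed.

End vector_valued.

(** Completeness of the space of row vectors, on which the fixed point argument of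
    [contraction_ball] rests. *)
HB.instance Definition _ (R : realType) m n := Complete.on 'M[R]_(m, n).

(** * Strict differentiability, open mappings and smooth inverses *)

Section inverse_function.
Variables (R : realType).

Lemma is_derive_line (V W : normedModType R) (f : V -> W) x v (s : R) :
  derivable f (x + s *: v) v ->
  is_derive s 1 (fun s => f (x + s *: v)) ('D_v f (x + s *: v)).
Proof.
move=> df.
have E : (fun h : R => h^-1 *: (((fun s => f (x + s *: v)) \o shift s) (h *: 1)
   - f (x + s *: v))) =
  (fun h => h^-1 *: ((f \o shift (x + s *: v)) (h *: v) - f (x + s *: v))).
  apply/funext => h /=; congr (_ *: (f _ - _)).
  by rewrite [h *: 1]mulr1 scalerDl addrCA.
by apply: DeriveDef; rewrite /derivable /derive E.
Qed.

Lemma derive_expand n (f : 'rV[R]_n -> R) x v : differentiable f x ->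
  'D_v f x = \sum_j v 0 j * 'D_(delta_mx 0 j) f x.
Proof.
move=> df; rewrite deriveE// [in LHS](row_sum_delta v) linear_sum.
by apply: eq_bigr => j _; rewrite linearZ deriveE.
Qed.

Lemma mulmx_continuous n m (M : 'M[R]_(n, m)) :
  continuous (fun v : 'rV[R]_n => v *m M).
Proof.
move=> v; apply: rV_continuous => i.
have : Ck 0 setT (fun v : 'rV[R]_n => (v *m M) 0 i).
  apply: (@Ck_eq _ _ _ _ (fun v => \sum_j v 0 j * M j i)).
  - exact: openT.
  - by move=> x _; rewrite mxE.
  - apply: Ck_sum; first exact: openT.
    move=> j _; apply: CkM; [exact: openT|exact: Ck_coord|exact: Ck_cst].
by apply.
Qed.

Lemma mulmx_bounded n m (M : 'M[R]_(n, m)) :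
  exists2 C : R, 0 < C & forall v : 'rV[R]_n, `|v *m M| <= C * `|v|.
Proof.
have [C C0 H] := @linear_lipschitz R _ _ (mulmxr M : {linear 'rV_n -> 'rV_m})
  (@mulmx_continuous n m M).
by exists C.
Qed.

Lemma injective_unitmx n (M : 'M[R]_n) :
  (forall v : 'rV[R]_n, v *m M = 0 -> v = 0) -> M \in unitmx.
Proof.
move=> h; rewrite -row_free_unit -kermx_eq0; apply/eqP/row_matrixP => i.
by rewrite row0; apply: h; rewrite -row_mul mulmx_ker row0.
Qed.

Lemma Ck_compose n m k (V : set 'rV[R]_n) (U : set 'rV[R]_m)
    (g : 'rV[R]_n -> 'rV[R]_m) (h : 'rV[R]_m -> R) :
  open V -> open U -> (forall y, V y -> U (g y)) ->
  (forall i, Ck k V (fun y => g y 0 i)) -> Ck k U h -> Ck k V (h \o g).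
Proof.
move=> oV oU VU; elim: k h => [|k IH] h.
  move=> cg ch y Vy; apply: continuous_comp; last exact/ch/VU.
  by apply: rV_continuous => i; exact: cg.
move=> Cg [dh Dh].
have dg y : V y -> differentiable g y.
  by move=> Vy; apply: rV_differentiable => i; have [d _] := Cg i; exact: d.
split=> [y Vy|v].
  by apply: differentiable_comp; [exact: dg|exact/dh/VU].
have Cg' i : Ck k V (fun y => g y 0 i) by exact: Ck_pred.
apply: (@Ck_eq _ _ _ _ (fun y => \sum_j 'D_v (fun y => g y 0 j) y
  * ('D_(delta_mx 0 j) h \o g) y)) => //.
  move=> y Vy; rewrite deriveE; last first.
    by apply: differentiable_comp; [exact: dg|exact/dh/VU].
  rewrite diff_comp//; [|exact: dg|exact/dh/VU].
  rewrite /= -deriveE; last exact/dh/VU.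
  rewrite derive_expand; last exact/dh/VU.
  apply: eq_bigr => j _; congr (_ * _).
  rewrite -deriveE; last exact: dg.
  by rewrite derivable_coord//; apply/diff_derivable/dg.
apply: Ck_sum => // j _; apply: CkM => //.
  by have [_ +] := Cg j; exact.
exact: (IH _ Cg' (Dh _)).
Qed.

Lemma Ck_det n k p (V : set 'rV[R]_n) (M : 'rV[R]_n -> 'M[R]_p) : open V ->
  (forall i j, Ck k V (fun y => M y i j)) -> Ck k V (fun y => \det (M y)).
Proof.
move=> oV CM; apply: Ck_sum => // s _; apply: CkM => //; first exact: Ck_cst.
exact: Ck_prod.
Qed.

Lemma Ck_adj n k p (V : set 'rV[R]_n) (M : 'rV[R]_n -> 'M[R]_p) i j : open V ->
  (forall i j, Ck k V (fun y => M y i j)) -> Ck k V (fun y => (\adj (M y)) i j).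
Proof.
move=> oV CM.
apply: (@Ck_eq _ _ _ _ (fun y => cofactor (M y) j i)) => //.
  by move=> y _; rewrite mxE.
apply: CkM => //; first exact: Ck_cst.
apply: Ck_det => // a b.
apply: (Ck_eq oV _ (CM (lift j a) (lift i b))) => y _.
by rewrite !mxE.
Qed.

(** Strict differentiability: the mean value theorem is applied to each coordinate on the segment
    from y to x, which stays in the ball, where the partial derivatives are close to those at x0. *)
Lemma C1_strict_estimate n m (U : set 'rV[R]_n) (f : 'rV[R]_n -> 'rV[R]_m) x0
    (e : R) : open U -> C_on 1 U f -> U x0 -> 0 < e ->
  exists2 r : R, 0 < r & ball x0 r `<=` U /\ forall x y, ball x0 r x -> ball x0 r y ->
    `|f x - f y - 'd f x0 (x - y)| <= e * `|x - y|.
Proof.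
move=> oU /(C_on_coord _ _ oU) Cf Ux0 e0.
pose D i j := 'D_(delta_mx 0 j) (fun x => f x 0 i).
have df i x : U x -> differentiable (fun x => f x 0 i) x.
  by move=> Ux; have [d _] := Cf i; exact: d.
have dfx x : U x -> differentiable f x.
  by move=> Ux; apply: rV_differentiable => i; exact: df.
(* The n partial derivatives contribute at most n e' in total; n + 1 keeps the denominator
   nonzero. *)
pose e' := e / n.+1%:R.
have e'0 : 0 < e' by rewrite divr_gt0.
have : \forall x \near x0, U x /\ forall i j, `|D i j x0 - D i j x| <= e'.
  near=> x; split; first by near: x; exact: open_nbhs_nbhs.
  move=> i j; move: i j; near: x; apply: filter_forall => i.
  apply: filter_forall => j.
  have [_ /(_ (delta_mx 0 j))] := Cf i.
  by move=> /(_ x0 Ux0) /cvgrPdist_le; apply.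
move=> /nbhs_ballP[r /= r0 hr]; exists r => //; split.
  by move=> x /hr[].
move=> x y bx by_; apply: norm_le_coord; first by rewrite mulr_ge0// ltW.
move=> i; rewrite !mxE.
have bl s : s \in `[0, 1]%R -> ball x0 r (y + s *: (x - y)).
  rewrite in_itv/= => /andP[s0 s1].
  move: bx by_; rewrite -ball_normE /= => bx by_.
  have -> : x0 - (y + s *: (x - y)) = s *: (x0 - x) + (1 - s) *: (x0 - y).
    by rewrite scalerBl scale1r !scalerBr; apply/rowP => k; rewrite !mxE; ring.
  apply: le_lt_trans (ler_normD _ _) _.
  rewrite !normrZ (ger0_norm s0) ger0_norm ?subr_ge0//.
  have [->|sn0] := eqVneq s 0; first by rewrite mul0r add0r subr0 mul1r.
  have -> : r = s * r + (1 - s) * r by ring.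
  apply: ltr_leD; first by rewrite ltr_pM2l// lt_neqAle eq_sym sn0.
  by rewrite ler_wpM2l// ?subr_ge0// ltW.
pose v := x - y.
have [s sI] : exists2 s, s \in `[0, 1]%R & f x 0 i - f y 0 i = 'D_v (fun x => f x 0 i) (y + s *: v) * (1 - 0).
  have := @MVT_segment R (fun s => f (y + s *: v) 0 i) (fun s => 'D_v (fun x => f x 0 i) (y + s *: v)) 0 1 ler01.
  rewrite scale1r scale0r addr0 /v subrKC; apply.
    move=> s /subset_itv_oo_cc sI.
    apply: (@is_derive_line _ _ (fun x => f x 0 i)).
    by apply: diff_derivable; apply: df; have [] := hr _ (bl _ sI).
  apply: derivable_within_continuous => s sI.
  have [] := @is_derive_line _ _ (fun x => f x 0 i) y v s; last by [].
  by apply: diff_derivable; apply: df; have [] := hr _ (bl _ sI).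
rewrite subr0 mulr1 => ->.
have [Us hs] := hr _ (bl _ sI).
rewrite -/v derive_expand; last exact: df.
rewrite -deriveE; last exact: dfx.
rewrite -derivable_coord; last by apply: diff_derivable; exact: dfx.
rewrite derive_expand; last exact: df.
rewrite -sumrB; apply: le_trans (ler_norm_sum _ _ _) _.
apply: (@le_trans _ _ (\sum_(j < n) (e' * `|v|))).
  apply: ler_sum => j _; rewrite -mulrBr normrM mulrC ler_pM//.
    by rewrite distrC; exact: hs.
  exact: coord_norm_le.
rewrite sumr_const card_ord -mulr_natr mulrAC ler_wpM2r//.
rewrite /e' -mulrA ler_piMr ?(ltW e0)// mulrC ler_pdivrMr// mul1r.
by rewrite ler_nat.
Unshelve. all: by end_near. Qed.

Lemma contraction_ball n (T : 'rV[R]_n -> 'rV[R]_n) x0 (r : R) : 0 < r ->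
  (forall x, closed_ball x0 r x -> closed_ball x0 r (T x)) ->
  (forall x y, closed_ball x0 r x -> closed_ball x0 r y ->
     `|T x - T y| <= 2^-1 * `|x - y|) ->
  exists2 x, closed_ball x0 r x & T x = x.
Proof.
move=> r0 hT cT; set B := closed_ball x0 r in hT cT *.
have hT' : {homo T : x / B x >-> B x} by [].
pose Tf : {fun B >-> B} := HB.pack T (isFun.Build _ _ B B T hT').
have half0 : (0 : R) <= 2^-1 by rewrite invr_ge0.
have ct : is_contraction Tf.
  exists (NngNum half0); split; first by rewrite /= invf_lt1// ltr1n.
  by case=> x y /= [Bx By]; exact: cT.
have [||p Bp pE] := banach_fixed_point ct.
- exact: closed_ball_closed.
- by exists x0; exact: closed_ballxx.
- by exists p.
Qed.

Definition immersion_on n m (U : set 'rV[R]_n) (f : 'rV[R]_n -> 'rV[R]_m) :=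
  forall x v, U x -> 'd f x v = 0 -> v = 0.

Section equidimensional.
Variables (n : nat) (U : set 'rV[R]_n) (f : 'rV[R]_n -> 'rV[R]_n).
Hypotheses (oU : open U) (sf : smooth_on U f) (immf : immersion_on U f).

Let M x := lin1_mx ('d f x).

Let dM x v : 'd f x v = v *m M x.
Proof. by rewrite mul_rV_lin1. Qed.

Let Mu x : U x -> M x \in unitmx.
Proof.
by move=> Ux; apply: injective_unitmx => v; rewrite -dM; exact: immf.
Qed.

(** The invertible differential stretches vectors by at least C^-1, and half of this factor absorbs
    the error in [C1_strict_estimate]. The result gives local injectivity and a Lipschitz bound for
    the inverse. *)
Lemma local_expansion x0 : U x0 -> exists2 c : R, 0 < c &
  exists2 r : R, 0 < r & ball x0 r `<=` U /\
  forall x y, ball x0 r x -> ball x0 r y -> c * `|x - y| <= `|f x - f y|.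
Proof.
move=> Ux0; have [C C0 hC] := mulmx_bounded (invmx (M x0)).
have lb v : C^-1 * `|v| <= `|'d f x0 v|.
  rewrite ler_pdivrMl//; have := hC ('d f x0 v).
  by rewrite dM mulmxK// Mu.
pose c := C^-1 / 2; have c0 : 0 < c by rewrite divr_gt0// invr_gt0.
have [r r0 [rU hr]] := C1_strict_estimate oU (sf.2 1%N) Ux0 c0.
exists c => //; exists r => //; split=> // x y bx by_.
have := hr _ _ bx by_; have := lb (x - y).
have := ler_normB (f x - f y) (f x - f y - 'd f x0 (x - y)).
rewrite subKr; rewrite [C^-1](splitr C^-1) -/c mulrDl; lra.
Qed.

(** Newton iteration with the differential frozen at x0: for y close to f x0 the map T x = x - (f x
    - y) M(x0)^-1 halves distances and preserves a closed ball, and its fixed point is a preimage of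
    y. *)
Lemma open_mapping x0 (N : set 'rV[R]_n) : U x0 -> nbhs x0 N ->
  nbhs (f x0) (f @` N).
Proof.
move=> Ux0 nN; have [C C0 hC] := mulmx_bounded (invmx (M x0)).
have e0 : 0 < (2 * C)^-1 by rewrite invr_gt0 mulr_gt0.
have [r r0 [rU hr]] := C1_strict_estimate oU (sf.2 1%N) Ux0 e0.
have : nbhs x0 (ball x0 r `&` N) by apply: filterI => //; exact: nbhsx_ballx.
move=> /nbhs_closedballP[rp].
have : 0 < rp%:num by [].
move: rp%:num => r' r'0 sub.
(* With this radius T moves the centre by at most r' / 2, which leaves r' / 2 for the
   contraction. *)
apply/nbhs_ballP; exists (r' / (2 * C)) => /=.
  by apply: divr_gt0 => //; apply: mulr_gt0.
move=> y; rewrite -ball_normE/= => yb.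
pose T x := x - (f x - y) *m invmx (M x0).
have cT x z : closed_ball x0 r' x -> closed_ball x0 r' z ->
    `|T x - T z| <= 2^-1 * `|x - z|.
  move=> /sub[bx _] /sub[bz _].
  have -> : T x - T z = - ((f x - f z - 'd f x0 (x - z)) *m invmx (M x0)).
    rewrite mulmxBl dM mulmxK ?Mu// /T opprB (mulmxBl (f x)) (mulmxBl (f x) (f z)).
    rewrite (mulmxBl (f z) y); apply/rowP => i; rewrite !mxE; ring.
  rewrite normrN; apply: le_trans (hC _) _.
  have := hr _ _ bx bz; rewrite -(ler_pM2l C0) => /le_trans; apply.
  by rewrite mulrA invfM mulrCA divff ?gt_eqF// mulr1.
have hT x : closed_ball x0 r' x -> closed_ball x0 r' (T x).
  move=> bx; have bx0 : closed_ball x0 r' x0 by exact: closed_ballxx.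
  have h : `|T x0 - T x| <= r' / 2.
    rewrite mulrC; apply: le_trans (cT _ _ bx0 bx) _.
    by rewrite ler_pM2l ?invr_gt0//; move: bx; rewrite closed_ballE.
  rewrite closed_ballE// /closed_ball_ /=.
  have h0 : `|x0 - T x0| <= r' / 2.
    rewrite /T subKr; apply: le_trans (hC _) _.
    move: yb; rewrite -(ltr_pM2l C0) => /ltW/le_trans; apply.
    rewrite invfM mulrA [C * _]mulrC -mulrA; rewrite [leLHS](_ : _ = r' / 2)//.
    by field; rewrite gt_eqF.
  by apply: le_trans (ler_distD (T x0) _ _) _; rewrite (splitr r') lerD.
have [x Bx Tx] := contraction_ball r'0 hT cT.
have [_ Nx] := sub _ Bx; exists x => //.
move: Tx; rewrite /T => /eqP; rewrite subr_eq addrC -subr_eq subrr eq_sym => /eqP h0.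
have := mulmxKV (Mu Ux0) (f x - y); rewrite h0 mul0mx => /esym/eqP.
by rewrite subr_eq0 => /eqP.
Qed.

Lemma open_image (W : set 'rV[R]_n) : open W -> W `<=` U -> open (f @` W).
Proof.
move=> oW WU; rewrite openE => _ [x Wx <-].
by apply: open_mapping; [exact: WU|exact: open_nbhs_nbhs].
Qed.

Section inverse.
Variables (W : set 'rV[R]_n) (g : 'rV[R]_n -> 'rV[R]_n).
Hypotheses (oW : open W) (WU : W `<=` U) (gK : forall x, W x -> g (f x) = x).

Lemma inverse_continuous x : W x -> {for f x, continuous g}.
Proof.
move=> Wx; rewrite /prop_for /continuous_at gK// => N nN.
have : nbhs (f x) (f @` (N `&` W)).
  by apply: open_mapping; [exact: WU|apply: filterI => //; exact: open_nbhs_nbhs].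
by apply: filterS => _ [z [Nz Wz] <-] /=; rewrite gK.
Qed.

(** Strict differentiability of f at x bounds the error by a multiple of |z - x|, and
    [local_expansion] turns |z - x| into |f z - f x|; the constant e c / C is what makes the two
    combine to e. *)
Lemma inverse_is_diff x : W x -> is_diff (f x) g (mulmxr (invmx (M x))).
Proof.
move=> Wx; have Ux := WU Wx; apply: is_diff_eps; first exact: mulmx_continuous.
move=> e e0; have [c c0 [r r0 [rU hr]]] := local_expansion Ux.
have [C C0 hC] := mulmx_bounded (invmx (M x)).
have d0 : 0 < e * c / C by rewrite divr_gt0// mulr_gt0.
have [r' r'0 [_ hr']] := C1_strict_estimate oU (sf.2 1%N) Ux d0.
have nV : nbhs (f x) (f @` (W `&` ball x r `&` ball x r')).
  apply: open_mapping => //; apply: filterI; last exact: nbhsx_ballx.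
  by apply: filterI; [exact: open_nbhs_nbhs|exact: nbhsx_ballx].
have : \forall y \near f x, (f @` (W `&` ball x r `&` ball x r')) y by [].
rewrite (near_shift 0 (f x)); apply: filterS => h /= [z [[Wz bz] bz'] fzE].
have fz : f z = h + f x by rewrite fzE subr0.
rewrite -fz !gK//.
have hE : h = f z - f x by rewrite fz addrK.
have -> : z - x - h *m invmx (M x) =
    - ((f z - f x - 'd f x (z - x)) *m invmx (M x)).
  by rewrite mulmxBl dM mulmxK ?Mu// -hE opprB.
rewrite normrN; apply: le_trans (hC _) _.
have b0 : ball x r x by exact: ballxx.
have b0' : ball x r' x by exact: ballxx.
have := hr' _ _ bz' b0'; rewrite -(ler_pM2l C0) => /le_trans; apply.
rewrite hE (_ : C * _ = e * (c * `|z - x|)); last by field; rewrite gt_eqF.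
by rewrite ler_pM2l//; exact: hr.
Qed.

(** Bootstrapping: by Cramer's rule the partial derivatives of g are rational in those of f composed
    with g. If g is C^k they are C^k, so g is C^(k+1). *)
Lemma inverse_smooth : smooth_on (f @` W) g.
Proof.
have oV : open (f @` W) by exact: open_image.
apply: smooth_on_coord => // i k; move: i; elim: k => [|k IH] i.
  move=> _ [x Wx <-].
  apply: (@continuous_comp _ _ _ g (fun y : 'rV_n => y 0 i)).
    exact: inverse_continuous.
  exact: coord_continuous.
have dg y : (f @` W) y -> differentiable g y.
  by move=> [x Wx <-]; have [] := inverse_is_diff Wx.
split=> [y Vy|v].
  apply: (@differentiable_comp _ _ _ _ g (fun y : 'rV_n => y 0 i)).
    exact: dg.
  exact: differentiable_coord.
pose J y := \matrix_(a, b) 'D_(delta_mx 0 a) (fun x => f x 0 b) (g y).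
have CJ a b : Ck k (f @` W) (fun y => J y a b).
  apply: (@Ck_eq _ _ _ _ ('D_(delta_mx 0 a) (fun x => f x 0 b) \o g)) => //.
    by move=> y _; rewrite mxE.
  apply: (@Ck_compose _ _ _ _ U) => //.
    by move=> _ [x Wx <-]; rewrite gK//; exact: WU.
  by have /C_on_coord - /(_ oU b)[_] := sf.2 k.+1; exact.
have JE x : W x -> J (f x) = M x.
  move=> Wx; apply/matrixP => a b; rewrite !mxE gK//.
  have df : differentiable f x by have [+ _] := sf.2 1%N => /(_ _ (WU Wx)).
  rewrite derivable_coord; last exact: diff_derivable.
  by rewrite deriveE.
apply: (@Ck_eq _ _ _ _ (fun y => \sum_a v 0 a * ((\det (J y))^-1 * (\adj (J y)) a i))) => //.
  move=> _ [x Wx <-].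
  have dgx : differentiable g (f x) by apply: dg; exists x.
  rewrite derivable_coord; last exact: diff_derivable.
  rewrite deriveE//; have [_ ->] := inverse_is_diff Wx.
  rewrite /= /invmx Mu ?JE//; last exact: WU.
  rewrite mxE; apply: eq_bigr => a _; by rewrite !mxE.
apply: Ck_sum => // a _; apply: CkM => //; first exact: Ck_cst.
apply: CkM => //; last exact: Ck_adj.
apply: Ck_inv => //; last exact: Ck_det.
move=> _ [x Wx <-]; rewrite JE//; have := Mu (WU Wx).
by rewrite unitmxE unitfE.
Qed.

End inverse.

Lemma inverse_function_theorem : local_diffeomorphism U f.
Proof.
split=> // x0 Ux0; have [c c0 [r r0 [rU hr]]] := local_expansion Ux0.
have oW : open (ball x0 r) by exact: ball_open.
exists (ball x0 r); split => //.
- exact: ballxx.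
- split=> // k; apply/C_on_coord => // i; apply: Ck_sub rU _.
  by have /C_on_coord := sf.2 k; apply.
have injf x y : ball x0 r x -> ball x0 r y -> f x = f y -> x = y.
  move=> bx by_ fxy; have := hr _ _ bx by_; rewrite fxy subrr normr0.
  by rewrite pmulr_rle0// normr_le0 subr_eq0 => /eqP.
pose g y := xget 0 [set x | ball x0 r x /\ f x = y].
have gK x : ball x0 r x -> g (f x) = x.
  move=> bx; rewrite /g; case: xgetP => [z -> [bz fz]|]; first exact: injf.
  by move=> /(_ x); case.
by exists g; split=> //; exact: inverse_smooth.
Qed.

(** Between spaces of equal dimension an immersion is open, so the set-theoretic inverse is
    automatically continuous on the image. *)
Lemma injective_embedding : (forall x y, U x -> U y -> f x = f y -> x = y) ->
  smooth_embedding U f.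
Proof.
move=> injf; split=> //.
pose g y := xget 0 [set x | U x /\ f x = y].
have gK x : U x -> g (f x) = x.
  move=> bx; rewrite /g; case: xgetP => [z -> [bz fz]|]; first exact: injf.
  by move=> /(_ x); case.
exists g; split=> //; apply: continuous_in_subspaceT => y.
by rewrite inE => -[x Ux <-]; exact: (inverse_continuous (W := U)).
Qed.

End equidimensional.
End inverse_function.

(** * Differentiation rules for explicit expressions *)

Section is_derive_lambda.
Variables (R : realType) (V : normedModType R).
Implicit Types (f g : V -> R) (x v : V).

Lemma is_derD f g x v (a b : R) : is_derive x v f a -> is_derive x v g b ->
  is_derive x v (fun t => f t + g t) (a + b).
Proof. by move=> *; exact: is_deriveD. Qed.

Lemma is_derB f g x v (a b : R) : is_derive x v f a -> is_derive x v g b ->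
  is_derive x v (fun t => f t - g t) (a - b).
Proof. by move=> *; exact: is_deriveB. Qed.

Lemma is_derM f g x v (a b : R) : is_derive x v f a -> is_derive x v g b ->
  is_derive x v (fun t => f t * g t) (a * g x + f x * b).
Proof.
move=> fa gb; have h := is_deriveM fa gb; apply: is_derive_eq h _.
by rewrite /GRing.scale/= addrC [a * _]mulrC.
Qed.

Lemma is_derMl f (c : R) x v (a : R) : is_derive x v f a ->
  is_derive x v (fun t => c * f t) (c * a).
Proof.
move=> fa; have := is_derM (is_derive_cst c x v) fa; rewrite mul0r add0r.
exact.
Qed.

Lemma is_derX2 f x v (a : R) : is_derive x v f a ->
  is_derive x v (fun t => f t ^+ 2) (2 * f x * a).
Proof.
move=> fa; have := is_derM fa fa; rewrite (_ : _ + _ = 2 * f x * a); last by ring.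
exact.
Qed.

Lemma is_derV f x v (a : R) : f x != 0 -> is_derive x v f a ->
  is_derive x v (fun t => (f t)^-1) (- (f x ^- 2 * a)).
Proof.
move=> f0 [df <-]; apply: DeriveDef; first exact: derivableV.
by rewrite deriveV// /GRing.scale/= mulNr.
Qed.

Lemma is_der_sum (I : Type) (r : seq I) (P : pred I) (f : I -> V -> R) x v
    (a : I -> R) : (forall i, is_derive x v (f i) (a i)) ->
  is_derive x v (fun t => \sum_(i <- r | P i) f i t) (\sum_(i <- r | P i) a i).
Proof.
move=> h; elim: r => [|i r IH].
  rewrite big_nil; under eq_fun do rewrite big_nil; exact: is_derive_cst.
rewrite big_cons; under eq_fun do rewrite big_cons.
by case: ifP => _ //; exact: is_derD.
Qed.

End is_derive_lambda.

Lemma is_derc (R : realType) (f g : R -> R) (x a b : R) :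
  is_derive (g x) 1 f a -> is_derive x 1 g b ->
  is_derive x 1 (fun t => f (g t)) (a * b).
Proof. by move=> fa gb; exact: (is_derive1_comp fa gb). Qed.

(** * Trigonometry of the model planes *)

Section trigonometry.
Variable R : realType.
Implicit Types (K : geometry) (x y : R).

Definition sinh x : R := (expR x - expR (- x)) / 2.
Definition cosh x : R := (expR x + expR (- x)) / 2.

(** [sn] and [cn] solve y'' = - kappa y with the initial values of sine and cosine, so that one set
    of formulas serves all three geometries. *)
Definition sn K x : R :=
  match K with Euclidean => x | Spherical => sin x | Hyperbolic => sinh x end.
Definition cn K x : R :=
  match K with Euclidean => 1 | Spherical => cos x | Hyperbolic => cosh x end.
Definition ct K x : R := cn K x / sn K x.
Local Notation kappa := (curvature R).

Lemma expRN_mul x : expR x * expR (- x) = 1.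
Proof. by rewrite -expRD subrr expR0. Qed.

Lemma snD K x y : sn K (x + y) = sn K x * cn K y + cn K x * sn K y.
Proof.
case: K => /=; [ring|exact: sinD|].
by rewrite /sinh /cosh opprD !expRD; field.
Qed.

Lemma cnD K x y : cn K (x + y) = cn K x * cn K y - kappa K * (sn K x * sn K y).
Proof.
case: K => /=; [ring|by rewrite cosD mul1r|].
by rewrite /sinh /cosh opprD !expRD; field.
Qed.

Lemma snN K x : sn K (- x) = - sn K x.
Proof. by case: K => //=; [exact: sinN|rewrite /sinh opprK; field]. Qed.

Lemma cnN K x : cn K (- x) = cn K x.
Proof. by case: K => //=; [exact: cosN|rewrite /cosh opprK addrC]. Qed.

Lemma snB K x y : sn K (x - y) = sn K x * cn K y - cn K x * sn K y.
Proof. by rewrite snD snN cnN mulrN. Qed.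

Lemma cnB K x y : cn K (x - y) = cn K x * cn K y + kappa K * (sn K x * sn K y).
Proof. by rewrite cnD snN cnN !mulrN opprK. Qed.

Lemma cn2sn2 K x : cn K x ^+ 2 + kappa K * sn K x ^+ 2 = 1.
Proof.
case: K => /=; [by rewrite expr1n mul0r addr0|by rewrite mul1r cos2Dsin2|].
by rewrite -[RHS](expRN_mul x) /sinh /cosh; field.
Qed.

Lemma sn0 K : sn K 0 = 0.
Proof. by case: K => //=; [exact: sin0|rewrite /sinh oppr0 subrr mul0r]. Qed.

Lemma is_derive_expRN x : is_derive x 1 (fun t => expR (- t)) (- expR (- x)).
Proof.
have := is_derc (is_derive_expR (- x)) (is_deriveNid x 1).
by rewrite mulrN1.
Qed.

Lemma is_derive_sn K x : is_derive x 1 (sn K) (cn K x).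
Proof.
case: K => /=; [exact: is_derive_id|exact: is_derive_sin|].
have := is_derMl 2^-1 (is_derB (is_derive_expR x) (is_derive_expRN x)).
rewrite opprK mulrC -/(cosh x); under eq_fun do rewrite mulrC; exact.
Qed.

Lemma is_derive_cn K x : is_derive x 1 (cn K) (- kappa K * sn K x).
Proof.
case: K => /=; [|by rewrite mulN1r; exact: is_derive_cos|].
  by rewrite oppr0 mul0r; exact: is_derive_cst.
have := is_derMl 2^-1 (is_derD (is_derive_expR x) (is_derive_expRN x)).
rewrite opprK mul1r mulrC -/(sinh x); under eq_fun do rewrite mulrC; exact.
Qed.

(** The lengths that sides of triangles can have; on them [sn] is positive. *)
Definition good K x := (0 < x) && (if K is Spherical then x < pi else true).

Lemma good_gt0 K x : good K x -> 0 < x. Proof. by case/andP. Qed.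

Lemma good_le K x y : 0 < x -> x <= y -> good K y -> good K x.
Proof.
by case: K => x0 xy /andP[_ h]; rewrite /good x0//= (le_lt_trans xy h).
Qed.

Lemma sinh_gt0 x : 0 < x -> 0 < sinh x.
Proof.
move=> x0; rewrite /sinh divr_gt0// subr_gt0 ltr_expR; lra.
Qed.

Lemma sn_gt0 K x : good K x -> 0 < sn K x.
Proof.
case: K => /andP[x0 h] //=; first by rewrite sin_gt0_pi// x0 h.
exact: sinh_gt0.
Qed.

Lemma Ck_sn n k K (U : set 'rV[R]_n) f : open U -> Ck k U f ->
  Ck k U (fun z => sn K (f z)).
Proof.
case: K => /= oU Cf //; first by have [] := Ck_sin_cos oU Cf.
apply: CkM => //; last exact: Ck_cst.
by apply: CkB => //; apply: Ck_expR => //; exact: CkN.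
Qed.

Lemma ct_sum K x y : 0 < sn K x -> 0 < sn K y ->
  ct K x + ct K y = sn K (x + y) / (sn K x * sn K y).
Proof. by move=> *; rewrite snD /ct; field; rewrite !gt_eqF. Qed.

Lemma ctD K x y : good K (x + y) -> good K x -> good K y ->
  ct K (x + y) = (ct K x * ct K y - kappa K) / (ct K x + ct K y).
Proof.
move=> /sn_gt0 gxy /sn_gt0 gx /sn_gt0 gy.
by rewrite ct_sum// /ct cnD; field; rewrite !gt_eqF.
Qed.

Lemma ct_sum_gt0 K x y : good K (x + y) -> good K x -> good K y ->
  0 < ct K x + ct K y.
Proof.
move=> /sn_gt0 gxy /sn_gt0 gx /sn_gt0 gy.
by rewrite ct_sum// divr_gt0// mulr_gt0.
Qed.

(** Eliminating ct (x + y) by the addition formula completes the square. The sign of the curvature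
    decides whether the form is positive; the three-variable form [Qform] is handled by applying
    this twice. *)
Lemma ct_form K x y p q : good K (x + y) -> good K x -> good K y ->
  ct K x * p ^+ 2 + ct K y * q ^+ 2 - ct K (x + y) * (p + q) ^+ 2 =
  ((ct K x * p - ct K y * q) ^+ 2 + kappa K * (p + q) ^+ 2) / (ct K x + ct K y).
Proof.
move=> gxy gx gy; rewrite ctD//; have := ct_sum_gt0 gxy gx gy => h.
by field; rewrite gt_eqF.
Qed.

End trigonometry.

(** * Sine and cosine in terms of the tangent of the half angle *)

Section half_angle.
Variable R : realType.
Implicit Types (t : R).

Lemma sin_cos_atan t : sin (atan t) = t * cos (atan t) /\
  cos (atan t) ^+ 2 = (1 + t ^+ 2)^-1.
Proof.
have h0 : 0 < 1 + t ^+ 2 by rewrite ltr_pwDl// sqr_ge0.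
split; last first.
  by rewrite cos_atan exprVn sqr_sqrtr// ltW.
have h := atanK t; rewrite /tan in h; rewrite -[in RHS]h.
rewrite [in RHS]h -[X in X * _]h divfK//.
by rewrite cos_atan invr_eq0 gt_eqF// sqrtr_gt0.
Qed.

Lemma sin_2atan t : sin (2 * atan t) = 2 * t / (1 + t ^+ 2).
Proof.
have [s c] := sin_cos_atan t.
by rewrite mulr_natl sin_mulr2n s -c; ring.
Qed.

Lemma cos_2atan t : cos (2 * atan t) = (1 - t ^+ 2) / (1 + t ^+ 2).
Proof.
have h0 : 0 < 1 + t ^+ 2 by rewrite ltr_pwDl// sqr_ge0.
have [s c] := sin_cos_atan t.
rewrite mulr_natl cos_mulr2n c; field; by rewrite gt_eqF.
Qed.

Lemma two_atan_itv t : 0 < t -> 0 < 2 * atan t < pi.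
Proof.
move=> t0; have := @atan_ltpi2 R t; have := lt_atan t0; rewrite atan0.
by move=> *; apply/andP; split; lra.
Qed.

End half_angle.

(** * Derivative of an oriented integral in its end point *)

Section integrals.
Variable R : realType.
Local Notation mu := (@lebesgue_measure R).

(** The integrand is controlled only inside ]p, q[ and may fail to be integrable up to the ends, as
    happens for negative exponents. The fundamental theorem is therefore applied on a compact
    [p', q'] around a and x, where the oriented integral is a difference of values of one
    primitive. *)
Lemma is_derive_oriented_integral (f : R -> R) (p q a x : R) :
  p < a < q -> p < x < q -> (forall t, p < t < q -> {for t, continuous f}) ->
  is_derive x 1 (fun y => oriented_integral a y f) (f x).
Proof.
move=> /andP[pa aq] /andP[px xq] cf.
pose p' := (p + Num.min a x) / 2; pose q' := (q + Num.max a x) / 2.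
have pm : p < Num.min a x by rewrite lt_min pa.
have qm : Num.max a x < q by rewrite gt_max aq.
have pp' : p < p' by rewrite /p'; lra.
have q'q : q' < q by rewrite /q'; lra.
have [p'a p'x] : p' < a /\ p' < x.
  by apply/andP; rewrite -lt_min /p'; lra.
have [aq' xq'] : a < q' /\ x < q'.
  by apply/andP; rewrite -gt_max /q'; lra.
have fint u v : p' <= u -> v <= q' -> mu.-integrable `[u, v] (EFin \o f).
  move=> pu vq; apply: continuous_compact_integrable.
    exact: segment_compact.
  apply: continuous_in_subspaceT => t; rewrite inE /= in_itv/= => /andP[ut tv].
  by apply: cf; rewrite (lt_le_trans pp')/=; [rewrite (le_lt_trans _ q'q)//; lra|lra].
pose F y := \int[mu]_(t in `[p', y]) f t.
have FE u v : p' <= u -> u <= v -> v <= q' ->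
    \int[mu]_(t in `[u, v]) f t = F v - F u.
  move=> pu uv vq; have -> : F v - F u = \int[mu]_(t in `]u, v]) f t.
    by apply: (@Rintegral_itvB R f (BLeft p') (BRight v) u);
      rewrite ?bnd_simp//; exact: fint.
  rewrite Rintegral_itv_obnd_cbnd//.
  apply: integrableS (fint u v pu vq) => //; exact: subset_itv_oc_cc.
have [dF DF] : derivable F x 1 /\ F^`() x = f x.
  apply: (continuous_FTC1_closed xq') => //; first exact: fint.
  by apply: cf; rewrite px.
apply: (@near_eq_is_derive _ _ _ (fun y => F y - F a)).
  have : \forall y \near x, p' < y /\ y < q'.
    by near=> y; split; near: y; [exact: lt_nbhsr|exact: lt_nbhsl].
  apply: filterS => y [/ltW py /ltW yq]; rewrite /oriented_integral.
  case: leP => ay; first by rewrite FE// ltW.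
  by rewrite FE//; [rewrite opprB|exact: ltW|exact: ltW].
have DF' : is_derive x 1 F (f x) by apply: DeriveDef; rewrite -?derive1E.
by have := is_deriveB DF' (is_derive_cst (F a) x 1); rewrite subr0.
Unshelve. all: by end_near. Qed.

End integrals.

(** * Half-angle formula, cosine rule and sine rule in terms of the deficits *)

Section triangles.
Variable R : realType.
Implicit Types (K : geometry) (W a b c : R).

(** The classical half-angle formula for tan (A / 2), where W is the semi-perimeter, a, b, c are its
    differences with the three sides, and A is opposite to the side b + c. *)
Definition tau K W a b c : R :=
  Num.sqrt (sn K b * sn K c / (sn K a * sn K W)).

Definition ang K W a b c : R := 2 * atan (tau K W a b c).

Section positive.
Variables (K : geometry) (W a b c : R).
Hypotheses (W0 : good K W) (a0 : good K a) (b0 : good K b) (c0 : good K c).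

Let sW0 := sn_gt0 W0.
Let sa0 := sn_gt0 a0.
Let sb0 := sn_gt0 b0.
Let sc0 := sn_gt0 c0.

Lemma tau_gt0 : 0 < tau K W a b c.
Proof. by rewrite /tau sqrtr_gt0 divr_gt0// mulr_gt0. Qed.

Lemma tau_sqr : tau K W a b c ^+ 2 = sn K b * sn K c / (sn K a * sn K W).
Proof. by rewrite sqr_sqrtr// ltW// divr_gt0// mulr_gt0. Qed.

Lemma ang_itv : 0 < ang K W a b c < pi.
Proof. exact: two_atan_itv tau_gt0. Qed.

End positive.

(** Logarithmic differentiation: the logarithm of tan^2 (theta / 2) is a signed sum of logarithms of
    [sn], and d log tan (theta / 2) = dtheta / sin theta. *)
Lemma is_derive_ang K (W a b c : R -> R) (s W' a' b' c' : R) :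
  good K (W s) -> good K (a s) -> good K (b s) -> good K (c s) ->
  is_derive s 1 W W' -> is_derive s 1 a a' -> is_derive s 1 b b' ->
  is_derive s 1 c c' ->
  is_derive s 1 (fun s => ang K (W s) (a s) (b s) (c s))
    (sin (ang K (W s) (a s) (b s) (c s)) *
     ((ct K (b s) * b' + ct K (c s) * c' - ct K (a s) * a' - ct K (W s) * W') / 2)).
Proof.
move=> gW ga gb gc dW da db dc.
have [sW sa] := (sn_gt0 gW, sn_gt0 ga); have [sb sc] := (sn_gt0 gb, sn_gt0 gc).
have dsn (f : R -> R) f' : is_derive s 1 f f' ->
    is_derive s 1 (fun s => sn K (f s)) (cn K (f s) * f').
  by move=> df; apply: is_derc => //; exact: is_derive_sn.
have den : sn K (a s) * sn K (W s) != 0 by rewrite gt_eqF// mulr_gt0.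
have dP := is_derM (is_derM (dsn _ _ db) (dsn _ _ dc))
  (is_derV (f := fun s => sn K (a s) * sn K (W s)) den
    (is_derM (dsn _ _ da) (dsn _ _ dW))).
have P0 : 0 < sn K (b s) * sn K (c s) / (sn K (a s) * sn K (W s)).
  by rewrite divr_gt0// mulr_gt0.
have dtau := is_derc (g := fun s => sn K (b s) * sn K (c s) /
  (sn K (a s) * sn K (W s))) (is_derive1_sqrt P0) dP.
have dang := is_derMl 2 (is_derc (g := fun s => tau K (W s) (a s) (b s) (c s))
  (is_derive1_atan _) dtau).
apply: is_derive_eq dang _.
rewrite -/(tau K (W s) (a s) (b s) (c s)) sin_2atan.
have := tau_sqr gW ga gb gc; have := tau_gt0 gW ga gb gc.
move: (tau _ _ _ _ _) => t t0 t2.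
rewrite (_ : (cn K (b s) * b' * _ + _) * _ + _ =
  t ^+ 2 * (ct K (b s) * b' + ct K (c s) * c' - ct K (a s) * a' - ct K (W s) * W')).
  have h : 1 + t ^+ 2 != 0 by rewrite gt_eqF// ltr_pwDl// sqr_ge0.
  by field; rewrite ?h ?(gt_eqF t0)//=; apply/andP.
by rewrite t2 /ct; field; rewrite !gt_eqF.
Qed.

Lemma Ck_ang n k K (U : set 'rV[R]_n) (W a b c : 'rV[R]_n -> R) : open U ->
  (forall x, U x -> [/\ good K (W x), good K (a x), good K (b x) & good K (c x)]) ->
  Ck k U W -> Ck k U a -> Ck k U b -> Ck k U c ->
  Ck k U (fun x => ang K (W x) (a x) (b x) (c x)).
Proof.
move=> oU g CW Ca Cb Cc; apply: CkM => //; first exact: Ck_cst.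
apply: Ck_atan => //; apply: Ck_sqrt => //.
  by move=> x /g[*]; rewrite divr_gt0// mulr_gt0// sn_gt0.
apply: Ck_div => //.
- by move=> x /g[*]; rewrite mulf_neq0// gt_eqF// sn_gt0.
- by apply: CkM => //; exact: Ck_sn.
- by apply: CkM => //; exact: Ck_sn.
Qed.

(* The semi-perimeter deficits of a triangle: its sides are the sums of two of
   them, and its semi-perimeter is the sum of all three. *)
Definition deficits K a b c :=
  [/\ 0 < a, 0 < b, 0 < c & good K (a + b + c)].

Lemma deficits_rot K a b c : deficits K a b c -> deficits K b c a.
Proof. by case=> *; split=> //; rewrite (addrC _ a) addrA. Qed.

Lemma deficits_good K a b c : deficits K a b c ->
  [/\ good K a, good K b & good K c] /\
  [/\ good K (b + c), good K (c + a) & good K (a + b)].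
Proof.
by case=> a0 b0 c0 g; split; split; apply: good_le g; lra.
Qed.

(** It says that 1 + tau^2 = sn (a + b) sn (a + c) / (sn a sn (a + b + c)), from which both the
    cosine rule and the sine rule follow. Multiplying sn b sn c by cn^2 + kappa sn^2 = 1 makes the
    identity polynomial. *)
Lemma sn_prod K a b c : sn K a * sn K (a + b + c) + sn K b * sn K c =
  sn K (a + b) * sn K (a + c).
Proof.
have := cn2sn2 K a; rewrite !snD cnD => h.
have -> : sn K b * sn K c = (cn K a ^+ 2 + curvature R K * sn K a ^+ 2) * (sn K b * sn K c).
  by rewrite h mul1r.
ring.
Qed.

Lemma cos_ang K a b c : deficits K a b c ->
  cos (ang K (a + b + c) a b c) =
  1 - 2 * (sn K b * sn K c) / (sn K (a + b) * sn K (a + c)).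
Proof.
move=> d; have [[ga gb gc] [gbc gca gab]] := deficits_good d.
have [_ _ _ gW] := d; rewrite cos_2atan tau_sqr// -sn_prod.
have [sW sa] := (sn_gt0 gW, sn_gt0 ga); have [sb sc] := (sn_gt0 gb, sn_gt0 gc).
have h : 0 < sn K a * sn K (a + b + c) + sn K b * sn K c.
  by rewrite addr_gt0// mulr_gt0.
field; by rewrite !gt_eqF// addrC.
Qed.

(** The common ratio of the sine of an angle to [sn] of the opposite side; its symmetry in the
    deficits is the content of the sine rule. *)
Definition sine_ratio K a b c : R :=
  2 * Num.sqrt (sn K a * sn K b * sn K c * sn K (a + b + c)) /
  (sn K (b + c) * sn K (c + a) * sn K (a + b)).

Lemma sine_ratio_rot K a b c : sine_ratio K a b c = sine_ratio K b c a.
Proof.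
rewrite /sine_ratio (_ : b + c + a = a + b + c); last by ring.
congr (_ * Num.sqrt _ / _); ring.
Qed.

Lemma sine_ratio_gt0 K a b c : deficits K a b c -> 0 < sine_ratio K a b c.
Proof.
move=> d; have [[ga gb gc] [gbc gca gab]] := deficits_good d.
have [_ _ _ gW] := d.
have [sW sa] := (sn_gt0 gW, sn_gt0 ga); have [sb sc] := (sn_gt0 gb, sn_gt0 gc).
have [[? ?] ?] := (sn_gt0 gbc, sn_gt0 gca, sn_gt0 gab).
by rewrite divr_gt0 ?mulr_gt0// sqrtr_gt0 !mulr_gt0.
Qed.

Lemma sine_rule K a b c : deficits K a b c ->
  sin (ang K (a + b + c) a b c) = sine_ratio K a b c * sn K (b + c).
Proof.
move=> d; have [[ga gb gc] [gbc gca gab]] := deficits_good d.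
have [_ _ _ gW] := d; rewrite sin_2atan tau_sqr//.
have [sW sa] := (sn_gt0 gW, sn_gt0 ga); have [sb sc] := (sn_gt0 gb, sn_gt0 gc).
have [[s1 s2] s3] := (sn_gt0 gbc, sn_gt0 gca, sn_gt0 gab).
have -> : tau K (a + b + c) a b c =
    Num.sqrt (sn K a * sn K b * sn K c * sn K (a + b + c)) / (sn K a * sn K (a + b + c)).
  have p0 : 0 < sn K a * sn K (a + b + c) by rewrite mulr_gt0.
  rewrite /tau (_ : _ / _ = (sn K a * sn K b * sn K c * sn K (a + b + c)) /
    (sn K a * sn K (a + b + c)) ^+ 2); last by field; rewrite !gt_eqF.
  rewrite sqrtrM; last by rewrite !mulr_ge0// ltW.
  by rewrite sqrtrV ?sqr_ge0// sqrtr_sqr ger0_norm// ltW.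
rewrite /sine_ratio; move: (Num.sqrt _) => q.
have := sn_prod K a b c; rewrite (addrC a c).
move: (sn K (b + c)) (sn K (c + a)) (sn K (a + b)) s1 s2 s3 => x y z x0 y0 z0.
move: (sn K a) (sn K b) (sn K c) (sn K (a + b + c)) sa sb sc sW => ta tb tc tW a0 b0 c0 W0 h.
have -> : 1 + tb * tc / (ta * tW) = z * y / (ta * tW).
  by rewrite -h; field; rewrite !gt_eqF.
by field; rewrite !gt_eqF.
Qed.

End triangles.

(** * Triangles in the model planes *)

Section model_triangles.
Variable R : realType.
Implicit Types (K : geometry) (a b c : R) (x y z : 'rV[R]_3).
Local Notation kappa := (curvature R).

Lemma det33 (M : 'M[R]_3) : \det M =
  M 0 0 * (M 1 1 * M 2 2 - M 1 2 * M 2 1)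
  - M 0 1 * (M 1 0 * M 2 2 - M 1 2 * M 2 0)
  + M 0 2 * (M 1 0 * M 2 1 - M 1 1 * M 2 0).
Proof.
rewrite (expand_det_row _ 0) !big_ord_recl big_ord0 /cofactor.
rewrite !(expand_det_row _ 0) !big_ord_recl !big_ord0 /cofactor !det_mx11 !mxE.
have [m E] : exists m : nat -> nat -> R, forall i j, M i j = m (val i) (val j).
  by exists (fun i j => M (inord i) (inord j)) => i j; rewrite !inord_val.
rewrite !E /= /bump /=; ring.
Qed.

Lemma det_rows x y z : \det (\matrix_(i < 3) nth 0 [:: x; y; z] i) =
  x 0 0 * (y 0 1 * z 0 2 - y 0 2 * z 0 1)
  - x 0 1 * (y 0 0 * z 0 2 - y 0 2 * z 0 0)
  + x 0 2 * (y 0 0 * z 0 1 - y 0 1 * z 0 0).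
Proof. by rewrite det33 !mxE. Qed.

(* [tri K a b c]: there is a triangle with sides a, b, c; see
   [triangle_withP] and [triangle_exists]. *)
Definition tri K a b c :=
  deficits K ((b + c - a) / 2) ((c + a - b) / 2) ((a + b - c) / 2).

Definition tri_angle K a b c : R :=
  ang K ((a + b + c) / 2) ((b + c - a) / 2) ((c + a - b) / 2) ((a + b - c) / 2).

Lemma sn_ge0 K (t : R) : 0 <= t -> (K = Spherical -> t <= pi) -> 0 <= sn K t.
Proof.
case: K => /= t0 h //; first by apply: sin_ge0_pi; rewrite t0 h.
by rewrite /sinh divr_ge0// subr_ge0 ler_expR; lra.
Qed.

Lemma sn_le0 K (t : R) : t <= 0 -> (K = Spherical -> - pi <= t) -> sn K t <= 0.
Proof.
move=> t0 h; rewrite -oppr_ge0 -snN; apply: sn_ge0; first by rewrite oppr_ge0.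
by move=> /h; rewrite lerNl.
Qed.

(** Up to a factor, the product is the squared determinant of the vertices (Heron). If a deficit is
    nonpositive, its [sn] is nonpositive and the three other factors are nonnegative; on the sphere
    the same happens when the semi-perimeter reaches pi. Either way the product would not be
    positive. *)
Lemma tri_of_prod K a b c : 0 <= a -> 0 <= b -> 0 <= c ->
  (K = Spherical -> [/\ a <= pi, b <= pi & c <= pi]) ->
  0 < sn K ((b + c - a) / 2) * sn K ((c + a - b) / 2) * sn K ((a + b - c) / 2)
    * sn K ((a + b + c) / 2) -> tri K a b c.
Proof.
move=> a0 b0 c0 h.
have pi0 := @pi_ge0 R.
set p := (b + c - a) / 2; set q := (c + a - b) / 2; set r := (a + b - c) / 2.
set W := (a + b + c) / 2 => P0.
have sneg (t u v w : R) : t <= 0 -> 0 <= u -> 0 <= v -> 0 <= w ->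
    (K = Spherical -> [/\ - pi <= t, u <= pi, v <= pi & w <= pi]) ->
    sn K t * sn K u * sn K v * sn K w <= 0.
  move=> t0 u0 v0 w0 ht; have tn : sn K t <= 0 by apply: sn_le0 => // /ht[].
  have [un vn wn] : [/\ 0 <= sn K u, 0 <= sn K v & 0 <= sn K w].
    by split; apply: sn_ge0 => // /ht[].
  by rewrite -!mulrA mulr_le0_ge0// !mulr_ge0.
have np : 0 < p.
  rewrite ltNge; apply/negP => p0; move: P0; rewrite ltNge => /negP; apply.
  by apply: sneg => //; rewrite /p /q /r /W in p0 *; [lra..|move=> /h[? ? ?]; split; lra].
have nq : 0 < q.
  rewrite ltNge; apply/negP => p0; move: P0.
  rewrite ltNge (mulrC (sn K p)) => /negP; apply.
  by apply: sneg => //; rewrite /p /q /r /W in p0 *; [lra..|move=> /h[? ? ?]; split; lra].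
have nr : 0 < r.
  rewrite ltNge; apply/negP => p0; move: P0.
  rewrite ltNge (mulrC _ (sn K r)) mulrA => /negP; apply.
  by apply: sneg => //; rewrite /p /q /r /W in p0 *; [lra..|move=> /h[? ? ?]; split; lra].
split=> //; rewrite (_ : p + q + r = W); last by rewrite /p /q /r /W; lra.
rewrite /good; apply/andP; split; first by rewrite /W; rewrite /p in np; lra.
clear sneg; case: K h P0 => //= /(_ erefl)[ha hb hc] P0.
rewrite ltNge; apply/negP => Wpi.
suff : sn Spherical p * sn Spherical q * sn Spherical r * sin W <= 0.
  by rewrite leNgt P0.
apply: mulr_ge0_le0.
  by rewrite !mulr_ge0// sn_ge0// ?(ltW np) ?(ltW nq) ?(ltW nr)// => _;
    rewrite /p /q /r /W in Wpi np nq nr *; lra.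
rewrite -(subrK pi W) sinDpi oppr_le0 sin_ge0_pi// subr_ge0 Wpi/=.
rewrite /W; lra.
Qed.

Lemma kappa2 K : K <> Euclidean -> kappa K * kappa K = 1.
Proof. by case: K => //= _; ring. Qed.

Lemma arcoshK (t : R) : 1 <= t -> 0 <= arcosh t /\ cosh (arcosh t) = t.
Proof.
move=> t1; rewrite /arcosh; set s := Num.sqrt _.
have s0 : 0 <= s by exact: sqrtr_ge0.
have s2 : s ^+ 2 = t ^+ 2 - 1.
  by rewrite sqr_sqrtr// subr_ge0 expr_ge1// (le_trans ler01 t1).
have e0 : 0 < t + s by lra.
split; first by rewrite ln_ge0//; lra.
rewrite /cosh expRN lnK ?posrE//.
have -> : (t + s)^-1 = t - s.
  apply: (mulfI (lt0r_neq0 e0)); rewrite divff ?lt0r_neq0//.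
  have -> : (t + s) * (t - s) = t ^+ 2 - s ^+ 2 by ring.
  by rewrite s2; ring.
by field.
Qed.

Lemma cosh_gt0 (t : R) : 0 < cosh t.
Proof. by rewrite divr_gt0// addr_gt0// expR_gt0. Qed.

Lemma arcosh_cosh (t : R) : 0 <= t -> arcosh (cosh t) = t.
Proof.
move=> t0; rewrite /arcosh.
have h := cn2sn2 Hyperbolic t; rewrite /= in h.
have -> : cosh t ^+ 2 - 1 = sinh t ^+ 2 by rewrite -h; ring.
rewrite sqrtr_sqr ger0_norm; last by apply: (@sn_ge0 Hyperbolic).
have -> : cosh t + sinh t = expR t by rewrite /cosh /sinh; field.
exact: expRK.
Qed.

Lemma cosine_rule_deficits K p q r : cn K (q + r) =
  cn K (r + p) * cn K (p + q) +
  kappa K * (sn K (p + r) * sn K (p + q) - 2 * (sn K q * sn K r)).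
Proof.
have -> : cn K (r + p) * cn K (p + q) + kappa K * (sn K (p + r) * sn K (p + q) -
  2 * (sn K q * sn K r)) = cn K (r - q) - 2 * (kappa K * (sn K q * sn K r)).
  have -> : r - q = (r + p) - (p + q) by ring.
  by rewrite (cnB K (r + p)) (addrC p r); ring.
by rewrite cnD cnB; ring.
Qed.

(** The Cauchy-Schwarz inequality, reversed on the hyperboloid, puts the form into the range where
    acos or arcosh is a genuine inverse. *)
Lemma curved_dist K x y : K <> Euclidean -> plane K x -> plane K y ->
  ambient_form K x y = kappa K * cn K (dist K x y) /\ 0 <= dist K x y /\
  (K = Spherical -> dist K x y <= pi).
Proof.
case: K => [[]//| _ /= | _ /=].
  rewrite /ambient_form /= !mul1r => Px Py.
  set t := _ + _ + _; have t1 : -1 <= t <= 1.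
    have := sqr_ge0 (x 0 0 - y 0 0); have := sqr_ge0 (x 0 1 - y 0 1).
    have := sqr_ge0 (x 0 2 - y 0 2); have := sqr_ge0 (x 0 0 + y 0 0).
    have := sqr_ge0 (x 0 1 + y 0 1); have := sqr_ge0 (x 0 2 + y 0 2).
    by rewrite /t => *; apply/andP; split; nra.
  split; first by rewrite acosK.
  by split; [exact: acos_ge0|move=> _; exact: acos_lepi].
rewrite /ambient_form /= => -[Px x0] [Py y0]; set t := _ + _ + _.
have t1 : 1 <= - t.
  rewrite /t; move: (x 0 0) (x 0 1) (x 0 2) (y 0 0) (y 0 1) (y 0 2) Px Py x0 y0.
  move=> a p q b u v Px Py a0 b0.
  have [h|h] := leP (1 + p * u + q * v) 0.
    have : 0 < a * b by rewrite mulr_gt0.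
    lra.
  have : (1 + p * u + q * v) ^+ 2 <= (a * b) ^+ 2.
    have := sqr_ge0 (p - u); have := sqr_ge0 (q - v).
    have := sqr_ge0 (p * v - q * u).
    have -> : (a * b) ^+ 2 = (1 + p ^+ 2 + q ^+ 2) * (1 + u ^+ 2 + v ^+ 2).
      by rewrite exprMn; congr (_ * _); rewrite !expr2; lra.
    by move=> *; lra.
  have ab0 := mulr_gt0 a0 b0.
  by rewrite ler_pXn2r ?nnegrE ?(ltW h) ?(ltW ab0)//; lra.
have [? ->] := arcoshK t1; split; last by [].
by rewrite mulN1r opprK.
Qed.

(** The form has matrix diag(kappa, 1, 1) and kappa^2 = 1, so the squared determinant is kappa times
    the Gram determinant, which is then expanded with kappa on the diagonal. *)
Lemma curved_gram K x y z : K <> Euclidean ->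
  plane K x -> plane K y -> plane K z ->
  \det (\matrix_(i < 3) nth 0 [:: x; y; z] i) ^+ 2 =
  (1 - ambient_form K x y ^+ 2) * (1 - ambient_form K x z ^+ 2)
   - (ambient_form K y z - kappa K * ambient_form K x y * ambient_form K x z) ^+ 2.
Proof.
rewrite det_rows.
have pE t : K <> Euclidean -> plane K t -> ambient_form K t t = kappa K.
  by clear; case: K => [[]//|//|_ []].
move=> K0 /(pE _ K0) + /(pE _ K0) + /(pE _ K0).
rewrite /ambient_form.
move: (x 0 0) (x 0 1) (x 0 2) (y 0 0) (y 0 1) (y 0 2) (z 0 0) (z 0 1) (z 0 2).
move=> a b c d e f g h i; have := kappa2 K0; move: (kappa K) => k kk Px Py Pz.
pose A := k * a * a + b * b + c * c; pose B := k * d * d + e * e + f * f.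
pose C := k * g * g + h * h + i * i.
pose X := k * a * d + b * e + c * f; pose Y := k * a * g + b * h + c * i.
pose Z := k * d * g + e * h + f * i.
transitivity (k * (A * B * C + 2 * X * Y * Z - A * Z ^+ 2 - B * Y ^+ 2 - C * X ^+ 2)).
  rewrite /A /B /C /X /Y /Z; ring: kk.
rewrite /A /B /C Px Py Pz -/X -/Y -/Z; ring: kk.
Qed.

Lemma tri_halves a b c : let p := (b + c - a) / 2 in let q := (c + a - b) / 2 in
  let r := (a + b - c) / 2 in
  [/\ p + q + r = (a + b + c) / 2, q + r = a, r + p = b & p + q = c] /\ p + r = b.
Proof. by split; [split|]; lra. Qed.

Lemma acos_cos_ang K (p q r : R) : deficits K p q r ->
  acos ((sn K (p + r) * sn K (p + q) - 2 * (sn K q * sn K r)) /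
    (sn K (p + r) * sn K (p + q))) = ang K (p + q + r) p q r.
Proof.
move=> d; have [[ga gb gc] [gbc gca gab]] := deficits_good d.
have [_ _ _ gW] := d; rewrite addrC in gca.
have s1 := sn_gt0 gca; have s2 := sn_gt0 gab.
rewrite -[RHS]cosK; last first.
  by have /andP[/ltW h1 /ltW h2] := ang_itv gW ga gb gc; rewrite in_itv/= h1.
congr acos; rewrite cos_ang//; field; by rewrite !gt_eqF.
Qed.

Lemma euclid_dot x y z : plane Euclidean x -> plane Euclidean y ->
  plane Euclidean z ->
  let u := y - x in let v := z - x in
  [/\ dist Euclidean x y ^+ 2 = ambient_form Euclidean u u,
      dist Euclidean z x ^+ 2 = ambient_form Euclidean v v,
      dist Euclidean y z ^+ 2 = ambient_form Euclidean u u +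
        ambient_form Euclidean v v - 2 * ambient_form Euclidean u v &
      \det (\matrix_(i < 3) nth 0 [:: x; y; z] i) ^+ 2 =
        ambient_form Euclidean u u * ambient_form Euclidean v v
        - ambient_form Euclidean u v ^+ 2].
Proof.
move=> /= x1 y1 z1; rewrite det_rows /ambient_form /= !mxE x1 y1 z1.
by rewrite !sqr_sqrtr; do ?[split; ring]; rewrite ?mul0r ?add0r addr_ge0//
  -?expr2 sqr_ge0.
Qed.

(** In each geometry the squared determinant is (sn b sn c)^2 - N^2, with N the product of the
    unnormalised directions at x. By [sn_prod] this difference of squares is four times the product
    in [tri_of_prod], so nondegeneracy gives the triangle inequalities, and N / (sn b sn c) gives
    the angle. *)
Lemma triangle_withP K a b c x y z : triangle_with K a b c x y z ->
  tri K a b c /\ angle_at K x y z = tri_angle K a b c.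
Proof.
move=> [[Px Py Pz] [nd [da db dc]]].
have det0 : 0 < \det (\matrix_(i < 3) nth 0 [:: x; y; z] i) ^+ 2.
  by rewrite exprn_even_gt0//=.
set p := (b + c - a) / 2; set q := (c + a - b) / 2; set r := (a + b - c) / 2.
have [[hW ha hb hc] hb'] := tri_halves a b c; rewrite -/p -/q -/r in hW ha hb hc hb'.
set N := sn K (p + r) * sn K (p + q) - 2 * (sn K q * sn K r).
have N2 : (sn K (p + r) * sn K (p + q)) ^+ 2 - N ^+ 2 =
    4 * (sn K p * sn K q * sn K r * sn K (p + q + r)).
  rewrite /N; have := sn_prod K p q r; rewrite (mulrC (sn K (p + q))) => <-; ring.
suff [fa fpos hN] : [/\ [/\ 0 <= a, 0 <= b & 0 <= c],
    K = Spherical -> [/\ a <= pi, b <= pi & c <= pi] &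
    [/\ \det (\matrix_(i < 3) nth 0 [:: x; y; z] i) ^+ 2 = (sn K b * sn K c) ^+ 2 - N ^+ 2,
     ambient_form K (direction K x y) (direction K x y) = sn K c ^+ 2,
     ambient_form K (direction K x z) (direction K x z) = sn K b ^+ 2 &
     ambient_form K (direction K x y) (direction K x z) = N]].
  have [a0 b0 c0] := fa; have [hd h1 h2 h3] := hN.
  have T : tri K a b c.
    apply: tri_of_prod => //; rewrite -/p -/q -/r -hW.
    move: det0; rewrite hd -[X in sn K X * _]hb' -[X in _ * sn K X]hc N2.
    by rewrite pmulr_rgt0.
  split=> //; rewrite /angle_at h1 h2 h3 !sqrtr_sqr.
  have [[ga gb gc] [gbc gca gab]] := deficits_good T.
  have sb : 0 < sn K b by rewrite -[b]hb'; rewrite addrC in gca; exact: sn_gt0.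
  have sc : 0 < sn K c by rewrite -[c]hc; exact: sn_gt0.
  rewrite !ger0_norm ?(ltW sb) ?(ltW sc)//.
  rewrite /tri_angle -/p -/q -/r -hW -acos_cos_ang//.
  by rewrite /N !hb' !hc (mulrC (sn K c)).
have [KE|KE] := pselect (K = Euclidean).
  move: Px Py Pz da db dc @N N2; rewrite KE => Px Py Pz da db dc N N2.
  have [e1 e2 e3 e4] := euclid_dot Px Py Pz.
  split; [by rewrite -da -db -dc; split; exact: sqrtr_ge0|by []|].
  rewrite -/(dist Euclidean x y) in dc *.
  rewrite dc db da in e1 e2 e3.
  have eN : ambient_form Euclidean (y - x) (z - x) = N.
    rewrite /N /= /p /q /r; lra.
  by rewrite /= e4 -e1 -e2 eN; split=> //; ring.
have cd s t := @curved_dist K s t KE.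
have [xy [c0 cpi]] := cd _ _ Px Py; have [yz [a0 api]] := cd _ _ Py Pz.
have [zx [b0 bpi]] := cd _ _ Pz Px.
rewrite dc in xy c0 cpi; rewrite da in yz a0 api; rewrite db in zx b0 bpi.
have symf s t : ambient_form K s t = ambient_form K t s.
  by rewrite /ambient_form; ring.
rewrite symf in zx.
have kk := kappa2 KE.
have hN : ambient_form K y z - kappa K * ambient_form K x y * ambient_form K x z = N.
  rewrite xy yz zx -[in cn K a]ha (cosine_rule_deficits K p) hb hc -/N.
  by rewrite /N !hb' !hc; ring: kk.
have pE t : plane K t -> ambient_form K t t = kappa K.
  by move: KE; clear; case: K => [[]//|//|_ []].
have sq t : 1 - (kappa K * cn K t) ^+ 2 = kappa K * sn K t ^+ 2.
  by rewrite -(cn2sn2 K t); ring: kk.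
have sq2 t : kappa K - kappa K * (kappa K * cn K t) * (kappa K * cn K t) = sn K t ^+ 2.
  transitivity (kappa K * (kappa K * sn K t ^+ 2)); first by rewrite -sq; ring.
  by rewrite mulrA kk mul1r.
have dirE s t : direction K s t = t - (kappa K * ambient_form K s t) *: s.
  by move: KE; clear; case: K => [[]//|//|//].
have dirf s t : ambient_form K (direction K x s) (direction K x t) =
    ambient_form K s t - kappa K * ambient_form K x s * ambient_form K x t.
  have := pE _ Px; rewrite !dirE /ambient_form !mxE.
  move: (x 0 0) (x 0 1) (x 0 2) (s 0 0) (s 0 1) (s 0 2) (t 0 0) (t 0 1) (t 0 2).
  move: kk; move: (kappa K) => k kk x0 x1 x2 s0 s1 s2 t0 t1 t2 hx.
  pose xs := k * x0 * s0 + x1 * s1 + x2 * s2.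
  pose xt := k * x0 * t0 + x1 * t1 + x2 * t2.
  transitivity (k * s0 * t0 + s1 * t1 + s2 * t2 - 2 * k * xs * xt +
      k ^+ 2 * xs * xt * (k * x0 * x0 + x1 * x1 + x2 * x2)).
    by rewrite /xs /xt; ring.
  by rewrite hx -/xs -/xt; ring: kk.
split; [by []|by move=> KS; rewrite api ?bpi ?cpi|split].
- by rewrite (curved_gram KE Px Py Pz) hN xy zx !sq; ring: kk.
- by rewrite dirf pE// xy sq2.
- by rewrite dirf pE// zx sq2.
- by rewrite dirf.
Qed.

Lemma tri_gt0 K a b c : tri K a b c -> [/\ good K a, good K b & good K c].
Proof.
move=> /deficits_good[_]; have [[_ -> -> ->] _] := tri_halves a b c.
by case.
Qed.

Lemma cosine_rule K a b c : tri K a b c -> cn K a =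
  cn K b * cn K c + kappa K * (sn K b * sn K c * cos (tri_angle K a b c)).
Proof.
move=> T; have [gb gc] : good K b /\ good K c by case: (tri_gt0 T).
have := cosine_rule_deficits K ((b + c - a) / 2) ((c + a - b) / 2) ((a + b - c) / 2).
have [[hW ha hb hc] hb'] := tri_halves a b c; rewrite ha hb hc hb' => ->.
rewrite /tri_angle -hW cos_ang// hb' hc.
have [sb sc] := (sn_gt0 gb, sn_gt0 gc).
by congr (_ + _ * _); field; rewrite !gt_eqF.
Qed.

Lemma triangle_exists K a b c : tri K a b c ->
  exists x y z : 'rV[R]_3, triangle_with K a b c x y z.
Proof.
move=> T; have [ga gb gc] := tri_gt0 T; set t := tri_angle K a b c.
have [[g1 g2 g3] _] := deficits_good T.
have [_ _ _ gW] := T; have [[hW ha hb hc] hb'] := tri_halves a b c.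
have [sa [sb sc]] := (sn_gt0 ga, (sn_gt0 gb, sn_gt0 gc)).
have st : 0 < sin t.
  by apply: sin_gt0_pi; rewrite /t /tri_angle -hW; exact: ang_itv.
have cs := cos2Dsin2 t.
have cr := cosine_rule T; rewrite -/t in cr.
have ce : sn K b * sn K c * cos t = sn K b * sn K c -
    2 * (sn K ((c + a - b) / 2) * sn K ((a + b - c) / 2)).
  rewrite /t /tri_angle -hW cos_ang// hb' hc; field; by rewrite !gt_eqF.
pose mk (u v w : R) : 'rV[R]_3 := \row_(i < 3) nth 0 [:: u; v; w] i.
have mkE u v w : [/\ mk u v w 0 0 = u, mk u v w 0 1 = v & mk u v w 0 2 = w].
  by rewrite !mxE.
(* Polar coordinates at the base point x: y lies at distance c on the first axis, z at distance b in
   the direction of angle t. *)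
pose x := mk 1 0 0; pose y := mk (cn K c) (sn K c) 0.
pose z := mk (cn K b) (sn K b * cos t) (sn K b * sin t).
have [[x0 x1 x2] [y0 y1 y2]] := (mkE 1 0 0, mkE (cn K c) (sn K c) 0).
have [z0 z1 z2] := mkE (cn K b) (sn K b * cos t) (sn K b * sin t).
rewrite -/x in x0 x1 x2; rewrite -/y in y0 y1 y2; rewrite -/z in z0 z1 z2.
exists x, y, z.
have sc2 u : sn K u ^+ 2 = (sn K u * cos t) ^+ 2 + (sn K u * sin t) ^+ 2.
  by rewrite -[LHS]mulr1 -cs; ring.
have nd : nondegenerate_triangle x y z.
  rewrite /nondegenerate_triangle det_rows x0 x1 x2 y0 y1 y2.
  by rewrite z2 (_ : _ + _ = sn K c * (sn K b * sin t)) ?mulf_neq0 ?gt_eqF//; ring.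
clear st mkE; move: x y z x0 x1 x2 y0 y1 y2 z0 z1 z2 nd cr ce cs sc2 => /=.
clear mk; move: t; case: K T ga gb gc g1 g2 g3 gW sa sb sc
  => T ga gb gc g1 g2 g3 gW sa sb sc t x y z x0 x1 x2 y0 y1 y2 z0 z1 z2 nd cr ce cs sc2.
- split; [by []|split; [by []|]].
  have dE (u : R) v w : 0 < u -> ambient_form Euclidean (w - v) (w - v) = u ^+ 2 ->
      dist Euclidean v w = u.
    by move=> u0 /= ->; rewrite sqrtr_sqr ger0_norm// ltW.
  have := sc2 b; rewrite /= in sa sb sc ce * => sc2b.
  split; apply: dE => //; rewrite /ambient_form /= !mxE ?(x0, x1, x2, y0, y1, y2, z0, z1, z2) /=; lra.
- split; last split; [| by [] |].
    rewrite /= /ambient_form /= x0 x1 x2 y0 y1 y2 z0 z1 z2 /=.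
    have := cn2sn2 Spherical b; have := cn2sn2 Spherical c; have := sc2 b.
    by rewrite /= !mul1r => -> <- <-; split; ring.
  have aK (u : R) : good Spherical u -> acos (cos u) = u.
    move=> /andP[/ltW u0 /ltW upi]; apply: cosK; by rewrite in_itv/= u0.
  rewrite /= /ambient_form /= x0 x1 x2 y0 y1 y2 z0 z1 z2 /=.
  split.
  + by rewrite -[RHS]aK//; congr acos; rewrite /= in cr; rewrite cr; ring.
  + by rewrite -[RHS]aK//; congr acos; ring.
  + by rewrite -[RHS]aK//; congr acos; ring.
- have cK (u : R) : good Hyperbolic u -> arcosh (cosh u) = u.
    by move=> /andP[/ltW u0 _]; exact: arcosh_cosh.
  split; last split; [| by [] |].
    rewrite /= /ambient_form /= x0 x1 x2 y0 y1 y2 z0 z1 z2 /=.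
    have := cn2sn2 Hyperbolic b; have := cn2sn2 Hyperbolic c; have := sc2 b.
    rewrite /= => e1 e2 e3; split; split; rewrite ?cosh_gt0 ?ltr01//.
    + by ring.
    + by lra.
    + by lra.
  rewrite /= /ambient_form /= x0 x1 x2 y0 y1 y2 z0 z1 z2 /=; split.
  + by rewrite -[RHS]cK//; congr arcosh; rewrite /= in cr; rewrite cr; ring.
  + by rewrite -[RHS]cK//; congr arcosh; ring.
  + by rewrite -[RHS]cK//; congr arcosh; ring.
Qed.

(** [xget] picks an unspecified triangle with these sides; by [triangle_withP] its angle depends on
    the sides alone. *)
Lemma inner_angleE K a b c : tri K a b c -> inner_angle K a b c = tri_angle K a b c.
Proof.
move=> /triangle_exists[x [y [z h]]]; rewrite /inner_angle; case: xgetP.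
  by move=> _ -> [x' [y' [z' [/triangle_withP[_ E] ->]]]].
by move=> /(_ (angle_at K x y z)); case; exists x, y, z.
Qed.

End model_triangles.

(** * Paths of triangles *)

Section paths.
Variable R : realType.
Implicit Types (K : geometry) (s t x y : R).

Lemma good_near K x : good K x -> \forall y \near x, good K y.
Proof.
case: K => /andP[x0 xpi]; rewrite /good.
- by near=> y; rewrite andbT; near: y; exact: lt_nbhsr.
- by near=> y; apply/andP; split; near: y; [exact: lt_nbhsr|exact: lt_nbhsl].
- by near=> y; rewrite andbT; near: y; exact: lt_nbhsr.
Unshelve. all: by end_near. Qed.

Lemma good_between K x y z : good K x -> good K y -> x <= z <= y -> good K z.
Proof.
by move=> /good_gt0 x0 gy /andP[xz zy]; apply: good_le zy gy; exact: lt_le_trans xz.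
Qed.

Lemma MVT_closed (f df : R -> R) (a b : R) : a < b ->
  (forall x, a <= x <= b -> is_derive x 1 f (df x)) ->
  exists2 c, a < c < b & f b - f a = df c * (b - a).
Proof.
move=> ab dfE; have [|//|c] := @MVT R f df a b ab.
- by move=> x /subset_itv_oo_cc; rewrite in_itv/=; exact: dfE.
- apply: derivable_within_continuous => x; rewrite in_itv/= => /dfE[].
  by [].
by rewrite in_itv/= => cI ->; exists c.
Qed.

Lemma good_increasing K (h k : R -> R) x y :
  (forall x, good K x -> is_derive x 1 h (k x)) ->
  (forall x, good K x -> 0 < k x) ->
  good K x -> good K y -> x < y -> h x < h y.
Proof.
move=> dh k0 gx gy xy.
have [z /andP[xz zy] E] : exists2 c, x < c < y & h y - h x = k c * (y - x).
  by apply: MVT_closed => // z zI; apply: dh; exact: good_between zI.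
rewrite -subr_gt0 E mulr_gt0 ?subr_gt0//; apply: k0.
by apply: (good_between gx gy); rewrite !ltW.
Qed.

Lemma good_inj K (h k : R -> R) x y :
  (forall x, good K x -> is_derive x 1 h (k x)) ->
  (forall x, good K x -> 0 < k x) ->
  good K x -> good K y -> h x = h y -> x = y.
Proof.
move=> dh k0 gx gy E; have [xy|xy|//] := ltgtP x y.
- by have := good_increasing dh k0 gx gy xy; rewrite E ltxx.
- by have := good_increasing dh k0 gy gx xy; rewrite E ltxx.
Qed.

(** Motion at constant speed in the coordinate [h], whose derivative is [k]. *)
Definition hpath K (h k : R -> R) a0 a1 (f : R -> R) :=
  [/\ f 0 = a0, f 1 = a1 &
    forall s, 0 <= s <= 1 -> [/\ good K (f s),
      h (f s) = h a0 + s * (h a1 - h a0) &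
      is_derive s 1 f ((h a1 - h a0) / k (f s))]].

Lemma inverse_path K (h k : R -> R) a0 a1 :
  (forall x, good K x -> is_derive x 1 h (k x)) ->
  (forall x, good K x -> 0 < k x) -> good K a0 -> good K a1 ->
  exists f : R -> R, hpath K h k a0 a1 f.
Proof.
move=> dh k0 g0 g1; have hinj := good_inj dh k0.
pose g y := xget a0 [set x | good K x /\ h x = y].
have gK x : good K x -> g (h x) = x.
  move=> gx; rewrite /g; case: xgetP => [z -> [gz hz]|]; first exact: hinj.
  by move=> /(_ x); case.
pose lin s := h a0 + s * (h a1 - h a0).
have iv a b s : a <= b -> good K a -> good K b -> 0 <= s <= 1 ->
    exists2 x, good K x & h x = h a + s * (h b - h a).
  move=> ab ga gb /andP[s0 s1].
  have hab : h a <= h b.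
    by move: ab; rewrite le_eqVlt => /predU1P[->//|/(good_increasing dh k0 ga gb)/ltW].
  have [||x xI hx] := @IVT R h a b (h a + s * (h b - h a)) ab.
  - apply: derivable_within_continuous => x; rewrite in_itv/= => xI.
    by have [] := dh _ (good_between ga gb xI).
  - rewrite ge_min le_max lerDl mulr_ge0 ?subr_ge0//=; apply/orP; right.
    by rewrite -[leRHS](subrKC (h a)) lerD2l ler_piMl// subr_ge0.
  - by rewrite in_itv/= in xI; exists x => //; exact: good_between xI.
have ivt s : 0 <= s <= 1 -> exists2 x, good K x & h x = lin s.
  move=> /[dup] /andP[s0 s1] sI; have [le01|/ltW le10] := leP a0 a1; first exact: iv.
  have [|x gx E] := iv a1 a0 (1 - s) le10 g1 g0.
    by apply/andP; split; lra.
  by exists x => //; rewrite E /lin; ring.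
have gE s x : good K x -> h x = lin s -> g (lin s) = x by move=> gx <-; exact: gK.
exists (g \o lin); split.
- by rewrite /= (gE _ a0)// /lin mul0r addr0.
- by rewrite /= (gE _ a1)// /lin mul1r subrKC.
move=> s sI; have [x gx hx] := ivt _ sI; rewrite /= (gE _ _ gx hx); split=> //.
have dlin : is_derive s 1 lin (h a1 - h a0).
  have := is_derD (is_derive_cst (h a0) s 1) (is_derM (is_derive_id s 1)
    (is_derive_cst (h a1 - h a0) s 1)).
  by rewrite mulr0 addr0 mul1r add0r.
have dg : is_derive (lin s) 1 g (k x)^-1.
  rewrite -hx; apply: is_derive_inverse.
  - by near=> z; apply: gK; near: z; exact: good_near.
  - near=> z; have gz : good K z by near: z; exact: good_near.
    exact: is_derive_continuous (dh _ gz).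
  - exact: dh.
  - by rewrite gt_eqF// k0.
by rewrite mulrC; exact: (is_derc dg dlin).
Unshelve. all: by end_near. Qed.

Section minimum.
Variables (D D' D'' : R -> R).
Hypothesis dD : forall s, 0 <= s <= 1 -> is_derive s 1 D (D' s).
Hypothesis dD' : forall s, 0 <= s <= 1 -> is_derive s 1 D' (D'' s).
Hypotheses (D0 : 0 < D 0) (D1 : 0 < D 1).

Let minD : exists2 c, 0 <= c <= 1 & (forall s, 0 <= s <= 1 -> D c <= D s) /\
  (D c <= 0 -> 0 < c < 1 /\ D' c = 0).
Proof.
have cD : {within `[0, 1], continuous D}.
  apply: derivable_within_continuous => x; rewrite in_itv/= => /dD[].
  by [].
have [c cI cmin] := EVT_min ler01 cD; rewrite in_itv/= in cI.
exists c => //; split=> [s sI|Dc]; first by apply: cmin; rewrite in_itv.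
have c01 : 0 < c < 1.
  case/andP: cI => c0 c1; apply/andP; split; rewrite lt_neqAle ?c0 ?c1 andbT.
    by apply: contraTneq Dc => <-; rewrite -ltNge.
  by apply: contraTneq Dc => ->; rewrite -ltNge.
split=> //.
have oc (x : R) : x \in `]0, 1[%R -> 0 <= x <= 1.
  by rewrite in_itv/= => /andP[/ltW -> /ltW ->].
have := @derive1_at_min R D 0 1 c ler01 _ _ _ => -[].
- by move=> t /oc/dD[].
- by rewrite in_itv.
- by move=> t /oc/cmin; apply; rewrite in_itv.
by move=> _; have [_ ->] := dD cI.
Qed.

Lemma path_pos : (forall s, 0 < s < 1 -> D s <= 0 -> D' s = 0 -> D'' s < 0) ->
  forall s, 0 <= s <= 1 -> 0 < D s.
Proof.
move=> H s sI; have [c cI [cmin hc]] := minD.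
have [Dc|Dc] := ltP 0 (D c); first exact: lt_le_trans (cmin _ sI).
have [c01 D'c] := hc Dc.
exfalso; have D''c := H _ c01 Dc D'c.
(* The slope function of D' at c is continuous and negative at c. As D' vanishes at c, D decreases
   just to the right of c, against minimality. *)
have /is_derive1_caratheodory[g [gE gc gcE]] := dD' cI.
have : \forall z \near c, g z < 0.
  apply: (cvgr_lt (g c) gc); by rewrite gcE.
move=> /nbhs_ballP[r /= r0 hr].
case/andP: c01 => c0 c1.
pose e := Num.min (r / 2) (1 - c).
have e0 : 0 < e by rewrite lt_min divr_gt0//= subr_gt0.
have er : e < r by rewrite /e gt_min; apply/orP; left; lra.
have ec : c + e <= 1 by rewrite -lerBrDl /e ge_min lexx orbT.
have cce : c < c + e by rewrite ltrDl.
have [|x /andP[cx xe] E] := @MVT_closed D D' c (c + e) cce.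
  by move=> x /andP[cx xe]; apply: dD; apply/andP; split; lra.
have : D (c + e) < D c.
  rewrite -subr_lt0 E addrAC subrr add0r nmulr_rlt0//.
  have := gE x; rewrite D'c subr0 => ->; rewrite nmulr_rlt0 ?subr_gt0//.
  apply: hr; rewrite -ball_normE /= distrC ger0_norm; lra.
by rewrite ltNge cmin// ; apply/andP; split; lra.
Qed.

(** The borderline case of a constant density, where no strict concavity is available: D' is
    constant, so if it vanished at an interior minimum, D would keep its value at 0, which is
    positive. *)
Lemma path_pos_affine : (forall s, 0 <= s <= 1 -> D'' s = 0) ->
  forall s, 0 <= s <= 1 -> 0 < D s.
Proof.
move=> H s sI; have [c cI [cmin hc]] := minD.
have [Dc|Dc] := ltP 0 (D c); first exact: lt_le_trans (cmin _ sI).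
have [c01 D'c] := hc Dc.
exfalso; case/andP: c01 => c0 c1.
have D'0 x : 0 <= x <= c -> D' x = 0.
  move=> /andP[x0]; rewrite le_eqVlt => /predU1P[->//|xc].
  have [|y /andP[xy yc]] := @MVT_closed D' D'' x c xc.
    by move=> y /andP[xy yc]; apply: dD'; apply/andP; split; lra.
  rewrite H ?mul0r ?D'c ?sub0r; last by apply/andP; split; lra.
  by move/eqP; rewrite oppr_eq0 => /eqP.
have [|y /andP[y0 yc]] := @MVT_closed D D' 0 c c0.
  by move=> y /andP[xy yc]; apply: dD; apply/andP; split; lra.
rewrite D'0 ?mul0r; last by rewrite !ltW.
by move/eqP; rewrite subr_eq0 => /eqP E; move: Dc; rewrite E leNgt D0.
Qed.

End minimum.

Section persistence.
Variables (K : geometry) (h k eta : R -> R) (w d : R).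
Hypothesis dh : forall x, good K x -> is_derive x 1 h (k x).
Hypothesis k0 : forall x, good K x -> 0 < k x.
Hypothesis dk : forall x, good K x -> is_derive x 1 k (k x * eta x).
Hypothesis w0 : 0 < w.
(** [eta] is the logarithmic derivative of [k]. The constants w and d deform the triangle inequality
    a < b + c: in the Euclidean plane the form with w = 1 and d = 0 vanishes on scalings, and only a
    positive d makes the inequality strict. The other two geometries take w = 1, d = 0. *)
Hypothesis eta_convex : (forall x, good K x -> eta x = 0) \/
  forall x y z p q r, good K x -> good K y -> good K z ->
    x + y + d <= w * z -> w * r = p + q -> p != 0 \/ q != 0 ->
    w * (eta z * r ^+ 2) < eta x * p ^+ 2 + eta y * q ^+ 2.

(* At an interior minimum of [b + c + d - w * a] along the paths the second
   derivative would be negative, by [eta_convex]. *)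
Lemma triangle_inequality_path a0 a1 b0 b1 c0 c1 (a b c : R -> R) :
  good K a0 -> good K b0 -> good K c0 ->
  hpath K h k a0 a1 a -> hpath K h k b0 b1 b -> hpath K h k c0 c1 c ->
  w * a0 < b0 + c0 + d -> w * a1 < b1 + c1 + d ->
  forall s, 0 <= s <= 1 -> w * a s < b s + c s + d.
Proof.
move=> ga0 gb0 gc0 [aE0 aE1 pa] [bE0 bE1 pb] [cE0 cE1 pc] i0 i1.
(* The velocity of a path is a constant divided by k x, so the acceleration is - eta x x'^2. *)
pose v x0 x1 (x : R -> R) s := (h x1 - h x0) / k (x s).
have dv x0 x1 (x : R -> R) s : 0 <= s <= 1 -> hpath K h k x0 x1 x ->
    is_derive s 1 (v x0 x1 x) (- (eta (x s) * v x0 x1 x s ^+ 2)).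
  move=> sI [_ _ /(_ s sI)[gx _ dx]].
  have kx := k0 gx; have kn : k (x s) != 0 by rewrite gt_eqF.
  have := is_derMl (h x1 - h x0) (is_derV (f := fun s => k (x s)) kn
    (is_derc (dk gx) dx)).
  move=> dd; apply: is_derive_eq dd _; rewrite /v; field; by [].
pose D s := b s + c s + d - w * a s.
pose D' s := v b0 b1 b s + v c0 c1 c s - w * v a0 a1 a s.
pose D'' s := - (eta (b s) * v b0 b1 b s ^+ 2) + - (eta (c s) * v c0 c1 c s ^+ 2)
  - w * - (eta (a s) * v a0 a1 a s ^+ 2).
have dD s : 0 <= s <= 1 -> is_derive s 1 D (D' s).
  move=> sI; have [_ _ da] := pa s sI; have [_ _ db] := pb s sI.
  have [_ _ dc] := pc s sI.
  have := is_derB (is_derD (is_derD db dc) (is_derive_cst d s 1)) (is_derMl w da).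
  by rewrite addr0.
have dD' s : 0 <= s <= 1 -> is_derive s 1 D' (D'' s).
  move=> sI; have da := dv _ _ _ _ sI (And3 aE0 aE1 pa).
  have db := dv _ _ _ _ sI (And3 bE0 bE1 pb).
  have dc := dv _ _ _ _ sI (And3 cE0 cE1 pc).
  exact: (is_derB (is_derD db dc) (is_derMl w da)).
have D0 : 0 < D 0 by rewrite /D aE0 bE0 cE0 subr_gt0.
have D1 : 0 < D 1 by rewrite /D aE1 bE1 cE1 subr_gt0.
suff H s : 0 <= s <= 1 -> 0 < D s by move=> s /H; rewrite /D subr_gt0.
case: eta_convex => [e0|econv].
  apply: (path_pos_affine dD dD') => // t tI; rewrite /D''.
  have [ga _ _] := pa t tI; have [gb _ _] := pb t tI.
  have [gc _ _] := pc t tI.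
  by rewrite !e0// !mul0r oppr0 mulr0 subr0 addr0.
apply: (path_pos dD dD') => // t /andP[t0 t1] Dt D't.
have tI : 0 <= t <= 1 by rewrite !ltW.
have [ga hat _] := pa t tI; have [gb hbt _] := pb t tI.
have [gc hct _] := pc t tI.
(* When these velocities vanish so does the third, and all three paths are constant; then D t = D 0
   > 0, contrary to D t <= 0. *)
have [e|ne] := pselect (v b0 b1 b t = 0 /\ v c0 c1 c t = 0).
  exfalso; have [eb ec] := e.
  have ea : v a0 a1 a t = 0.
    move: D't; rewrite /D' eb ec !(add0r, addr0) => /eqP; rewrite oppr_eq0 mulf_eq0 gt_eqF//=.
    by move/eqP.
  have cst x0 x1 (x : R -> R) : good K x0 -> good K (x t) ->
      h (x t) = h x0 + t * (h x1 - h x0) -> v x0 x1 x t = 0 -> x t = x0.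
    move=> gx0 gxt E /eqP; rewrite mulf_eq0 invr_eq0 (gt_eqF (k0 gxt)) orbF => /eqP E0.
    by apply: (good_inj dh k0) => //; rewrite E E0 mulr0 addr0.
  have := Dt; rewrite /D (cst b0 b1 b)// (cst c0 c1 c)// (cst a0 a1 a)//.
  by rewrite subr_le0 leNgt i0.
have ne' : v b0 b1 b t != 0 \/ v c0 c1 c t != 0.
  have [E|?] := eqVneq (v b0 b1 b t) 0; last by left.
  have [E'|?] := eqVneq (v c0 c1 c t) 0; last by right.
  by case: ne.
have := econv _ _ _ (v b0 b1 b t) (v c0 c1 c t) (v a0 a1 a t) gb gc ga _ _ ne'.
rewrite /D''; have := Dt; rewrite /D subr_le0 => /[swap] /[apply].
have -> : w * v a0 a1 a t = v b0 b1 b t + v c0 c1 c t.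
  by move: D't; rewrite /D' => /eqP; rewrite subr_eq0 => /eqP ->.
move=> /(_ erefl); lra.
Qed.

End persistence.
End paths.

(** * The quadratic form of an infinitesimal deformation of a triangle *)

Section quadratic_form.
Variable R : realType.
Implicit Types (K : geometry) (p q r a b c : R).

(** By [dlog_angle_form] this is the sum, over the three sides, of the variation of the side times
    that of the opposite angle divided by its sine; p, q, r are the deficits and p', q', r' their
    variations. *)
Definition Qform K p q r (p' q' r' : R) : R :=
  ct K p * p' ^+ 2 + ct K q * q' ^+ 2 + ct K r * r' ^+ 2 -
  ct K (p + q + r) * (p' + q' + r') ^+ 2.

Lemma Qform2_ge0 K x y p q : K <> Hyperbolic -> 0 < x -> 0 < y -> good K (x + y) ->
  let F := ct K x * p ^+ 2 + ct K y * q ^+ 2 - ct K (x + y) * (p + q) ^+ 2 in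
  0 <= F /\ (F = 0 -> ct K x * p = ct K y * q /\ (K = Spherical -> p + q = 0)).
Proof.
move=> KH x0 y0 gxy F.
have gx : good K x by apply: good_le gxy; lra.
have gy : good K y by apply: good_le gxy; lra.
have C0 := ct_sum_gt0 gxy gx gy; rewrite /F ct_form//.
have k0 : 0 <= curvature R K by case: {F C0 gx gy gxy} K KH => //=.
have n0 : 0 <= (ct K x * p - ct K y * q) ^+ 2 + curvature R K * (p + q) ^+ 2.
  by rewrite addr_ge0 ?sqr_ge0// mulr_ge0// sqr_ge0.
split; first by rewrite divr_ge0// ltW.
move/eqP; rewrite mulf_eq0 invr_eq0 (gt_eqF C0) orbF paddr_eq0 ?sqr_ge0//; last first.
  by rewrite mulr_ge0// sqr_ge0.
rewrite sqrf_eq0 subr_eq0 => /andP[/eqP -> h]; split=> // KS.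
by move: h; rewrite KS mul1r sqrf_eq0 => /eqP.
Qed.

(** Inserting the term in ct (p + q) splits the form into two binary ones, for (p, q) and for (p +
    q, r). Equality in both leaves only scalings, and none of these on the sphere, where the total
    variation must also vanish. *)
Lemma Qform_ge0 K p q r p' q' r' : K <> Hyperbolic -> deficits K p q r ->
  0 <= Qform K p q r p' q' r' /\ (Qform K p q r p' q' r' = 0 ->
    exists t, [/\ p' = t * p, q' = t * q, r' = t * r & K = Spherical -> t = 0]).
Proof.
move=> KH d; have [[gp gq gr] [gqr grp gpq]] := deficits_good d.
have [p0 q0 r0 gW] := d.
have [F0 Fz] := Qform2_ge0 p' q' KH p0 q0 gpq.
have [G0 Gz] := Qform2_ge0 (p' + q') r' KH (good_gt0 gpq) r0 gW.
have -> : Qform K p q r p' q' r' =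
  (ct K p * p' ^+ 2 + ct K q * q' ^+ 2 - ct K (p + q) * (p' + q') ^+ 2) +
  (ct K (p + q) * (p' + q') ^+ 2 + ct K r * r' ^+ 2 -
     ct K (p + q + r) * (p' + q' + r') ^+ 2) by rewrite /Qform; ring.
split; first exact: addr_ge0.
move=> /eqP; rewrite paddr_eq0// => /andP[/eqP /Fz[e1 h1] /eqP /Gz[e2 h2]].
have C0 := ct_sum_gt0 gpq gp gq.
have [KS|KS] := pselect (K = Spherical).
  have pq := h1 KS; have pqr := h2 KS; exists 0; rewrite !mul0r.
  have p'0 : p' = 0.
    have : (ct K p + ct K q) * p' = 0.
      by rewrite mulrDl e1 -mulrDr addrC pq mulr0.
    by move/eqP; rewrite mulf_eq0 (gt_eqF C0)/= => /eqP.
  by split=> //; move: pq pqr; rewrite p'0; lra.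
have KE : K = Euclidean by move: KH KS; clear; case: K.
move: e1 e2; rewrite KE /ct /= !div1r => e1 e2.
exists (p' / p); split; last by [].
- by rewrite divfK// gt_eqF.
- apply: (mulfI (x := q^-1)); first by rewrite invr_eq0 gt_eqF.
  by rewrite -e1; field; rewrite !gt_eqF.
- have e3 : q' = q / p * p'.
    apply: (mulfI (x := q^-1)); first by rewrite invr_eq0 gt_eqF.
    by rewrite -e1; field; rewrite !gt_eqF.
  have pq0 : 0 < p + q by rewrite addr_gt0.
  apply: (mulfI (x := r^-1)); first by rewrite invr_eq0 gt_eqF.
  by rewrite -e2 e3; field; rewrite !gt_eqF.
Qed.

End quadratic_form.

(** * Variation of the angles and the weights from the sine rule *)

Section triangle_paths.
Variable R : realType.
Implicit Types (K : geometry) (a b c : R).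

(* Half of the logarithmic derivative of [tan^2 (theta / 2)], that is, the
   derivative of the angle opposite to [a] divided by its sine. *)
Definition dlog_angle K a b c (a' b' c' : R) : R :=
  (ct K ((c + a - b) / 2) * ((c' + a' - b') / 2) +
   ct K ((a + b - c) / 2) * ((a' + b' - c') / 2) -
   ct K ((b + c - a) / 2) * ((b' + c' - a') / 2) -
   ct K ((a + b + c) / 2) * ((a' + b' + c') / 2)) / 2.

Lemma tri_rot K a b c : tri K a b c -> tri K b c a.
Proof. by move=> /deficits_rot. Qed.

Lemma is_derive_tri_angle K (a b c : R -> R) (s a' b' c' : R) :
  tri K (a s) (b s) (c s) ->
  is_derive s 1 a a' -> is_derive s 1 b b' -> is_derive s 1 c c' ->
  is_derive s 1 (fun s => tri_angle K (a s) (b s) (c s))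
    (sin (tri_angle K (a s) (b s) (c s)) *
     dlog_angle K (a s) (b s) (c s) a' b' c').
Proof.
move=> T da db dc; have [[ga gb gc] _] := deficits_good T.
have gW : good K ((a s + b s + c s) / 2).
  by have [_ _ _] := T; have [[-> _ _ _] _] := tri_halves (a s) (b s) (c s).
have half (f : R -> R) f' : is_derive s 1 f f' -> is_derive s 1 (fun s => f s / 2) (f' / 2).
  move=> df; have := is_derMl 2^-1 df; rewrite mulrC.
  by under eq_fun do rewrite mulrC.
exact: (is_derive_ang (W := fun s => (a s + b s + c s) / 2)
  (a := fun s => (b s + c s - a s) / 2) (b := fun s => (c s + a s - b s) / 2)
  (c := fun s => (a s + b s - c s) / 2) gW ga gb gc
  (half _ _ (is_derD (is_derD da db) dc)) (half _ _ (is_derB (is_derD db dc) da))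
  (half _ _ (is_derB (is_derD dc da) db)) (half _ _ (is_derB (is_derD da db) dc))).
Qed.

Lemma dlog_angle_form K a b c a' b' c' :
  a' * dlog_angle K a b c a' b' c' + b' * dlog_angle K b c a b' c' a' +
  c' * dlog_angle K c a b c' a' b' =
  Qform K ((b + c - a) / 2) ((c + a - b) / 2) ((a + b - c) / 2)
    ((b' + c' - a') / 2) ((c' + a' - b') / 2) ((a' + b' - c') / 2).
Proof.
rewrite /dlog_angle /Qform; have [[-> _ _ _] _] := tri_halves a b c.
rewrite (_ : b + c + a = a + b + c); last by ring.
rewrite (_ : c + a + b = a + b + c); last by ring.
by move: (ct _ _) (ct _ _) (ct _ _) (ct _ _) => *; field.
Qed.

Lemma tri_sine_rule K a b c : tri K a b c -> exists2 m, 0 < m &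
  [/\ sin (tri_angle K a b c) = m * sn K a, sin (tri_angle K b c a) = m * sn K b &
      sin (tri_angle K c a b) = m * sn K c].
Proof.
move=> T; exists (sine_ratio K ((b + c - a) / 2) ((c + a - b) / 2) ((a + b - c) / 2)).
  exact: sine_ratio_gt0.
rewrite /tri_angle; split.
- by have := sine_rule T; have [[-> -> _ _] _] := tri_halves a b c.
- have := sine_rule (tri_rot T); have [[-> -> _ _] _] := tri_halves b c a.
  by move=> ->; rewrite -sine_ratio_rot.
- have := sine_rule (tri_rot (tri_rot T)); have [[-> -> _ _] _] := tri_halves c a b.
  by move=> ->; rewrite sine_ratio_rot.
Qed.

Lemma tri_angle_itv K a b c : tri K a b c -> 0 < tri_angle K a b c < pi.
Proof.
move=> T; have [[ga gb gc] _] := deficits_good T.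
have [_ _ _] := T; have [[hW _ _ _] _] := tri_halves a b c; rewrite hW => gW.
exact: ang_itv.
Qed.

Section sine_weight.
Variable lam : R.

Definition Jsin (t : R) := oriented_integral (pi / 2) t (fun t => sin t `^ lam).

Lemma pi_half_itv : 0 < (pi / 2 : R) < pi.
Proof. by have := @pi_gt0 R; move=> ?; apply/andP; split; lra. Qed.

Lemma is_derive_Jsin t : 0 < t < pi -> is_derive t 1 Jsin (sin t `^ lam).
Proof.
move=> tI; apply: (@is_derive_oriented_integral _ (fun t => sin t `^ lam) 0 pi) => //.
  exact: pi_half_itv.
move=> u uI; have s0 := sin_gt0_pi uI.
apply: is_derive_continuous; apply: (is_derc (f := @powR R ^~ lam)).
exact: is_derive1_powR.
Qed.

(** Here m is the ratio in the sine rule and x is [sn] of a side. The right-hand side no longer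
    depends on x, so the three terms of the weighted sum get the same factor. *)
Lemma powR_weight (x m : R) : 0 < x -> 0 < m ->
  x `^ (- lam - 1) * ((m * x) `^ lam * (m * x)) = m `^ (lam + 1).
Proof.
move=> x0 m0; have mx : 0 < m * x by rewrite mulr_gt0.
rewrite -[X in _ * (_ * X)](powRr1 (ltW mx)) -powRD ?(gt_eqF mx) ?implybT//.
rewrite powRM ?ltW// mulrCA -powRD ?(gt_eqF x0) ?implybT//.
by rewrite (_ : - lam - 1 + (lam + 1) = 0) ?powRr0 ?mulr1//; ring.
Qed.

(** A, B, C are the velocities of the coordinates t. They are named by equations because along an
    [hpath] they are constant increments, whereas for a differential they are the products
    themselves. *)
Lemma weighted_form K (a b c : R -> R) (s a' b' c' A B C : R) :
  a' * sn K (a s) `^ (- lam - 1) = A -> b' * sn K (b s) `^ (- lam - 1) = B ->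
  c' * sn K (c s) `^ (- lam - 1) = C ->
  tri K (a s) (b s) (c s) ->
  is_derive s 1 a a' -> is_derive s 1 b b' -> is_derive s 1 c c' ->
  exists u v w : R, [/\
    is_derive s 1 (fun s => Jsin (tri_angle K (a s) (b s) (c s))) u,
    is_derive s 1 (fun s => Jsin (tri_angle K (b s) (c s) (a s))) v,
    is_derive s 1 (fun s => Jsin (tri_angle K (c s) (a s) (b s))) w &
    exists2 m : R, 0 < m &
    A * u + B * v + C * w = m * Qform K ((b s + c s - a s) / 2) ((c s + a s - b s) / 2)
      ((a s + b s - c s) / 2)
      ((b' + c' - a') / 2) ((c' + a' - b') / 2) ((a' + b' - c') / 2)].
Proof.
move=> <- <- <- T da db dc; have T2 := tri_rot T; have T3 := tri_rot T2.
have dJ K' (x y z : R -> R) x' y' z' (Txyz : tri K' (x s) (y s) (z s))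
    (dx : is_derive s 1 x x') (dy : is_derive s 1 y y') (dz : is_derive s 1 z z') :=
  is_derc (g := fun s => tri_angle K' (x s) (y s) (z s))
    (is_derive_Jsin (tri_angle_itv Txyz)) (is_derive_tri_angle Txyz dx dy dz).
have du := dJ _ _ _ _ _ _ _ T da db dc.
have dv := dJ _ _ _ _ _ _ _ T2 db dc da.
have dw := dJ _ _ _ _ _ _ _ T3 dc da db.
have [m m0 [e1 e2 e3]] := tri_sine_rule T.
have [/sn_gt0 sa /sn_gt0 sb /sn_gt0 sc] := tri_gt0 T.
have [h1 [h2 h3]] := (powR_weight sa m0, (powR_weight sb m0, powR_weight sc m0)).
do 3 eexists; split; [exact: du|exact: dv|exact: dw|].
exists (m `^ (lam + 1)); first exact: powR_gt0.
have aux (k t x d : R) : k * (t `^ lam * t) = m `^ (lam + 1) ->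
    x * k * (t `^ lam * (t * d)) = m `^ (lam + 1) * (x * d) by move=> <-; ring.
rewrite -dlog_angle_form 2!mulrDr; congr (_ + _ + _).
- by rewrite e1; exact: aux.
- by rewrite e2; exact: aux.
- by rewrite e3; exact: aux.
Qed.

End sine_weight.
End triangle_paths.

(** * Paths with affine coordinates t, and integration of the quadratic form *)

Section monotonicity.
Variable R : realType.
Implicit Types (K : geometry) (a b c s x y z p q r : R).

Lemma tri_ineq K a b c : a < b + c -> b < c + a -> c < a + b ->
  (K = Spherical -> a + b + c < 2 * pi) -> tri K a b c.
Proof.
move=> i1 i2 i3 iW; split; [lra..|].
have [[-> _ _ _] _] := tri_halves a b c; rewrite /good; apply/andP; split; first lra.
by case: K iW => // /(_ erefl); lra.
Qed.

Lemma tri_ineqV K a b c : tri K a b c -> [/\ a < b + c, b < c + a, c < a + b &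
  (K = Spherical -> a + b + c < 2 * pi)].
Proof.
case=> p0 q0 r0; have [[-> _ _ _] _] := tri_halves a b c => /andP[_ gW].
split; [lra..|]; by move=> KS; move: gW; rewrite KS; lra.
Qed.

Lemma good_reflect x : good Spherical x -> good Spherical (pi - x).
Proof. by case/andP => x0 xpi; apply/andP; split; lra. Qed.

Lemma reflection_antisymmetric (h k : R -> R) :
  (forall x, good Spherical x -> is_derive x 1 h (k x)) ->
  (forall x, good Spherical x -> k (pi - x) = k x) ->
  forall x y, good Spherical x -> good Spherical y ->
    h (pi - x) + h x = h (pi - y) + h y.
Proof.
move=> dh ksym x y.
wlog xy : x y / x < y.
    move=> W gx gy; have [xy|xy|->//] := ltgtP x y; first exact: W.
    by apply/esym/W.
  move=> gx gy.
  have [z _ E] : exists2 z, x < z < y &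
      (h (pi - y) + h y) - (h (pi - x) + h x) = 0 * (y - x).
    apply: (@MVT_closed _ (fun x => h (pi - x) + h x) (fun=> 0)) => // z zI.
    have gz : good Spherical z := good_between gx gy zI.
    have dpi : is_derive z 1 (fun t => pi - t) (0 - 1).
      by apply: is_derB; exact: is_derive_id.
    have := is_derD (is_derc (g := fun t => pi - t) (dh _ (good_reflect gz)) dpi) (dh _ gz).
    by rewrite ksym// sub0r mulrN1 addNr.
  by apply/esym/eqP; rewrite -subr_eq0 E mul0r.
Qed.

(** On the sphere the bound a + b + c < 2 pi is the triangle inequality a < (pi - b) + (pi - c).
    Reflected paths are again affine in [h], so the bound persists by the same argument as the other
    inequalities. *)
Lemma hpath_reflect (h k : R -> R) a0 a1 (f : R -> R) :
  (forall x, good Spherical x -> is_derive x 1 h (k x)) ->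
  (forall x, good Spherical x -> 0 < k x) ->
  (forall x, good Spherical x -> k (pi - x) = k x) ->
  good Spherical a0 -> good Spherical a1 ->
  hpath Spherical h k a0 a1 f ->
  hpath Spherical h k (pi - a0) (pi - a1) (fun s => pi - f s).
Proof.
move=> dh k0 ksym g0 g1 [f0 f1 pf].
have gpi := good_reflect.
have hsym := reflection_antisymmetric dh ksym.
split; [by rewrite f0|by rewrite f1|move=> s sI; have [gs hs ds] := pf s sI].
split; first exact: gpi.
- have E0 := hsym _ _ gs g0; have E1 := hsym _ _ g1 g0.
  have -> : h (pi - f s) = h (pi - a0) + h a0 - h (f s) by rewrite -E0; ring.
  have -> : h (pi - a1) = h (pi - a0) + h a0 - h a1 by rewrite -E1; ring.
  by rewrite hs; ring.
- have E1 := hsym _ _ g1 g0.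
  have -> : (h (pi - a1) - h (pi - a0)) / k (pi - f s) = 0 - (h a1 - h a0) / k (f s).
    rewrite ksym// (_ : h (pi - a1) = h (pi - a0) + h a0 - h a1); last by rewrite -E1; ring.
    by ring.
  by apply: is_derB.
Qed.

Lemma sn_weight_derive K (mu : R) x : good K x ->
  is_derive x 1 (fun x => sn K x `^ mu) (sn K x `^ mu * (mu * ct K x)).
Proof.
move=> gx; have s0 := sn_gt0 gx.
have := is_derc (f := fun y => y `^ mu) (is_derive1_powR mu s0) (is_derive_sn K x).
move=> dd; apply: is_derive_eq dd _.
rewrite powRB ?(gt_eqF s0) ?implybT// powRr1 ?ltW// /ct; ring.
Qed.

(** [ct] is decreasing, so z may be replaced by x + y; what remains is the binary form of
    [Qform2_ge0], which on the sphere vanishes only at zero. *)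
Lemma spherical_eta_convex x y z p q r : good Spherical x -> good Spherical y ->
  good Spherical z -> x + y <= z -> r = p + q -> p != 0 \/ q != 0 ->
  ct Spherical z * r ^+ 2 < ct Spherical x * p ^+ 2 + ct Spherical y * q ^+ 2.
Proof.
move=> gx gy gz xyz -> pq0.
have [x0 y0] := (good_gt0 gx, good_gt0 gy).
have gxy : good Spherical (x + y) by apply: good_le gz => //; lra.
have [F0 Fz] := Qform2_ge0 p q (K := Spherical) (fun e => ltac:(by [])) x0 y0 gxy.
have F1 : ct Spherical x * p ^+ 2 + ct Spherical y * q ^+ 2 -
    ct Spherical (x + y) * (p + q) ^+ 2 != 0.
  apply/eqP => /Fz[e1 /(_ erefl) e2].
  have C0 := ct_sum_gt0 gxy gx gy.
  have : (ct Spherical x + ct Spherical y) * p = 0.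
    by rewrite mulrDl e1 -mulrDr addrC e2 mulr0.
  move/eqP; rewrite mulf_eq0 (gt_eqF C0)/= => p0.
  move: pq0 e2; rewrite (eqP p0) eqxx add0r => -[//|q0 E].
  by move: q0; rewrite E eqxx.
have cz : ct Spherical z <= ct Spherical (x + y).
  rewrite -subr_ge0; have [s1 s2] := (sn_gt0 gxy, sn_gt0 gz).
  have -> : ct Spherical (x + y) - ct Spherical z =
      sn Spherical (z - (x + y)) / (sn Spherical (x + y) * sn Spherical z).
    by rewrite (snB Spherical z) /ct; field; rewrite !gt_eqF.
  apply: divr_ge0; last by rewrite mulr_ge0// ltW.
  by apply: sn_ge0 => [|_]; rewrite ?subr_ge0//; case/andP: gz => _ zpi; lra.
have := ler_wpM2r (sqr_ge0 (p + q)) cz.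
have : 0 < ct Spherical x * p ^+ 2 + ct Spherical y * q ^+ 2 -
    ct Spherical (x + y) * (p + q) ^+ 2 by rewrite lt_neqAle eq_sym F1.
lra.
Qed.

Lemma spherical_ineq_path (h : R -> R) (mu : R) a0 b0 c0 a1 b1 c1 (a b c : R -> R) :
  let k x := sn Spherical x `^ mu in
  0 <= mu -> (forall x, good Spherical x -> is_derive x 1 h (k x)) ->
  good Spherical a0 -> good Spherical b0 -> good Spherical c0 ->
  hpath Spherical h k a0 a1 a -> hpath Spherical h k b0 b1 b ->
  hpath Spherical h k c0 c1 c -> a0 < b0 + c0 -> a1 < b1 + c1 ->
  forall s, 0 <= s <= 1 -> a s < b s + c s.
Proof.
move=> k mu0 dh ga gb gc pa pb pc e0 e1 s sI.
have k0 x : good Spherical x -> 0 < k x by move=> /sn_gt0 ?; exact: powR_gt0.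
have dk x : good Spherical x -> is_derive x 1 k (k x * (mu * ct Spherical x)).
  exact: sn_weight_derive.
have ec : (forall x, good Spherical x -> mu * ct Spherical x = 0) \/
  forall x y z p q r, good Spherical x -> good Spherical y -> good Spherical z ->
    x + y + 0 <= 1 * z -> 1 * r = p + q -> p != 0 \/ q != 0 ->
    1 * (mu * ct Spherical z * r ^+ 2) <
    mu * ct Spherical x * p ^+ 2 + mu * ct Spherical y * q ^+ 2.
  have [->|mun0] := eqVneq mu 0; first by left => x _; rewrite mul0r.
  right=> x y z p q r gx gy gz; rewrite addr0 !mul1r => h1 h2 h3.
  have mup : 0 < mu by rewrite lt_neqAle eq_sym mun0.
  rewrite -(mulrA mu (ct _ z)) -(mulrA mu (ct _ x)) -(mulrA mu (ct _ y)) -mulrDr.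
  by rewrite ltr_pM2l//; exact: spherical_eta_convex.
have := triangle_inequality_path dh k0 dk ltr01 ec ga gb gc pa pb pc _ _ sI.
by rewrite !mul1r !addr0; apply.
Qed.

Lemma spherical_tri_path (h : R -> R) (mu : R) a0 b0 c0 a1 b1 c1 (a b c : R -> R) :
  let k x := sn Spherical x `^ mu in
  0 <= mu -> (forall x, good Spherical x -> is_derive x 1 h (k x)) ->
  tri Spherical a0 b0 c0 -> tri Spherical a1 b1 c1 ->
  hpath Spherical h k a0 a1 a -> hpath Spherical h k b0 b1 b ->
  hpath Spherical h k c0 c1 c ->
  forall s, 0 <= s <= 1 -> tri Spherical (a s) (b s) (c s).
Proof.
move=> k mu0 dh T0 T1 pa pb pc.
have k0 x : good Spherical x -> 0 < k x by move=> /sn_gt0 ?; exact: powR_gt0.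
have [ga0 gb0 gc0] := tri_gt0 T0; have [ga1 gb1 gc1] := tri_gt0 T1.
have [i1 i2 i3 /(_ erefl) i4] := tri_ineqV T0.
have [j1 j2 j3 /(_ erefl) j4] := tri_ineqV T1.
have key := spherical_ineq_path mu0 dh.
have ksym x : good Spherical x -> k (pi - x) = k x.
  by move=> _; rewrite /k /= sinB sinpi cospi mul0r sub0r mulN1r opprK.
have gpi := good_reflect.
have pb' := hpath_reflect dh k0 ksym gb0 gb1 pb.
have pc' := hpath_reflect dh k0 ksym gc0 gc1 pc.
move=> s sI; apply: tri_ineq.
- exact: (key _ _ _ _ _ _ _ _ _ ga0 gb0 gc0 pa pb pc).
- exact: (key _ _ _ _ _ _ _ _ _ gb0 gc0 ga0 pb pc pa).
- exact: (key _ _ _ _ _ _ _ _ _ gc0 ga0 gb0 pc pa pb).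
- move=> _; have := key _ _ _ _ _ _ _ _ _ ga0 (gpi _ gb0) (gpi _ gc0) pa pb' pc'.
  move=> /(_ _ _ s sI); lra.
Qed.

(** The left-hand side is (p + q)^2 / (w z), and w z exceeds x + y by at least d > 0. This makes the
    comparison with (p + q)^2 / (x + y) strict, unless p + q = 0, when the right-hand side alone is
    positive. *)
Lemma euclidean_eta_convex x y z p q r (w d : R) : 0 < x -> 0 < y -> 0 < z ->
  0 < w -> 0 < d -> x + y + d <= w * z -> w * r = p + q -> p != 0 \/ q != 0 ->
  w * (ct Euclidean z * r ^+ 2) <
  ct Euclidean x * p ^+ 2 + ct Euclidean y * q ^+ 2.
Proof.
move=> x0 y0 z0 w0 d0 h hr pq; rewrite /ct /= !div1r.
have rE : r = (p + q) / w by rewrite -hr mulrAC divff ?mul1r// gt_eqF.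
have wz0 : 0 < w * z by rewrite mulr_gt0.
have -> : w * (z^-1 * r ^+ 2) = (w * z)^-1 * (p + q) ^+ 2.
  by rewrite rE; field; rewrite !gt_eqF.
have [e|ne] := eqVneq (p + q) 0.
  rewrite e expr0n mulr0.
  have p2 : 0 <= x^-1 * p ^+ 2 by rewrite mulr_ge0 ?sqr_ge0// invr_ge0 ltW.
  have q2 : 0 <= y^-1 * q ^+ 2 by rewrite mulr_ge0 ?sqr_ge0// invr_ge0 ltW.
  rewrite lt_neqAle addr_ge0// andbT eq_sym paddr_eq0// !mulf_eq0 !invr_eq0.
  rewrite (gt_eqF x0) (gt_eqF y0) /= !orbb negb_and.
  by case: pq => ->; rewrite ?orbT.
have g : good Euclidean (x + y) by rewrite /good andbT addr_gt0.
have [F0 _] := Qform2_ge0 p q (K := Euclidean) ltac:(by []) x0 y0 g.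
rewrite /ct /= !div1r in F0.
have xy0 : 0 < x + y by rewrite addr_gt0.
have : (w * z)^-1 * (p + q) ^+ 2 < (x + y)^-1 * (p + q) ^+ 2.
  rewrite ltr_pM2r ?exprn_even_gt0//= ltf_pV2 ?posrE//; lra.
lra.
Qed.

Lemma euclidean_tri_path (h : R -> R) (mu : R) a0 b0 c0 a1 b1 c1 (a b c : R -> R) :
  let k x := sn Euclidean x `^ mu in
  0 <= mu -> (forall x, good Euclidean x -> is_derive x 1 h (k x)) ->
  tri Euclidean a0 b0 c0 -> tri Euclidean a1 b1 c1 ->
  hpath Euclidean h k a0 a1 a -> hpath Euclidean h k b0 b1 b ->
  hpath Euclidean h k c0 c1 c ->
  forall s, 0 <= s <= 1 -> tri Euclidean (a s) (b s) (c s).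
Proof.
move=> k mu0 dh T0 T1 pa pb pc.
have k0 x : good Euclidean x -> 0 < k x by move=> /sn_gt0 ?; exact: powR_gt0.
have [ga0 gb0 gc0] := tri_gt0 T0; have [ga1 gb1 gc1] := tri_gt0 T1.
have [i1 i2 i3 _] := tri_ineqV T0.
have [j1 j2 j3 _] := tri_ineqV T1.
have dk x : good Euclidean x -> is_derive x 1 k (k x * (mu * ct Euclidean x)).
  exact: sn_weight_derive.
have key x0 y0 z0 x1 y1 z1 (x y z : R -> R) : good Euclidean x0 -> good Euclidean y0 ->
    good Euclidean z0 -> good Euclidean x1 ->
    hpath Euclidean h k x0 x1 x -> hpath Euclidean h k y0 y1 y ->
    hpath Euclidean h k z0 z1 z -> x0 < y0 + z0 -> x1 < y1 + z1 ->
    forall s, 0 <= s <= 1 -> x s < y s + z s.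
  move=> gx gy gz gx1 px py pz e0 e1 s sI.
  have [x00 x10] := (good_gt0 gx, good_gt0 gx1).
  (* The inequality carried along the path is (1 + e) x < y + z + e m. The slack g at the two ends
     fixes e so that it holds there, and since the path stays above m, the smaller end value of x,
     it implies x < y + z. *)
  pose g := Num.min (y0 + z0 - x0) (y1 + z1 - x1).
  have g0 : 0 < g by rewrite lt_min !subr_gt0 e0.
  have [gg0 gg1] : g <= y0 + z0 - x0 /\ g <= y1 + z1 - x1.
    by split; rewrite /g ge_min lexx ?orbT.
  pose e := g / (2 * (x0 + x1)).
  have e00 : 0 < e by rewrite divr_gt0// mulr_gt0// addr_gt0.
  have eE : e * x0 + e * x1 = g / 2.
    by rewrite /e; field; rewrite gt_eqF// addr_gt0.
  have [ex0 ex1] : 0 < e * x0 /\ 0 < e * x1 by split; rewrite mulr_gt0.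
  pose m := Num.min x0 x1.
  have m0 : 0 < m by rewrite lt_min x00.
  have ec : (forall x, good Euclidean x -> mu * ct Euclidean x = 0) \/
    forall x y z p q r, good Euclidean x -> good Euclidean y -> good Euclidean z ->
      x + y + e * m <= (1 + e) * z -> (1 + e) * r = p + q -> p != 0 \/ q != 0 ->
      (1 + e) * (mu * ct Euclidean z * r ^+ 2) <
      mu * ct Euclidean x * p ^+ 2 + mu * ct Euclidean y * q ^+ 2.
    have [->|mun0] := eqVneq mu 0; first by left => ? _; rewrite mul0r.
    right=> x' y' z' p q r /good_gt0 x'0 /good_gt0 y'0 /good_gt0 z'0 h1 h2 h3.
    have mup : 0 < mu by rewrite lt_neqAle eq_sym mun0.
    rewrite -(mulrA mu (ct _ z')) -(mulrA mu (ct _ x')) -(mulrA mu (ct _ y')) -mulrDr.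
    rewrite mulrCA ltr_pM2l//; apply: (euclidean_eta_convex (d := e * m)) => //.
      by rewrite addr_gt0.
    by rewrite mulr_gt0.
  have w0 : 0 < 1 + e by rewrite addr_gt0.
  have em : 0 < e * m by rewrite mulr_gt0.
  have c0' : (1 + e) * x0 < y0 + z0 + e * m by lra.
  have c1' : (1 + e) * x1 < y1 + z1 + e * m by lra.
  have := triangle_inequality_path dh k0 dk w0 ec gx gy gz px py pz c0' c1' sI.
  have mx : m <= x s.
    have [_ _ /(_ s sI)[gxs hs _]] := px.
    rewrite leNgt; apply/negP; rewrite lt_min => /andP[l0 l1].
    have := good_increasing dh k0 gxs gx l0; have := good_increasing dh k0 gxs gx1 l1.
    rewrite hs; case/andP: sI => s0 s1 l l'.
    have : 0 <= s * (h x1 - (h x0 + s * (h x1 - h x0))) by rewrite mulr_ge0// ltW// subr_gt0.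
    have : 0 <= (1 - s) * (h x0 - (h x0 + s * (h x1 - h x0))).
      by rewrite mulr_ge0 ?subr_ge0// ltW.
    nra.
  have := ler_wpM2l (ltW e00) mx; lra.
move=> s sI; apply: tri_ineq => //.
- exact: (key _ _ _ _ _ _ _ _ _ ga0 gb0 gc0 ga1 pa pb pc).
- exact: (key _ _ _ _ _ _ _ _ _ gb0 gc0 ga0 gb1 pb pc pa).
- exact: (key _ _ _ _ _ _ _ _ _ gc0 ga0 gb0 gc1 pc pa pb).
Qed.

(** By the mean value theorem D is a positive multiple of [Qform] at one intermediate time s.
    Vanishing of D is therefore informative at that time only: x, y, z are the sides then, and their
    velocities are t times themselves. Passing back to the end points depends on the geometry. *)
Lemma sine_monotone K (lam : R) (h : R -> R) a0 b0 c0 a1 b1 c1 :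
  K <> Hyperbolic -> lam <= -1 ->
  (forall x, good K x -> is_derive x 1 h (sn K x `^ (- lam - 1))) ->
  tri K a0 b0 c0 -> tri K a1 b1 c1 ->
  let D := (h a1 - h a0) * (Jsin lam (tri_angle K a1 b1 c1) - Jsin lam (tri_angle K a0 b0 c0))
         + (h b1 - h b0) * (Jsin lam (tri_angle K b1 c1 a1) - Jsin lam (tri_angle K b0 c0 a0))
         + (h c1 - h c0) * (Jsin lam (tri_angle K c1 a1 b1) - Jsin lam (tri_angle K c0 a0 b0)) in
  0 <= D /\ (D = 0 -> exists s t, [/\ 0 <= s <= 1, K = Spherical -> t = 0 &
    exists x y z, [/\ good K x, good K y & good K z] /\
    [/\ h a1 - h a0 = t * x * sn K x `^ (- lam - 1) /\ h x = h a0 + s * (h a1 - h a0),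
        h b1 - h b0 = t * y * sn K y `^ (- lam - 1) /\ h y = h b0 + s * (h b1 - h b0) &
        h c1 - h c0 = t * z * sn K z `^ (- lam - 1) /\ h z = h c0 + s * (h c1 - h c0)]]).
Proof.
move=> KH lam1 dh T0 T1 D; pose k x := sn K x `^ (- lam - 1).
have k0 x : good K x -> 0 < k x by move=> /sn_gt0 ?; exact: powR_gt0.
have mu0 : 0 <= - lam - 1 by lra.
have [ga0 gb0 gc0] := tri_gt0 T0; have [ga1 gb1 gc1] := tri_gt0 T1.
have [a pa] := inverse_path dh k0 ga0 ga1; have [b pb] := inverse_path dh k0 gb0 gb1.
have [c pc] := inverse_path dh k0 gc0 gc1.
have Ts s : 0 <= s <= 1 -> tri K (a s) (b s) (c s).
  move: s; case: (K) KH dh T0 T1 pa pb pc => // _ dh T0 T1 pa pb pc.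
    exact: (euclidean_tri_path mu0 dh T0 T1 pa pb pc).
  exact: (spherical_tri_path mu0 dh T0 T1 pa pb pc).
pose f s := (h a1 - h a0) * Jsin lam (tri_angle K (a s) (b s) (c s))
  + (h b1 - h b0) * Jsin lam (tri_angle K (b s) (c s) (a s))
  + (h c1 - h c0) * Jsin lam (tri_angle K (c s) (a s) (b s)).
pose va s := (h a1 - h a0) / k (a s); pose vb s := (h b1 - h b0) / k (b s).
pose vc s := (h c1 - h c0) / k (c s).
pose Q s := Qform K ((b s + c s - a s) / 2) ((c s + a s - b s) / 2)
      ((a s + b s - c s) / 2)
      ((vb s + vc s - va s) / 2) ((vc s + va s - vb s) / 2) ((va s + vb s - vc s) / 2).
have df s : 0 <= s <= 1 -> exists2 m, 0 < m & is_derive s 1 f (m * Q s).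
  move=> sI; have [_ _ /(_ s sI)[ga _ da]] := pa; have [_ _ /(_ s sI)[gb _ db]] := pb.
  have [_ _ /(_ s sI)[gc _ dc]] := pc.
  have kn x e : good K x -> e / k x * sn K x `^ (- lam - 1) = e.
    by move=> /k0/gt_eqF kn; rewrite divfK// kn.
  have [u [v [w [du dv dw [m m0 E]]]]] := weighted_form (kn _ _ ga) (kn _ _ gb)
    (kn _ _ gc) (Ts _ sI) da db dc.
  exists m; first exact: m0.
  have dd := is_derD (is_derD (is_derMl (h a1 - h a0) du) (is_derMl (h b1 - h b0) dv))
    (is_derMl (h c1 - h c0) dw).
  by apply: is_derive_eq dd _; exact: E.
have df' s : 0 <= s <= 1 -> is_derive s 1 f ('D_1 f s).
  by move=> /df[m _ [dm _]]; exact: DeriveDef.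
have [s /andP[s0 s1]] := MVT_closed ltr01 df'.
have sI : 0 <= s <= 1 by rewrite !ltW.
have [m m0 [_ ->]] := df s sI; rewrite subr0 mulr1.
have -> : f 1 - f 0 = D.
  have [a_0 a_1 _] := pa; have [b_0 b_1 _] := pb; have [c_0 c_1 _] := pc.
  rewrite /f /D a_0 a_1 b_0 b_1 c_0 c_1.
  move: (Jsin _ (tri_angle K a1 _ _)) (Jsin _ (tri_angle K b1 _ _))
    (Jsin _ (tri_angle K c1 _ _)) (Jsin _ (tri_angle K a0 _ _))
    (Jsin _ (tri_angle K b0 _ _)) (Jsin _ (tri_angle K c0 _ _)) => *; ring.
move=> ->.
have [Q0 Qz] := Qform_ge0 ((vb s + vc s - va s) / 2) ((vc s + va s - vb s) / 2)
  ((va s + vb s - vc s) / 2) KH (Ts _ sI).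
split; first exact: mulr_ge0 (ltW m0) Q0.
move/eqP; rewrite mulf_eq0 (gt_eqF m0)/= => /eqP /Qz[t [e1 e2 e3 tS]].
exists s, t; split=> //; exists (a s), (b s), (c s).
have [_ _ /(_ s sI)[ga ha _]] := pa; have [_ _ /(_ s sI)[gb hb _]] := pb.
have [_ _ /(_ s sI)[gc hc _]] := pc.
have kk x e v : good K x -> e / k x = v -> e = v * sn K x `^ (- lam - 1).
  by move=> gx <-; rewrite divfK// gt_eqF// k0.
split; [by []|split; split=> //; apply: kk => //].
- by rewrite -/(va s); lra.
- by rewrite -/(vb s); lra.
- by rewrite -/(vc s); lra.
Qed.

End monotonicity.

(** * Spherical and Euclidean triangles *)

Section polar_duality.
Variable R : realType.
Implicit Types (K : geometry) (a b c p q r x y z : R).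
Local Notation kappa := (curvature R).

Lemma half_sum_sn K x y z :
  sn K (x + y + z) + sn K (z + x - y) + sn K (x + y - z) - sn K (y + z - x) =
  4 * (sn K x * cn K y * cn K z).
Proof. by rewrite !(snB, cnB, snD, cnD); ring. Qed.

Lemma sum_half_sn K x y z :
  sn K (y + z - x) + sn K (z + x - y) + sn K (x + y - z) - sn K (x + y + z) =
  kappa K * (4 * (sn K x * sn K y * sn K z)).
Proof. by rewrite !(snB, cnB, snD, cnD); ring. Qed.

(** The product of the tangents of two half angles is free of square roots, which makes
    [angle_half_sums] accessible. *)
Lemma tau_mul K p q r : deficits K p q r ->
  tau K (p + q + r) p q r * tau K (p + q + r) q r p = sn K r / sn K (p + q + r).
Proof.
move=> d; have [[/sn_gt0 gp /sn_gt0 gq /sn_gt0 gr] _] := deficits_good d.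
have [_ _ _ /sn_gt0 gW] := d; rewrite /tau -sqrtrM; last first.
  by rewrite ltW// divr_gt0// mulr_gt0.
rewrite [X in Num.sqrt X](_ : _ = (sn K r / sn K (p + q + r)) ^+ 2); last first.
  by field; rewrite !gt_eqF.
by rewrite sqrtr_sqr ger0_norm// ltW// divr_gt0.
Qed.

Lemma cn_half_gt0 K x : good K x -> 0 < cn K (x / 2).
Proof.
case: K => /andP[x0 h] //=; first by rewrite cos_gt0_pihalf//; apply/andP; split; lra.
exact: cosh_gt0.
Qed.

Lemma good_half K x : good K x -> good K (x / 2).
Proof. by move=> g; have g0 := good_gt0 g; apply: good_le g; lra. Qed.

Lemma gt0_of_sin (u : R) : 0 < sin u -> - pi < u -> 0 < u.
Proof.
move=> su upi; rewrite ltNge; apply/negP => u0; move: su; rewrite ltNge => /negP; apply.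
by rewrite -[u]opprK sinN oppr_le0 sin_ge0_pi//; apply/andP; split; lra.
Qed.

(** Identities in the manner of Delambre. Expanding the cosines leaves only pairwise products of
    half-angle tangents, which [tau_mul] gives as quotients of [sn]; [half_sum_sn] and [sum_half_sn]
    turn the resulting sums into products of half sides. They describe both the polar spherical
    triangle and the half sides of a hyperbolic one. *)
Lemma angle_half_sums K a b c : tri K a b c ->
  let A := tri_angle K a b c in let B := tri_angle K b c a in
  let C := tri_angle K c a b in
  exists2 m, 0 < m &
  [/\ cos ((B + C - A) / 2) = m * (sn K (a / 2) * cn K (b / 2) * cn K (c / 2)),
      cos ((C + A - B) / 2) = m * (sn K (b / 2) * cn K (c / 2) * cn K (a / 2)),
      cos ((A + B - C) / 2) = m * (sn K (c / 2) * cn K (a / 2) * cn K (b / 2)) &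
      cos ((A + B + C) / 2) =
        - kappa K * (m * (sn K (a / 2) * sn K (b / 2) * sn K (c / 2)))].
Proof.
move=> T A B C.
have [[hW ha hb hc] _] := tri_halves a b c.
have := tau_mul T; have := tau_mul (tri_rot T); have := tau_mul (tri_rot (tri_rot T)).
have [[hW2 _ _ _] _] := tri_halves b c a; have [[hW3 _ _ _] _] := tri_halves c a b.
have sW : 0 < sn K ((a + b + c) / 2).
  by have [_ _ _ /sn_gt0] := T; rewrite hW.
have AE : A / 2 = atan (tau K ((a + b + c) / 2) ((b + c - a) / 2) ((c + a - b) / 2) ((a + b - c) / 2)).
  by rewrite /A /tri_angle /ang mulrAC divff// mul1r.
have BE : B / 2 = atan (tau K ((a + b + c) / 2) ((c + a - b) / 2) ((a + b - c) / 2) ((b + c - a) / 2)).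
  by rewrite /B /tri_angle /ang mulrAC divff// mul1r (_ : b + c + a = a + b + c)//; ring.
have CE : C / 2 = atan (tau K ((a + b + c) / 2) ((a + b - c) / 2) ((b + c - a) / 2) ((c + a - b) / 2)).
  by rewrite /C /tri_angle /ang mulrAC divff// mul1r (_ : c + a + b = a + b + c)//; ring.
rewrite hW hW2 hW3 (_ : b + c + a = a + b + c); last by ring.
rewrite (_ : c + a + b = a + b + c); last by ring.
move: AE BE CE; move: (tau _ _ _ _ _) (tau _ _ _ _ _) (tau _ _ _ _ _) => t3 t2 t1.
move=> AE BE CE e31 e23 e12.
have cpos t : 0 < cos (atan t :> R).
  by apply: cos_gt0_pihalf; rewrite atan_gtNpi2 atan_ltpi2.
pose P := cos (atan t1) * cos (atan t2) * cos (atan t3).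
have P0 : 0 < P by rewrite !mulr_gt0.
have [[s1 _] [s2 _] [s3 _]] := And3 (sin_cos_atan t1) (sin_cos_atan t2) (sin_cos_atan t3).
have hs := half_sum_sn K (a / 2) (b / 2) (c / 2).
have hs2 := half_sum_sn K (b / 2) (c / 2) (a / 2).
have hs3 := half_sum_sn K (c / 2) (a / 2) (b / 2).
have ks := sum_half_sn K (a / 2) (b / 2) (c / 2).
have E (u v : R) : u / 2 + v / 2 = (u + v) / 2 by rewrite mulrDl.
have E' (u v : R) : u / 2 - v / 2 = (u - v) / 2 by rewrite mulrBl.
rewrite !(E, E') in hs hs2 hs3 ks.
rewrite (_ : b + c + a = a + b + c) in hs2; last by ring.
rewrite (_ : c + a + b = a + b + c) in hs3; last by ring.
(* P is the product of the cosines of the half angles, the denominator comes from [tau_mul], and the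
   4 from [half_sum_sn]. *)
exists (4 * P / sn K ((a + b + c) / 2)); first by rewrite divr_gt0// mulr_gt0.
have W0 : sn K ((a + b + c) / 2) != 0 by rewrite gt_eqF.
have mE (u v : R) : 4 * u = v -> 4 * P / sn K ((a + b + c) / 2) * u =
    P * (v / sn K ((a + b + c) / 2)).
  by move=> <-; field.
have [-> -> -> ->] : [/\ (B + C - A) / 2 = B / 2 + C / 2 - A / 2,
    (C + A - B) / 2 = C / 2 + A / 2 - B / 2, (A + B - C) / 2 = A / 2 + B / 2 - C / 2 &
    (A + B + C) / 2 = A / 2 + B / 2 + C / 2].
  by rewrite !(mulrBl, mulrDl).
rewrite AE BE CE; split.
- rewrite (mE _ _ (esym hs)) cosB cosD sinD s1 s2 s3.
  transitivity (P * (1 - t2 * t3 + t3 * t1 + t1 * t2)); first by rewrite /P; ring.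
  by rewrite e12 e23 e31; congr (_ * _); field.
- rewrite (mE _ _ (esym hs2)) cosB cosD sinD s1 s2 s3.
  transitivity (P * (1 + t2 * t3 - t3 * t1 + t1 * t2)); first by rewrite /P; ring.
  by rewrite e12 e23 e31; congr (_ * _); field.
- rewrite (mE _ _ (esym hs3)) cosB cosD sinD s1 s2 s3.
  transitivity (P * (1 + t2 * t3 + t3 * t1 - t1 * t2)); first by rewrite /P; ring.
  by rewrite e12 e23 e31; congr (_ * _); field.
- rewrite (mulrCA (- kappa K)) (mE _ (sn K ((a + b + c) / 2) - sn K ((b + c - a) / 2)
     - sn K ((c + a - b) / 2) - sn K ((a + b - c) / 2))); last first.
    by rewrite mulrCA mulNr -ks; ring.
  rewrite !(cosD, sinD) s1 s2 s3.
  transitivity (P * (1 - t2 * t3 - t3 * t1 - t1 * t2)); first by rewrite /P; ring.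
  by rewrite e12 e23 e31; congr (_ * _); field.
Qed.

(** Up to sign, the cosines of [angle_half_sums] are the sines of the deficits and of the
    semi-perimeter of the triangle with sides pi - A, pi - B, pi - C. Their signs show that it
    exists, and the half-angle formula gives the tangent cot (a / 2). *)
Lemma polar_triangle a b c : tri Spherical a b c ->
  let A := tri_angle Spherical a b c in let B := tri_angle Spherical b c a in
  let C := tri_angle Spherical c a b in
  tri Spherical (pi - A) (pi - B) (pi - C) /\
  tri_angle Spherical (pi - A) (pi - B) (pi - C) = pi - a.
Proof.
move=> T A B C; have [m m0 [h1 h2 h3 h4]] := angle_half_sums T.
rewrite -/A -/B -/C in h1 h2 h3 h4.
have /andP[A0 Api] := tri_angle_itv T; have /andP[B0 Bpi] := tri_angle_itv (tri_rot T).
have /andP[C0 Cpi] := tri_angle_itv (tri_rot (tri_rot T)).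
rewrite -/A -/B -/C in A0 Api B0 Bpi C0 Cpi.
have [ga gb gc] := tri_gt0 T.
have [sa [sb sc]] := (sn_gt0 (good_half ga), (sn_gt0 (good_half gb), sn_gt0 (good_half gc))).
have [ca [cb cc]] := (cn_half_gt0 ga, (cn_half_gt0 gb, cn_half_gt0 gc)).
have comp u : sin (pi / 2 - u) = cos u :> R.
  by rewrite sinB sin_pihalf cos_pihalf mul1r mul0r subr0.
have e1 : (pi - B + (pi - C) - (pi - A)) / 2 = pi / 2 - (B + C - A) / 2 by field.
have e2 : (pi - C + (pi - A) - (pi - B)) / 2 = pi / 2 - (C + A - B) / 2 by field.
have e3 : (pi - A + (pi - B) - (pi - C)) / 2 = pi / 2 - (A + B - C) / 2 by field.
have e4 : (pi - A + (pi - B) + (pi - C)) / 2 = pi + (pi / 2 - (A + B + C) / 2) by field.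
have s1 := comp ((B + C - A) / 2); have s2 := comp ((C + A - B) / 2).
have s3 := comp ((A + B - C) / 2); have s4 := comp ((A + B + C) / 2).
rewrite -e1 h1 in s1; rewrite -e2 h2 in s2; rewrite -e3 h3 in s3; rewrite h4 in s4.
have s5 : sin ((pi - A + (pi - B) + (pi - C)) / 2) =
    m * (sn Spherical (a / 2) * sn Spherical (b / 2) * sn Spherical (c / 2)).
  by rewrite e4 addrC sinDpi s4 /=; ring.
have [p1 p2 p3] : [/\ 0 < (pi - B + (pi - C) - (pi - A)) / 2,
    0 < (pi - C + (pi - A) - (pi - B)) / 2 & 0 < (pi - A + (pi - B) - (pi - C)) / 2].
  split; apply: gt0_of_sin; rewrite ?s1 ?s2 ?s3 ?mulr_gt0//;
    by clear - A0 Api B0 Bpi C0 Cpi; lra.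
have T' : tri Spherical (pi - A) (pi - B) (pi - C).
  split=> //; have [[-> _ _ _] _] := tri_halves (pi - A) (pi - B) (pi - C).
  apply/andP; split; first by clear - A0 Api B0 Bpi C0 Cpi; lra.
  have := @gt0_of_sin (pi - (pi - A + (pi - B) + (pi - C)) / 2).
  rewrite sinB sinpi cospi mul0r sub0r mulN1r opprK s5 subr_gt0; apply.
    by rewrite !mulr_gt0.
  by clear - A0 Api B0 Bpi C0 Cpi; lra.
split=> //; rewrite /tri_angle /ang.
have -> : tau Spherical ((pi - A + (pi - B) + (pi - C)) / 2)
    ((pi - B + (pi - C) - (pi - A)) / 2) ((pi - C + (pi - A) - (pi - B)) / 2)
    ((pi - A + (pi - B) - (pi - C)) / 2) = tan (pi / 2 - a / 2).
  rewrite /tau /= s1 s2 s3 s5 /tan comp cosB cos_pihalf sin_pihalf mul0r add0r mul1r.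
  rewrite /= in sa sb sc ca cb cc.
  rewrite (_ : _ / _ = (cos (a / 2) / sin (a / 2)) ^+ 2).
    by rewrite sqrtr_sqr ger0_norm// divr_ge0// ltW.
  by rewrite /=; field; rewrite !gt_eqF.
rewrite tanK; first by field.
by case/andP: ga => a0 api; rewrite in_itv/=; clear - a0 api; apply/andP; split; lra.
Qed.

End polar_duality.

Section spherical_monotonicity.
Variable R : realType.
Implicit Types (a b c x y z : R).

Lemma spherical_monotone (lam : R) a0 b0 c0 a1 b1 c1 :
  0 <= lam \/ lam <= -1 -> tri Spherical a0 b0 c0 -> tri Spherical a1 b1 c1 ->
  let J := Jsin lam in let h := Jsin (- lam - 1) in
  let D := (h a1 - h a0) * (J (tri_angle Spherical a1 b1 c1) - J (tri_angle Spherical a0 b0 c0))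
         + (h b1 - h b0) * (J (tri_angle Spherical b1 c1 a1) - J (tri_angle Spherical b0 c0 a0))
         + (h c1 - h c0) * (J (tri_angle Spherical c1 a1 b1) - J (tri_angle Spherical c0 a0 b0)) in
  0 <= D /\ (D = 0 -> [/\ a0 = a1, b0 = b1 & c0 = c1]).
Proof.
have gI x : good Spherical x -> 0 < x < pi by [].
have dJ (mu : R) x : good Spherical x -> is_derive x 1 (Jsin mu) (sin x `^ mu).
  by move=> /gI; exact: is_derive_Jsin.
have Jinj (mu : R) x y : good Spherical x -> good Spherical y -> Jsin mu x = Jsin mu y -> x = y.
  move=> gx gy; apply: (@good_inj R Spherical (Jsin mu) (fun x => sin x `^ mu) x y _ _ gx gy).
  by move=> z /sn_gt0 ?; exact: powR_gt0.
have key (mu : R) x0 y0 z0 x1 y1 z1 : mu <= -1 -> tri Spherical x0 y0 z0 ->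
  tri Spherical x1 y1 z1 ->
  let J := Jsin mu in let h := Jsin (- mu - 1) in
  let D := (h x1 - h x0) * (J (tri_angle Spherical x1 y1 z1) - J (tri_angle Spherical x0 y0 z0))
         + (h y1 - h y0) * (J (tri_angle Spherical y1 z1 x1) - J (tri_angle Spherical y0 z0 x0))
         + (h z1 - h z0) * (J (tri_angle Spherical z1 x1 y1) - J (tri_angle Spherical z0 x0 y0)) in
  0 <= D /\ (D = 0 -> [/\ x0 = x1, y0 = y1 & z0 = z1]).
  move=> mu1 T0 T1 J h D.
  have [D0 Dz] := @sine_monotone R Spherical mu h x0 y0 z0 x1 y1 z1 ltac:(by []) mu1
    (dJ (- mu - 1)) T0 T1.
  have [gx0 gy0 gz0] := tri_gt0 T0; have [gx1 gy1 gz1] := tri_gt0 T1.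
  split; first exact: D0.
  move=> /Dz[s [t [sI /(_ erefl) t0 [x [y [z [_ [[ex _] [ey _] [ez _]]]]]]]]].
  rewrite t0 !mul0r in ex ey ez.
  have eq x0' x1' : good Spherical x0' -> good Spherical x1' -> h x1' - h x0' = 0 -> x0' = x1'.
    move=> g0 g1 e; apply: (Jinj (- mu - 1)); [exact: g0|exact: g1|].
    by apply/esym/eqP; rewrite -subr_eq0 -/(h _) -/(h x0') e.
  by split; apply: eq.
move=> [lam0|lam1] T0 T1 J h D; last exact: key.
have [T0' A0] := polar_triangle T0; have [_ B0] := polar_triangle (tri_rot T0).
have [_ C0] := polar_triangle (tri_rot (tri_rot T0)).
have [T1' A1] := polar_triangle T1; have [_ B1] := polar_triangle (tri_rot T1).
have [_ C1] := polar_triangle (tri_rot (tri_rot T1)).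
have [gx0 gy0 gz0] := tri_gt0 T0; have [gx1 gy1 gz1] := tri_gt0 T1.
have gA x y z : tri Spherical x y z -> good Spherical (tri_angle Spherical x y z).
  by move=> /tri_angle_itv.
have [R0 R1] := (tri_rot T0, tri_rot T1); have [S0 S1] := (tri_rot R0, tri_rot R1).
have [[gA0 gB0 gC0] [gA1 gB1 gC1]] := (And3 (gA _ _ _ T0) (gA _ _ _ R0) (gA _ _ _ S0),
  And3 (gA _ _ _ T1) (gA _ _ _ R1) (gA _ _ _ S1)).
have sym (mu : R) x y : good Spherical x -> good Spherical y ->
    Jsin mu (pi - y) - Jsin mu (pi - x) = - (Jsin mu y - Jsin mu x).
  move=> gx gy; have E : Jsin mu (pi - x) + Jsin mu x = Jsin mu (pi - y) + Jsin mu y.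
    apply: (@reflection_antisymmetric R (Jsin mu) (fun x => sin x `^ mu) _ _ x y gx gy).
    by move=> z _; rewrite sinB sinpi cospi mul0r sub0r mulN1r opprK.
  have -> : Jsin mu (pi - y) = Jsin mu (pi - x) + Jsin mu x - Jsin mu y by rewrite E; ring.
  by ring.
(* For the polar triangles sides and angles trade places, and x -> pi - x flips the sign of both
   factors in each product, so D is unchanged. *)
have mu1 : - lam - 1 <= -1 by lra.
have [] := key (- lam - 1) _ _ _ _ _ _ mu1 T0' T1'.
rewrite A0 B0 C0 A1 B1 C1 (_ : - (- lam - 1) - 1 = lam); last by ring.
have sJ := sym lam; have sh := sym (- lam - 1); rewrite -/J -/h in sJ sh *.
have jA := sJ _ _ gA0 gA1; have jB := sJ _ _ gB0 gB1; have jC := sJ _ _ gC0 gC1.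
have ha := sh _ _ gx0 gx1; have hb := sh _ _ gy0 gy1; have hc := sh _ _ gz0 gz1.
have inj x y : pi - x = pi - y -> x = y :> R by move=> e; clear - e; lra.
have eqs : pi - tri_angle Spherical a0 b0 c0 = pi - tri_angle Spherical a1 b1 c1 ->
    pi - tri_angle Spherical b0 c0 a0 = pi - tri_angle Spherical b1 c1 a1 ->
    pi - tri_angle Spherical c0 a0 b0 = pi - tri_angle Spherical c1 a1 b1 ->
    [/\ a0 = a1, b0 = b1 & c0 = c1].
  move=> e1 e2 e3; split; apply: inj.
  - by rewrite -A0 -A1 e1 e2 e3.
  - by rewrite -B0 -B1 e1 e2 e3.
  - by rewrite -C0 -C1 e1 e2 e3.
rewrite /D {D}; clearbody J h.
move: jA jB jC ha hb hc eqs; clear.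
move: (tri_angle Spherical a0 b0 c0) (tri_angle Spherical b0 c0 a0) (tri_angle Spherical c0 a0 b0).
move: (tri_angle Spherical a1 b1 c1) (tri_angle Spherical b1 c1 a1) (tri_angle Spherical c1 a1 b1).
move=> A1 B1 C1 A0 B0 C0 -> -> -> -> -> -> eqs D0 Dz.
have DE : (h a1 - h a0) * (J A1 - J A0) + (h b1 - h b0) * (J B1 - J B0) +
    (h c1 - h c0) * (J C1 - J C0) =
    - (J A1 - J A0) * - (h a1 - h a0) + - (J B1 - J B0) * - (h b1 - h b0) +
    - (J C1 - J C0) * - (h c1 - h c0) by ring.
rewrite DE; split=> [|/Dz[e1 e2 e3]]; first exact: D0.
exact: eqs.
Qed.

End spherical_monotonicity.

Section euclidean_monotonicity.
Variable R : realType.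
Implicit Types (a b c x y z : R).

Lemma euclidean_monotone (lam : R) a0 b0 c0 a1 b1 c1 :
  lam <= -1 -> tri Euclidean a0 b0 c0 -> tri Euclidean a1 b1 c1 ->
  let J := Jsin lam in let h x := x `^ (- lam) / (- lam) in
  let D := (h a1 - h a0) * (J (tri_angle Euclidean a1 b1 c1) - J (tri_angle Euclidean a0 b0 c0))
         + (h b1 - h b0) * (J (tri_angle Euclidean b1 c1 a1) - J (tri_angle Euclidean b0 c0 a0))
         + (h c1 - h c0) * (J (tri_angle Euclidean c1 a1 b1) - J (tri_angle Euclidean c0 a0 b0)) in
  0 <= D /\ (D = 0 -> exists2 rho : R, 0 < rho &
    [/\ a1 = rho * a0, b1 = rho * b0 & c1 = rho * c0]).
Proof.
move=> lam1 T0 T1 J h; have n0 : 0 < - lam by lra.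
have nn : - lam != 0 by rewrite gt_eqF.
have dh x : good Euclidean x -> is_derive x 1 h (sn Euclidean x `^ (- lam - 1)).
  move=> /good_gt0 x0; have := is_derMl (- lam)^-1 (is_derive1_powR (- lam) x0).
  rewrite mulrA mulVf// mul1r /= => dd; apply: is_derive_eq; last by [].
  by move: dd; under eq_fun do rewrite mulrC.
have := @sine_monotone R Euclidean lam h a0 b0 c0 a1 b1 c1 ltac:(by []) lam1 dh T0 T1.
cbv zeta => -[D0 Dz]; split; first exact: D0.
move=> /Dz[s [t [sI _ [x [y [z [[gx gy gz] [ex ey ez]]]]]]]].
have [ga0 gb0 gc0] := tri_gt0 T0; have [ga1 gb1 gc1] := tri_gt0 T1.
clear D0 Dz dh J T0 T1.
have h0 u : good Euclidean u -> 0 < h u.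
  by move=> /good_gt0 u0; rewrite /h divr_gt0// powR_gt0.
(* h is homogeneous of degree -lambda, so a velocity proportional to the side is a velocity of h
   proportional to h, with factor q. Both end values of h are then fixed multiples of the
   intermediate one, and their ratio is the same for the three sides. *)
pose q := t * - lam.
have aux u u0 u1 : good Euclidean u -> good Euclidean u0 -> good Euclidean u1 ->
    h u1 - h u0 = t * u * sn Euclidean u `^ (- lam - 1) /\
    h u = h u0 + s * (h u1 - h u0) -> 0 < 1 - q * s /\ h u1 = (1 + q / (1 - q * s)) * h u0.
  move=> gu gu0 gu1 [e1 e2].
  have e : h u1 - h u0 = q * h u.
    rewrite e1 /q /h /=; have u00 := good_gt0 gu.
    rewrite -mulrA -[X in X * _ `^ _](powRr1 (ltW u00)) -powRD ?(gt_eqF u00) ?implybT//.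
    have -> : 1 + (- lam - 1) = - lam by ring.
    by move: (u `^ _) => v; field; rewrite -oppr_eq0.
  have e3 : (1 - q * s) * h u = h u0.
    by rewrite mulrBl mul1r -mulrA mulrCA -e e2; ring.
  have n1 : 0 < 1 - q * s by rewrite -(pmulr_lgt0 _ (h0 _ gu)) e3 h0.
  split; first exact: n1.
  have e4 : h u1 = q * h u + h u0 by rewrite -e subrK.
  by rewrite e4 -e3; move: (h u) n1 => v n1; field; rewrite gt_eqF.
have [n1 Ea] := aux _ _ _ gx ga0 ga1 ex; have [_ Eb] := aux _ _ _ gy gb0 gb1 ey.
have [_ Ec] := aux _ _ _ gz gc0 gc1 ez.
have Q0 : 0 < 1 + q / (1 - q * s) by rewrite -(pmulr_lgt0 _ (h0 _ ga0)) -Ea h0.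
exists ((1 + q / (1 - q * s)) `^ (- lam)^-1); first exact: powR_gt0.
have rt u0 u1 : good Euclidean u0 -> good Euclidean u1 ->
    h u1 = (1 + q / (1 - q * s)) * h u0 -> u1 = (1 + q / (1 - q * s)) `^ (- lam)^-1 * u0.
  move=> /good_gt0 g0 /good_gt0 g1 E.
  have E' : u1 `^ (- lam) = (1 + q / (1 - q * s)) * u0 `^ (- lam).
    by apply: (mulIf (invr_neq0 nn)); rewrite -mulrA; exact: E.
  rewrite -[LHS](powRr1 (ltW g1)) -(divff nn) powRrM E' powRM ?ltW ?powR_gt0//.
  by rewrite -powRrM divff// powRr1// ltW.
by split; apply: rt.
Qed.

End euclidean_monotonicity.

(** * Hyperbolic triangles *)

Section angular_form.
Variable R : realType.
Implicit Types (x y z p q r : R).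

(** For angles A, B, C the variables are (B + C - A) / 2 and its rotations, so the angles are y + z,
    z + x, x + y; the last condition says that A + B + C < pi. *)
Definition angular x y z := [/\ 0 < y + z, 0 < z + x, 0 < x + y & x + y + z < pi / 2].

Lemma angular_rot x y z : angular x y z -> angular y z x.
Proof. by case=> *; split=> //; lra. Qed.

Lemma angular_itv x y z : angular x y z -> - (pi / 2) < x < pi / 2.
Proof. by case=> *; apply/andP; split; lra. Qed.

Lemma angular_gt0 x y z : angular x y z ->
  [/\ 0 < cos x, 0 < cos y, 0 < cos z & 0 < cos (x + y + z)] /\
  [/\ 0 < sin (y + z), 0 < sin (z + x) & 0 < sin (x + y)].
Proof.
move=> d; split; split.
- exact/cos_gt0_pihalf/(angular_itv d).
- exact/cos_gt0_pihalf/(angular_itv (angular_rot d)).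
- exact/cos_gt0_pihalf/(angular_itv (angular_rot (angular_rot d))).
- by apply: cos_gt0_pihalf; case: d => *; apply/andP; split; lra.
- by apply: sin_gt0_pi; case: d => *; apply/andP; split; lra.
- by apply: sin_gt0_pi; case: d => *; apply/andP; split; lra.
- by apply: sin_gt0_pi; case: d => *; apply/andP; split; lra.
Qed.

(* In a hyperbolic triangle with angles y + z, z + x, x + y this is
   tanh (l / 2), where l is the side opposite to the angle y + z. *)
Definition half_side x y z : R :=
  Num.sqrt (cos x * cos (x + y + z) / (cos y * cos z)).

(** The common quotient cos x / tanh (l / 2); it plays the part that [sine_ratio] has for the sine
    weights. *)
Definition angular_scale x y z : R :=
  Num.sqrt (cos x * cos y * cos z / cos (x + y + z)).

Lemma half_side_scale x y z : angular x y z ->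
  [/\ 0 < angular_scale x y z, 0 < half_side x y z < 1 &
      cos x = angular_scale x y z * half_side x y z].
Proof.
move=> /angular_gt0[[cx cy cz cS] [sA sB sC]].
have h0 : 0 < cos x * cos (x + y + z) / (cos y * cos z) by rewrite divr_gt0 ?mulr_gt0.
have m0 : 0 < cos x * cos y * cos z / cos (x + y + z) by rewrite divr_gt0 ?mulr_gt0.
split.
- by rewrite sqrtr_gt0.
- rewrite sqrtr_gt0 h0/= -sqrtr1 ltr_sqrt// ltr_pdivrMr ?mulr_gt0// mul1r -subr_gt0.
  suff -> : cos y * cos z - cos x * cos (x + y + z) = sin (z + x) * sin (x + y).
    exact: mulr_gt0.
  have := cos2Dsin2 x; rewrite !(cosD, sinD) => e.
  by rewrite -[X in X - _]mul1r -e; ring.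
- rewrite -sqrtrM ?ltW// -[LHS]ger0_norm ?ltW// -sqrtr_sqr; congr Num.sqrt.
  by field; rewrite !gt_eqF.
Qed.

Lemma angular_scale_rot x y z : angular_scale y z x = angular_scale x y z.
Proof.
by rewrite /angular_scale (_ : y + z + x = x + y + z); [congr Num.sqrt; ring|ring].
Qed.

Lemma half_side_compl x y z : angular x y z ->
  1 - half_side x y z ^+ 2 = sin (z + x) * sin (x + y) / (cos y * cos z).
Proof.
move=> /angular_gt0[[cx cy cz cS] [sA sB sC]].
rewrite sqr_sqrtr; last by rewrite ltW// divr_gt0 ?mulr_gt0.
have -> : sin (z + x) * sin (x + y) = cos y * cos z - cos x * cos (x + y + z).
  have := cos2Dsin2 x; rewrite !(cosD, sinD) => e.
  by rewrite -[X in _ = X - _]mul1r -e; ring.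
by field; rewrite !gt_eqF.
Qed.

Lemma is_derive_half_side (x y z : R -> R) (s x' y' z' : R) :
  angular (x s) (y s) (z s) ->
  is_derive s 1 x x' -> is_derive s 1 y y' -> is_derive s 1 z z' ->
  is_derive s 1 (fun s => half_side (x s) (y s) (z s))
    (half_side (x s) (y s) (z s) / 2 *
      (- (sin (x s + y s + z s + x s) * (x' / cos (x s))
        + sin (z s + x s) * (y' / cos (y s)) + sin (x s + y s) * (z' / cos (z s)))
       / cos (x s + y s + z s))).
Proof.
move=> d dx dy dz; have [[cx cy cz cS] _] := angular_gt0 d.
have dc (f : R -> R) f' : is_derive s 1 f f' ->
    is_derive s 1 (fun s => cos (f s)) (- sin (f s) * f').
  by move=> df; apply: is_derc => //; exact: is_derive_cos.
have dS := is_derD (is_derD dx dy) dz.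
have den : cos (y s) * cos (z s) != 0 by rewrite gt_eqF// mulr_gt0.
have P0 : 0 < cos (x s) * cos (x s + y s + z s) / (cos (y s) * cos (z s)).
  by rewrite divr_gt0 ?mulr_gt0.
have dP := is_derM (is_derM (dc _ _ dx) (dc _ _ dS))
  (is_derV (f := fun s => cos (y s) * cos (z s)) den (is_derM (dc _ _ dy) (dc _ _ dz))).
have dd := is_derc (g := fun s => cos (x s) * cos (x s + y s + z s) / (cos (y s) * cos (z s)))
  (is_derive1_sqrt P0) dP.
apply: is_derive_eq dd _; rewrite -/(half_side (x s) (y s) (z s)).
have [_ /andP[t0 _] _] := half_side_scale d.
have t2 : half_side (x s) (y s) (z s) ^+ 2 =
    cos (x s) * cos (x s + y s + z s) / (cos (y s) * cos (z s)).
  by rewrite sqr_sqrtr// ltW.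
move: (half_side _ _ _) t0 t2 => t t0 t2.
have -> : sin (z s + x s) = sin (x s + y s + z s) * cos (y s) - cos (x s + y s + z s) * sin (y s).
  by rewrite -sinB; congr sin; ring.
have -> : sin (x s + y s) = sin (x s + y s + z s) * cos (z s) - cos (x s + y s + z s) * sin (z s).
  by rewrite -sinB; congr sin; ring.
have -> : sin (x s + y s + z s + x s) = sin (x s + y s + z s) * cos (x s) +
  cos (x s + y s + z s) * sin (x s) by exact: sinD.
move: t2 cS.
move: (cos (x s + y s + z s)) (sin (x s + y s + z s)) => cS sS t2 cS0.
move: cx cy cz t2; move: (cos (x s)) (cos (y s)) (cos (z s)) => x0 y0 z0 cx cy cz t2.
rewrite (_ : forall X, t / 2 * X = (2 * t)^-1 * (t ^+ 2 * X)); last first.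
  by move=> X; field; rewrite gt_eqF.
by rewrite t2; congr (_ * _); field; rewrite !gt_eqF.
Qed.

(** The form that [is_derive_half_side] produces in the variables p = x' / cos x and its
    rotations. *)
Definition angle_form x y z p q r :=
  sin (y + z) * p * (sin (x + y + z + x) * p + sin (z + x) * q + sin (x + y) * r) +
  sin (z + x) * q * (sin (y + z + x + y) * q + sin (x + y) * r + sin (y + z) * p) +
  sin (x + y) * r * (sin (z + x + y + z) * r + sin (y + z) * p + sin (z + x) * q).

(** With a, b, c the tangents of the half angles, the form is a sum of squares whose coefficients
    are positive because ab + bc + ca < 1, that is, because the angles add up to less than pi. *)
Lemma angle_form_ge0 x y z p q r : angular x y z ->
  0 <= angle_form x y z p q r /\
  (angle_form x y z p q r = 0 -> [/\ p = 0, q = 0 & r = 0]).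
Proof.
move=> d; have [A0 B0 C0 S0] := d.
have tp u : 0 < u -> u < pi -> 0 < tan (u / 2) /\ atan (tan (u / 2)) = u / 2.
  move=> u0 upi; split; last first.
    by apply: tanK; rewrite in_itv/=; apply/andP; split; lra.
  by rewrite /tan divr_gt0// ?sin_gt0_pi ?cos_gt0_pihalf//; apply/andP; split; lra.
have [a0 aE] : 0 < tan ((y + z) / 2) /\ atan (tan ((y + z) / 2)) = (y + z) / 2.
  by apply: tp => //; lra.
have [b0 bE] : 0 < tan ((z + x) / 2) /\ atan (tan ((z + x) / 2)) = (z + x) / 2.
  by apply: tp => //; lra.
have [c0 cE] : 0 < tan ((x + y) / 2) /\ atan (tan ((x + y) / 2)) = (x + y) / 2.
  by apply: tp => //; lra.
move: (tan _) (tan _) (tan _) a0 b0 c0 aE bE cE => c b a a0 b0 c0 aE bE cE.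
have [yz [zx xy]] : y + z = 2 * atan a /\ z + x = 2 * atan b /\ x + y = 2 * atan c.
  by rewrite aE bE cE; split; [|split]; field.
have e1 : 0 < 1 - (a * b + b * c + c * a).
  have [_ _ _] := (angular_gt0 d).1.
  have -> : x + y + z = atan a + atan b + atan c by rewrite aE bE cE; field.
  rewrite !(cosD, sinD) (sin_cos_atan a).1 (sin_cos_atan b).1 (sin_cos_atan c).1.
  have -> : forall u v w : R, (u * v - a * u * (b * v)) * w - (a * u * v + u * (b * v)) * (c * w)
    = u * v * w * (1 - (a * b + b * c + c * a)) by move=> *; ring.
  by rewrite pmulr_rgt0// !mulr_gt0// cos_gt0_pihalf// atan_gtNpi2 atan_ltpi2.
have [E1 [E2 E3]] : sin (x + y + z + x) = sin (z + x) * cos (x + y) + cos (z + x) * sin (x + y) /\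
  sin (y + z + x + y) = sin (x + y) * cos (y + z) + cos (x + y) * sin (y + z) /\
  sin (z + x + y + z) = sin (y + z) * cos (z + x) + cos (y + z) * sin (z + x).
  by rewrite -!sinD; split; [congr sin|split; congr sin]; ring.
have pos u : 0 < 1 + u ^+ 2 :> R by rewrite ltr_pwDl// sqr_ge0.
have [pa [pb pc]] := (pos a, (pos b, pos c)).
have -> : angle_form x y z p q r =
   4 * (a * b * c) / ((1 + a ^+ 2) * (1 + b ^+ 2) * (1 + c ^+ 2)) *
   ((1 - (a * b + b * c + c * a)) * ((q + r) ^+ 2 / a + (r + p) ^+ 2 / b + (p + q) ^+ 2 / c) +
    (b * c * (q + r) + c * a * (r + p) + a * b * (p + q)) ^+ 2 / (a * b * c)).
  rewrite /angle_form E1 E2 E3 yz zx xy !sin_2atan !cos_2atan.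
  by field; rewrite !gt_eqF.
have k0 : 0 < 4 * (a * b * c) / ((1 + a ^+ 2) * (1 + b ^+ 2) * (1 + c ^+ 2)).
  by rewrite divr_gt0 ?mulr_gt0.
have sq (u v : R) : 0 < v -> 0 <= u ^+ 2 / v by move=> v0; rewrite divr_ge0 ?sqr_ge0 ?ltW.
have abc0 : 0 < a * b * c by rewrite !mulr_gt0.
split; first by rewrite mulr_ge0 ?(ltW k0)// addr_ge0 ?sq// mulr_ge0 ?(ltW e1)// !addr_ge0 ?sq.
move/eqP; rewrite mulf_eq0 (gt_eqF k0)/= paddr_eq0 ?sq//; last first.
  by rewrite mulr_ge0 ?(ltW e1)// !addr_ge0 ?sq.
rewrite mulf_eq0 (gt_eqF e1)/= => /andP[+ _].
rewrite !paddr_eq0 ?addr_ge0 ?sq// !mulf_eq0 !invr_eq0 (gt_eqF a0) (gt_eqF b0) (gt_eqF c0).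
rewrite !orbF !orbb => /andP[/andP[/eqP h1 /eqP h2] /eqP h3].
by split; lra.
Qed.

(** The triangle is given by its angles, so that the statement also serves paths along which the
    angles are prescribed. [powR_weight] applies with cos x = M tanh (l / 2). Vanishing of u, v, w
    is recorded for the converse situation, in which the sides are prescribed. *)
Lemma cosine_weighted_form (lam : R) (x y z : R -> R) (s x' y' z' : R) :
  angular (x s) (y s) (z s) ->
  is_derive s 1 x x' -> is_derive s 1 y y' -> is_derive s 1 z z' ->
  exists u v w : R, [/\
    is_derive s 1 (fun s => half_side (x s) (y s) (z s)) u,
    is_derive s 1 (fun s => half_side (y s) (z s) (x s)) v,
    is_derive s 1 (fun s => half_side (z s) (x s) (y s)) w &
    let k t := t `^ (- lam - 1) * (2 / (1 - t ^+ 2)) in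
    exists m H : R, [/\ 0 < m, 0 <= H,
      H = 0 -> [/\ x' = 0, y' = 0 & z' = 0] /\ [/\ u = 0, v = 0 & w = 0] &
    k (half_side (x s) (y s) (z s)) * u * (cos (x s) `^ lam * x') +
    k (half_side (y s) (z s) (x s)) * v * (cos (y s) `^ lam * y') +
    k (half_side (z s) (x s) (y s)) * w * (cos (z s) `^ lam * z') = - (m * H)]].
Proof.
move=> d dx dy dz; have d2 := angular_rot d; have d3 := angular_rot d2.
have hx := is_derive_half_side d dx dy dz; have hy := is_derive_half_side d2 dy dz dx.
have hz := is_derive_half_side d3 dz dx dy.
do 3 eexists; split; [exact: hx|exact: hy|exact: hz|].
have [[cx cy cz cS] [sA sB sC]] := angular_gt0 d.
have [M0 /andP[t0 _] Mx] := half_side_scale d.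
have [_ /andP[t0' _] My] := half_side_scale d2; have [_ /andP[t0'' _] Mz] := half_side_scale d3.
have R1 := angular_scale_rot (x s) (y s) (z s).
have R2 := angular_scale_rot (y s) (z s) (x s).
rewrite R2 R1 in Mz; rewrite R1 in My; clear R1 R2.
have h1 := half_side_compl d; have h2 := half_side_compl d2; have h3 := half_side_compl d3.
move=> k.
set M := angular_scale (x s) (y s) (z s) in M0 Mx My Mz.
pose P := cos (x s) * cos (y s) * cos (z s).
pose Q := sin (y s + z s) * sin (z s + x s) * sin (x s + y s).
have P0 : 0 < P by rewrite !mulr_gt0.
have Q0 : 0 < Q by rewrite !mulr_gt0.
have [F0 Fz] := angle_form_ge0 (x' / cos (x s)) (y' / cos (y s)) (z' / cos (z s)) d.
exists (M `^ (lam + 1) * P / (M * Q * cos (x s + y s + z s))),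
  (angle_form (x s) (y s) (z s) (x' / cos (x s)) (y' / cos (y s)) (z' / cos (z s))).
split=> //; first by rewrite divr_gt0 ?mulr_gt0 ?powR_gt0.
  have z0 (u v : R) : 0 < v -> u / v = 0 -> u = 0.
    by move=> v0 /eqP; rewrite mulf_eq0 invr_eq0 (gt_eqF v0) orbF => /eqP.
  move=> /Fz[e1 e2 e3]; split; first by split; [exact: z0 cx e1|exact: z0 cy e2|exact: z0 cz e3].
  by rewrite e1 e2 e3 !(mulr0, addr0, oppr0, mul0r).
have aux (c c2 c3 s1 s2 s3 t L cS1 u : R) : 0 < c -> 0 < c2 -> 0 < c3 -> 0 < s1 ->
    0 < s2 -> 0 < s3 -> 0 < cS1 -> 0 < t ->
    P = c * c2 * c3 -> Q = s1 * s2 * s3 -> c = M * t -> 1 - t ^+ 2 = s2 * s3 / (c2 * c3) ->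
    k t * (t / 2 * (- L / cS1)) * (c `^ lam * u) =
    - (M `^ (lam + 1) * P / (M * Q * cS1) * (s1 * (u / c) * L)).
  move=> c0 c20 c30 s10 s20 s30 cS10 t10 EP EQ cE E.
  have := powR_weight lam t10 M0; rewrite -cE /k E EP EQ => <-.
  move: (t `^ _) (c `^ _) => w1 w2.
  have -> : c = M * t by exact: cE.
  by field; rewrite !gt_eqF.
have [S2 S3] : cos (y s + z s + x s) = cos (x s + y s + z s) /\
    cos (z s + x s + y s) = cos (x s + y s + z s) by split; congr cos; ring.
rewrite S2 S3.
rewrite (aux _ _ _ _ _ _ _ _ _ _ cx cy cz sA sB sC cS t0 erefl erefl Mx h1).
rewrite (aux _ _ _ _ _ _ _ _ _ _ cy cz cx sB sC sA cS t0' _ _ My h2); first last.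
  by rewrite /Q; ring.
  by rewrite /P; ring.
rewrite (aux _ _ _ _ _ _ _ _ _ _ cz cx cy sC sA sB cS t0'' _ _ Mz h3); first last.
  by rewrite /Q; ring.
  by rewrite /P; ring.
rewrite /angle_form; move: (_ / (M * Q * _)) => N; ring.
Qed.

End angular_form.

(** * Hyperbolic triangles described by sides or by half defects *)

Section hyperbolic_triangles.
Variable R : realType.
Implicit Types (a b c x y z s : R).

Definition half_defect K a b c : R :=
  (tri_angle K b c a + tri_angle K c a b - tri_angle K a b c) / 2.

Definition tanh_half a : R := sinh (a / 2) / cosh (a / 2).

Lemma tanh_half_gt0 a : 0 < a -> 0 < tanh_half a.
Proof. by move=> a0; rewrite divr_gt0 ?cosh_gt0// sinh_gt0// divr_gt0. Qed.

Lemma tanh_half_lt1 a : tanh_half a < 1.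
Proof.
rewrite ltr_pdivrMr ?cosh_gt0// mul1r /sinh /cosh.
have := expR_gt0 (- (a / 2)); move: (expR _) (expR _) => u v; lra.
Qed.

Lemma is_derive_tanh_half a :
  is_derive a 1 tanh_half ((1 - tanh_half a ^+ 2) / 2).
Proof.
have c0 : cosh (a / 2) != 0 by rewrite gt_eqF// cosh_gt0.
have dh : is_derive a 1 (fun a => a / 2) (2^-1).
  have := is_derM (is_derive_id a 1) (is_derive_cst (2^-1 : R) a 1).
  by rewrite mulr0 addr0 mul1r.
have ds := is_derc (g := fun a => a / 2) (is_derive_sn Hyperbolic (a / 2)) dh.
have dc := is_derc (g := fun a => a / 2) (is_derive_cn Hyperbolic (a / 2)) dh.
have dd := is_derM ds (is_derV (f := fun a => cosh (a / 2)) c0 dc).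
apply: is_derive_eq dd _; rewrite /tanh_half /=.
by field.
Qed.

(** In [angle_half_sums] curvature -1 makes the cosine of half the angle sum positive, so this sum
    is below pi; quotients of the four identities give tanh^2 of the half sides. *)
Lemma tri_angular a b c : tri Hyperbolic a b c ->
  let x := half_defect Hyperbolic a b c in let y := half_defect Hyperbolic b c a in
  let z := half_defect Hyperbolic c a b in
  [/\ angular x y z, half_side x y z = tanh_half a, half_side y z x = tanh_half b &
      half_side z x y = tanh_half c].
Proof.
move=> T x y z; have [m m0 [h1 h2 h3 h4]] := angle_half_sums T.
have [ga gb gc] := tri_gt0 T.
have [sa [sb sc]] := (sn_gt0 (good_half ga), (sn_gt0 (good_half gb), sn_gt0 (good_half gc))).
have [ca [cb cc]] := (cn_half_gt0 ga, (cn_half_gt0 gb, cn_half_gt0 gc)).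
have /andP[A0 Api] := tri_angle_itv T; have /andP[B0 Bpi] := tri_angle_itv (tri_rot T).
have /andP[C0 Cpi] := tri_angle_itv (tri_rot (tri_rot T)).
rewrite -/(half_defect Hyperbolic a b c) -/x in h1.
rewrite -/(half_defect Hyperbolic b c a) -/y in h2.
rewrite -/(half_defect Hyperbolic c a b) -/z in h3.
have [E1 E2 E3 E4] : [/\ y + z = tri_angle Hyperbolic a b c, z + x = tri_angle Hyperbolic b c a,
   x + y = tri_angle Hyperbolic c a b &
  x + y + z = (tri_angle Hyperbolic a b c + tri_angle Hyperbolic b c a + tri_angle Hyperbolic c a b) / 2].
  rewrite /x /y /z /half_defect; move: (tri_angle _ a _ _) (tri_angle _ b _ _) (tri_angle _ c _ _).
  by move=> u v w; split; field.
rewrite -E4 in h4.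
have [cS cP] : 0 < cos (x + y + z) /\ 0 < m * (sn Hyperbolic (a / 2) * sn Hyperbolic (b / 2) * sn Hyperbolic (c / 2)).
  have P0 : 0 < m * (sn Hyperbolic (a / 2) * sn Hyperbolic (b / 2) * sn Hyperbolic (c / 2)).
    by apply: mulr_gt0 m0 _; apply: mulr_gt0 sc; exact: mulr_gt0.
  by split; [rewrite h4 opprK mul1r; exact: P0|exact: P0].
rewrite -E1 -E2 -E3 in A0 Api B0 Bpi C0 Cpi.
have d : angular x y z.
  split=> //; rewrite ltNge; apply/negP => S1.
  suff : cos (x + y + z) <= 0 by rewrite leNgt cS.
  rewrite -[x + y + z](subrK pi) cosDpi oppr_le0; apply: cos_ge0_pihalf.
  have := @pi_gt0 R; clear - A0 B0 C0 Api Bpi Cpi S1.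
  by move: (pi) Api Bpi Cpi S1 => p *; apply/andP; split; lra.
have [[cx cy cz _] _] := angular_gt0 d.
rewrite /= opprK mul1r in h4; rewrite /= in h1 h2 h3 sa sb sc ca cb cc.
have key u v w t X Y Z : 0 < cos v -> 0 < cos w -> 0 < cosh (X / 2) -> 0 < sinh (X / 2) ->
   cos u = m * (sinh (X / 2) * cosh (Y / 2) * cosh (Z / 2)) ->
   cos v = m * (sinh (Y / 2) * cosh (Z / 2) * cosh (X / 2)) ->
   cos w = m * (sinh (Z / 2) * cosh (X / 2) * cosh (Y / 2)) ->
   cos t = m * (sinh (X / 2) * sinh (Y / 2) * sinh (Z / 2)) ->
   cos u * cos t / (cos v * cos w) = tanh_half X ^+ 2.
  move=> cv0 cw0 cX sX eu ev ew ->.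
  rewrite /tanh_half; move: cv0 cw0; rewrite eu ev ew => cv0 cw0.
  have n1 := lt0r_neq0 cv0; have n2 := lt0r_neq0 cw0.
  move: (sinh (X / 2)) (cosh (X / 2)) (sinh (Y / 2)) (cosh (Y / 2)) (sinh (Z / 2)) (cosh (Z / 2))
     n1 n2 cX sX => p p' q q' r r'; rewrite !mulf_eq0 !negb_or => /andP[m1 /andP[/andP[n1 n2] n3]].
  move=> /andP[_ /andP[/andP[n4 n5] n6]] /lt0r_neq0 k1 /lt0r_neq0 k2.
  by field; rewrite ?m1 ?n1 ?n2 ?n3 ?n4 ?n5 ?n6 ?k1 ?k2.
have hs u : 0 < u -> Num.sqrt (tanh_half u ^+ 2) = tanh_half u.
  by move=> u0; rewrite sqrtr_sqr ger0_norm// ltW// tanh_half_gt0.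
rewrite /half_side (_ : y + z + x = x + y + z); last by ring.
rewrite (_ : z + x + y = x + y + z); last by ring.
split; first exact: d.
- by rewrite (key x y z (x + y + z) a b c)// hs// (good_gt0 ga).
- rewrite (key y z x (x + y + z) b c a) ?hs// ?(good_gt0 gb)//.
  by rewrite h4; ring.
- rewrite (key z x y (x + y + z) c a b) ?hs// ?(good_gt0 gc)//.
  by rewrite h4; ring.
Qed.

Lemma tri_near (T : topologicalType) (K : geometry) (a b c : T -> R) (s : T) :
  {for s, continuous a} -> {for s, continuous b} -> {for s, continuous c} ->
  tri K (a s) (b s) (c s) -> \forall t \near s, tri K (a t) (b t) (c t).
Proof.
move=> ca cb cc [p0 q0 r0 gW].
have cD (f g : T -> R) : {for s, continuous f} -> {for s, continuous g} ->
  {for s, continuous (fun t => f t + g t)} by move=> *; exact: cvgD.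
have cB (f g : T -> R) : {for s, continuous f} -> {for s, continuous g} ->
  {for s, continuous (fun t => f t - g t)} by move=> *; exact: cvgB.
have ch (f : T -> R) : {for s, continuous f} -> {for s, continuous (fun t => f t / 2)}.
  by move=> cf; apply: cvgM => //; exact: cvg_cst.
have c1 := ch _ (cB _ _ (cD _ _ cb cc) ca); have c2 := ch _ (cB _ _ (cD _ _ cc ca) cb).
have c3 := ch _ (cB _ _ (cD _ _ ca cb) cc).
have c4 := cD _ _ (cD _ _ c1 c2) c3.
near=> t; split; near: t.
- exact: (cvgr_gt _ c1 _ p0).
- exact: (cvgr_gt _ c2 _ q0).
- exact: (cvgr_gt _ c3 _ r0).
- exact: (c4 _ (good_near gW)).
Unshelve. all: by end_near. Qed.

Section cosine_weight.
Variable lam : R.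

Definition Jcos (t : R) := oriented_integral 0 t (fun t => cos t `^ lam).

Lemma is_derive_Jcos t : - (pi / 2) < t < pi / 2 -> is_derive t 1 Jcos (cos t `^ lam).
Proof.
move=> tI; apply: (@is_derive_oriented_integral _ (fun t => cos t `^ lam) (- (pi / 2)) (pi / 2)) => //.
  by have := @pi_gt0 R; move=> ?; apply/andP; split; lra.
move=> u uI; have s0 := cos_gt0_pihalf uI.
apply: is_derive_continuous; apply: (is_derc (f := @powR R ^~ lam)).
exact: is_derive1_powR.
Qed.

(** Density of the coordinate of an edge with respect to T = tanh (l / 2), since dl = 2 dT / (1 -
    T^2). *)
Definition tanh_weight t : R := t `^ (- lam - 1) * (2 / (1 - t ^+ 2)).

(** The base point 1/2 is an arbitrary point of ]0, 1[; from 0 the integral diverges when lambda >=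
    0. *)
Definition Jtanh (t : R) := oriented_integral 2^-1 t tanh_weight.

Lemma is_derive_Jtanh (t : R) : 0 < t < 1 -> is_derive t 1 Jtanh (tanh_weight t).
Proof.
move=> tI; apply: (@is_derive_oriented_integral _ tanh_weight 0 1) => //.
  by apply/andP; split; lra.
move=> u /andP[u0 u1].
have n : 1 - u ^+ 2 != 0 by rewrite gt_eqF// subr_gt0 expr_lt1// ltW.
have d1 := is_derB (is_derive_cst (1 : R) u 1) (is_derX2 (is_derive_id u 1)).
have d2 := is_derM (is_derive1_powR (- lam - 1) u0) (is_derMl 2 (is_derV (f := fun t : R => 1 - t ^+ 2) n d1)).
exact: (is_derive_continuous d2).
Qed.

Lemma is_derive_Jtanh_half a : 0 < a ->
  is_derive a 1 (fun a => Jtanh (tanh_half a)) (tanh_half a `^ (- lam - 1)).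
Proof.
move=> a0; have t0 := tanh_half_gt0 a0; have t1 := tanh_half_lt1 a.
have tI : 0 < tanh_half a < 1 by rewrite t0.
have dd := is_derc (is_derive_Jtanh tI) (is_derive_tanh_half a).
apply: is_derive_eq dd _; rewrite /tanh_weight; move: (_ `^ _) => w.
by field; rewrite gt_eqF// subr_gt0 expr_lt1// ltW.
Qed.

Lemma is_derive_half_defect K (a b c : R -> R) s (a' b' c' : R) :
  tri K (a s) (b s) (c s) ->
  is_derive s 1 a a' -> is_derive s 1 b b' -> is_derive s 1 c c' ->
  exists x', is_derive s 1 (fun s => half_defect K (a s) (b s) (c s)) x'.
Proof.
move=> T da db dc; have T2 := tri_rot T; have T3 := tri_rot T2.
have dd := is_derM (is_derB (is_derD (is_derive_tri_angle T2 db dc da)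
  (is_derive_tri_angle T3 dc da db)) (is_derive_tri_angle T da db dc))
  (is_derive_cst (2^-1 : R) s 1).
by eexists; exact: dd.
Qed.

(** No formula for the derivatives of the angles enters. They exist, and near s the function
    [half_side] of the angles is [tanh_half] of the sides, so uniqueness of derivatives identifies
    u, v, w of [cosine_weighted_form] with multiples of a', b', c'. *)
Lemma hyperbolic_weighted_form (a b c : R -> R) s (a' b' c' A B C : R) :
  a' * tanh_half (a s) `^ (- lam - 1) = A -> b' * tanh_half (b s) `^ (- lam - 1) = B ->
  c' * tanh_half (c s) `^ (- lam - 1) = C ->
  tri Hyperbolic (a s) (b s) (c s) ->
  is_derive s 1 a a' -> is_derive s 1 b b' -> is_derive s 1 c c' ->
  exists u v w : R, [/\
    is_derive s 1 (fun s => Jcos (half_defect Hyperbolic (a s) (b s) (c s))) u,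
    is_derive s 1 (fun s => Jcos (half_defect Hyperbolic (b s) (c s) (a s))) v,
    is_derive s 1 (fun s => Jcos (half_defect Hyperbolic (c s) (a s) (b s))) w &
    exists m H : R, [/\ 0 < m, 0 <= H, H = 0 -> [/\ a' = 0, b' = 0 & c' = 0] &
    A * u + B * v + C * w = - (m * H)]].
Proof.
move=> EA EB EC T da db dc; have T2 := tri_rot T; have T3 := tri_rot T2.
have [x' dx] := is_derive_half_defect T da db dc.
have [y' dy] := is_derive_half_defect T2 db dc da.
have [z' dz] := is_derive_half_defect T3 dc da db.
have [d _ _ _] := tri_angular T.
have [u [v [w [du dv dw [m [H [m0 H0 Hz E]]]]]]] := cosine_weighted_form
  (x := fun s => half_defect Hyperbolic (a s) (b s) (c s))
  (y := fun s => half_defect Hyperbolic (b s) (c s) (a s))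
  (z := fun s => half_defect Hyperbolic (c s) (a s) (b s)) lam d dx dy dz.
have nT : \forall t \near s, tri Hyperbolic (a t) (b t) (c t).
  by apply: tri_near T; [exact: is_derive_continuous da|exact: is_derive_continuous db|
     exact: is_derive_continuous dc].
have dth (f : R -> R) f' : is_derive s 1 f f' ->
    is_derive s 1 (fun t => tanh_half (f t)) ((1 - tanh_half (f s) ^+ 2) / 2 * f').
  by move=> df; exact: (is_derc (is_derive_tanh_half (f s)) df).
have eqd (f : R -> R) (g : R -> R) f' e : is_derive s 1 f f' -> is_derive s 1 g e ->
    (\forall t \near s, g t = tanh_half (f t)) -> e = (1 - tanh_half (f s) ^+ 2) / 2 * f'.
  move=> df [_ <-] fg; have [_ <-] := dth _ _ df.
  exact: near_eq_derive fg.
have [nu nv nw] : [/\ \forall t \near s, half_side (half_defect Hyperbolic (a t) (b t) (c t))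
     (half_defect Hyperbolic (b t) (c t) (a t)) (half_defect Hyperbolic (c t) (a t) (b t)) =
     tanh_half (a t),
   \forall t \near s, half_side (half_defect Hyperbolic (b t) (c t) (a t))
     (half_defect Hyperbolic (c t) (a t) (b t)) (half_defect Hyperbolic (a t) (b t) (c t)) =
     tanh_half (b t) &
   \forall t \near s, half_side (half_defect Hyperbolic (c t) (a t) (b t))
     (half_defect Hyperbolic (a t) (b t) (c t)) (half_defect Hyperbolic (b t) (c t) (a t)) =
     tanh_half (c t)].
  by split; apply: filterS nT => t /tri_angular[_].
have eu := eqd _ _ _ _ da du nu; have ev := eqd _ _ _ _ db dv nv.
have ew := eqd _ _ _ _ dc dw nw.
have [_ hu hv hw] := tri_angular T; rewrite hu hv hw in E.
have dJ (f : R -> R) f' : is_derive s 1 f f' -> - (pi / 2) < f s < pi / 2 ->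
    is_derive s 1 (fun s => Jcos (f s)) (cos (f s) `^ lam * f').
  by move=> df fI; exact: (is_derc (is_derive_Jcos fI) df).
exists (cos (half_defect Hyperbolic (a s) (b s) (c s)) `^ lam * x'),
  (cos (half_defect Hyperbolic (b s) (c s) (a s)) `^ lam * y'),
  (cos (half_defect Hyperbolic (c s) (a s) (b s)) `^ lam * z').
have d2 := angular_rot d; have d3 := angular_rot d2.
split; [exact: dJ dx (angular_itv d)|exact: dJ dy (angular_itv d2)|
  exact: dJ dz (angular_itv d3)|].
have n1 (f : R) : 0 < f -> 1 - tanh_half f ^+ 2 != 0.
  move=> f0; rewrite gt_eqF// subr_gt0 expr_lt1// ?tanh_half_lt1//.
  exact/ltW/tanh_half_gt0.
have [/good_gt0/n1 na /good_gt0/n1 nb /good_gt0/n1 nc] := tri_gt0 T.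
exists m, H; split; [exact: m0|exact: H0| |].
  move=> /Hz[_ [zu zv zw]].
  have zz (f f' e : R) : 1 - f ^+ 2 != 0 -> e = (1 - f ^+ 2) / 2 * f' -> e = 0 -> f' = 0.
    move=> nf -> /eqP; rewrite !mulf_eq0 (negbTE nf)/= invr_eq0 pnatr_eq0/=.
    by move/eqP.
  by split; [exact: zz na eu zu|exact: zz nb ev zv|exact: zz nc ew zw].
rewrite -E -EA -EB -EC.
have kE (f f' e : R) : 1 - f ^+ 2 != 0 -> e = (1 - f ^+ 2) / 2 * f' ->
    f' * f `^ (- lam - 1) = f `^ (- lam - 1) * (2 / (1 - f ^+ 2)) * e.
  by move=> nf ->; move: (_ `^ _) => ww; field.
by rewrite (kE _ _ _ na eu) (kE _ _ _ nb ev) (kE _ _ _ nc ew).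
Qed.

End cosine_weight.
End hyperbolic_triangles.

(** * Paths and monotonicity for hyperbolic triangles *)

Section hyperbolic_monotonicity.
Variable R : realType.
Implicit Types (a b c x y z s : R).
Local Notation dfct := (half_defect Hyperbolic).

Lemma tanh_half_inj a b : 0 < a -> 0 < b -> tanh_half a = tanh_half b -> a = b.
Proof.
move=> a0 b0; have g x : 0 < x -> good Hyperbolic x by move=> x0; rewrite /good x0.
apply: (@good_inj R Hyperbolic _ _ a b (fun x _ => is_derive_tanh_half x) _ (g _ a0) (g _ b0)).
by move=> x /good_gt0 x0; rewrite divr_gt0// subr_gt0 expr_lt1 ?tanh_half_lt1// ltW// tanh_half_gt0.
Qed.

Lemma hpath_lt K (h k : R -> R) a0 a1 b0 b1 (a b : R -> R) :
  (forall x, good K x -> is_derive x 1 h (k x)) -> (forall x, good K x -> 0 < k x) ->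
  hpath K h k a0 a1 a -> hpath K h k b0 b1 b -> a0 < b0 -> a1 < b1 ->
  forall s, 0 <= s <= 1 -> a s < b s.
Proof.
move=> dh k0 [A0 A1 pa] [B0 B1 pb] e0 e1 s sI.
have I0 : 0 <= (0 : R) <= 1 by rewrite lexx ler01.
have I1 : 0 <= (1 : R) <= 1 by rewrite lexx ler01.
have [ga0 _ _] := pa _ I0; have [ga1 _ _] := pa _ I1.
have [gb0 _ _] := pb _ I0; have [gb1 _ _] := pb _ I1.
rewrite A0 in ga0; rewrite A1 in ga1; rewrite B0 in gb0; rewrite B1 in gb1.
have [ga ha _] := pa _ sI; have [gb hb _] := pb _ sI.
have h0 := good_increasing dh k0 ga0 gb0 e0; have h1 := good_increasing dh k0 ga1 gb1 e1.
have hab : h (a s) < h (b s).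
  rewrite ha hb -subr_gt0; case/andP: sI; rewrite le_eqVlt => /predU1P[<- _|s0 s1].
    by rewrite !mul0r !addr0 subr_gt0.
  rewrite (_ : _ - _ = (1 - s) * (h b0 - h a0) + s * (h b1 - h a1)); last by ring.
  by rewrite ltr_wpDl ?mulr_gt0 ?mulr_ge0 ?subr_ge0 ?subr_gt0// ltW.
rewrite ltNge le_eqVlt; apply/negP => /predU1P[E|/(good_increasing dh k0 gb ga)].
  by rewrite E ltxx in hab.
by move=> /(lt_trans hab); rewrite ltxx.
Qed.

Section large_exponent.
Variables (lam : R) (x0 y0 z0 x1 y1 z1 : R).
Hypotheses (lam0 : 0 <= lam) (d0 : angular x0 y0 z0) (d1 : angular x1 y1 z1).

(** The substitution y = pi / 2 - x turns cos^lambda into sin^lambda, so that the spherical path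
    lemmas apply to angles. *)
Let h y := - Jcos lam (pi / 2 - y).
Let k y := sn Spherical y `^ lam.
Let gP x y z : angular x y z -> good Spherical (pi / 2 - x).
Proof. by move=> /angular_itv/andP[? ?]; apply/andP; split; lra. Qed.

Let dh y : good Spherical y -> is_derive y 1 h (k y).
Proof.
move=> /andP[y00 ypi].
have yI : - (pi / 2) < pi / 2 - y < pi / 2 by apply/andP; split; lra.
have dl := is_derB (is_derive_cst (pi / 2 : R) y 1) (is_derive_id y 1).
have := is_derMl (-1) (is_derc (g := fun y => pi / 2 - y) (is_derive_Jcos lam yI) dl).
rewrite /k /= cosB cos_pihalf sin_pihalf mul0r add0r mul1r sub0r !mulN1r mulrN1 opprK.
by under eq_fun do rewrite mulN1r.
Qed.

Let k0 y : good Spherical y -> 0 < k y.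
Proof. by move=> /sn_gt0 ?; exact: powR_gt0. Qed.

Let ksym y : good Spherical y -> k (pi - y) = k y.
Proof. by move=> _; rewrite /k /= sinB sinpi cospi mul0r sub0r mulN1r opprK. Qed.

(** After the substitution, positivity of an angle compares one path with a reflected one
    ([hpath_lt]), and x + y + z < pi / 2 is a spherical triangle inequality with one side
    reflected. *)
Lemma angular_path : exists x y z : R -> R,
  [/\ [/\ x 0 = x0, y 0 = y0 & z 0 = z0], [/\ x 1 = x1, y 1 = y1 & z 1 = z1] &
    forall s, 0 <= s <= 1 -> angular (x s) (y s) (z s) /\
     exists x' y' z', [/\ is_derive s 1 x x' /\ cos (x s) `^ lam * x' = Jcos lam x1 - Jcos lam x0,
       is_derive s 1 y y' /\ cos (y s) `^ lam * y' = Jcos lam y1 - Jcos lam y0 &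
       is_derive s 1 z z' /\ cos (z s) `^ lam * z' = Jcos lam z1 - Jcos lam z0]].
Proof.
have aux0 (u v : R) : 0 < u + v -> pi / 2 - u < pi - (pi / 2 - v) by move=> *; lra.
have aux1 (u v : R) : u < pi - v -> 0 < (pi / 2 - u) + (pi / 2 - v) by move=> *; lra.
have aux2 (u v w : R) : u + v + w < pi / 2 -> pi - (pi / 2 - u) < pi / 2 - v + (pi / 2 - w).
  by move=> *; lra.
have aux3 (u v w : R) : pi - u < v + w -> pi / 2 - u + (pi / 2 - v) + (pi / 2 - w) < pi / 2.
  by move=> *; lra.
have [gx0 gx1] := (gP d0, gP d1).
have [gy0 gy1] := (gP (angular_rot d0), gP (angular_rot d1)).
have [gz0 gz1] := (gP (angular_rot (angular_rot d0)), gP (angular_rot (angular_rot d1))).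
have [x px] := inverse_path dh k0 gx0 gx1; have [y py] := inverse_path dh k0 gy0 gy1.
have [z pz] := inverse_path dh k0 gz0 gz1.
exists (fun s => pi / 2 - x s), (fun s => pi / 2 - y s), (fun s => pi / 2 - z s).
have [ex0 ex1 qx] := px; have [ey0 ey1 qy] := py; have [ez0 ez1 qz] := pz.
split; [by rewrite ex0 ey0 ez0 !subKr|by rewrite ex1 ey1 ez1 !subKr|move=> s sI; split].
  have [A0 B0 C0 S0] := d0; have [A1 B1 C1 S1] := d1.
  have rx := hpath_reflect dh k0 ksym gx0 gx1 px.
  have ry := hpath_reflect dh k0 ksym gy0 gy1 py.
  have rz := hpath_reflect dh k0 ksym gz0 gz1 pz.
  have i1 := hpath_lt dh k0 py rz _ _ sI; have i2 := hpath_lt dh k0 pz rx _ _ sI.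
  have i3 := hpath_lt dh k0 px ry _ _ sI.
  have i4 := spherical_ineq_path lam0 dh (good_reflect gx0) gy0 gz0 rx py pz _ _ sI.
  split.
  - by apply: aux1; apply: i1; exact: aux0.
  - by apply: aux1; apply: i2; exact: aux0.
  - by apply: aux1; apply: i3; exact: aux0.
  - by apply: aux3; apply: i4; exact: aux2.
have D (u : R -> R) u0 u1 : hpath Spherical h k (pi / 2 - u0) (pi / 2 - u1) u ->
    exists u', is_derive s 1 (fun s => pi / 2 - u s) u' /\
      cos (pi / 2 - u s) `^ lam * u' = Jcos lam u1 - Jcos lam u0.
  move=> [_ _ /(_ s sI)[gu _ du]].
  have dd := is_derB (is_derive_cst (pi / 2 : R) s 1) du.
  eexists; split; first exact: dd.
  have ku := k0 gu; rewrite cosB cos_pihalf sin_pihalf mul0r add0r mul1r -/(k (u s)).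
  rewrite sub0r /h !subKr; move: (Jcos _ _) (Jcos _ _) => v w.
  by move: (k _) ku => kk kk0; field; rewrite gt_eqF.
have [x' hx] := D _ _ _ px; have [y' hy] := D _ _ _ py; have [z' hz] := D _ _ _ pz.
by exists x', y', z'.
Qed.

Lemma angular_monotone : let g x y z := Jtanh lam (half_side x y z) in
  let D := (g x1 y1 z1 - g x0 y0 z0) * (Jcos lam x1 - Jcos lam x0)
         + (g y1 z1 x1 - g y0 z0 x0) * (Jcos lam y1 - Jcos lam y0)
         + (g z1 x1 y1 - g z0 x0 y0) * (Jcos lam z1 - Jcos lam z0) in
  D <= 0 /\ (D = 0 -> [/\ x0 = x1, y0 = y1 & z0 = z1]).
Proof.
move=> g D; have [x [y [z [[X0 Y0 Z0] [X1 Y1 Z1] p]]]] := angular_path.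
pose A := Jcos lam x1 - Jcos lam x0; pose B := Jcos lam y1 - Jcos lam y0.
pose C := Jcos lam z1 - Jcos lam z0.
have DE : D = (g x1 y1 z1 - g x0 y0 z0) * A + (g y1 z1 x1 - g y0 z0 x0) * B
  + (g z1 x1 y1 - g z0 x0 y0) * C by [].
pose f s := A * g (x s) (y s) (z s) + B * g (y s) (z s) (x s) + C * g (z s) (x s) (y s).
have df s : 0 <= s <= 1 -> exists2 f', is_derive s 1 f f' &
    f' <= 0 /\ (f' = 0 -> [/\ A = 0, B = 0 & C = 0]).
  move=> sI; have [d [x' [y' [z' [[dx Ax] [dy Ay] [dz Az]]]]]] := p s sI.
  rewrite -/A in Ax; rewrite -/B in Ay; rewrite -/C in Az.
  have [u [v [w [du dv dw [m [H [m0 H0 Hz E]]]]]]] := cosine_weighted_form lam d dx dy dz.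
  have dJ (T : R -> R) T' : is_derive s 1 T T' -> 0 < T s < 1 ->
      is_derive s 1 (fun s => Jtanh lam (T s)) (tanh_weight lam (T s) * T').
    by move=> dT TI; exact: (is_derc (is_derive_Jtanh lam TI) dT).
  have d2 := angular_rot d; have d3 := angular_rot d2.
  have [_ Ix _] := half_side_scale d; have [_ Iy _] := half_side_scale d2.
  have [_ Iz _] := half_side_scale d3.
  have dd := is_derD (is_derD (is_derMl A (dJ _ _ du Ix)) (is_derMl B (dJ _ _ dv Iy)))
    (is_derMl C (dJ _ _ dw Iz)).
  eexists; first exact: dd.
  have -> : A * (tanh_weight lam (half_side (x s) (y s) (z s)) * u) +
    B * (tanh_weight lam (half_side (y s) (z s) (x s)) * v) +
    C * (tanh_weight lam (half_side (z s) (x s) (y s)) * w) = - (m * H).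
    rewrite -E Ax Ay Az; move: (half_side _ _ _) (half_side _ _ _) (half_side _ _ _).
    by move=> t1 t2 t3; rewrite /tanh_weight; congr (_ + _ + _); rewrite mulrC.
  split; first by rewrite oppr_le0 mulr_ge0// ltW.
  move/eqP; rewrite oppr_eq0 mulf_eq0 (gt_eqF m0)/= => /eqP /Hz[[e1 e2 e3] _].
  by rewrite -Ax -Ay -Az e1 e2 e3 !mulr0.
have df' s : 0 <= s <= 1 -> is_derive s 1 f ('D_1 f s).
  by move=> /df[m [dm _] _]; exact: DeriveDef.
have [s /andP[s0 s1]] := MVT_closed ltr01 df'.
have sI : 0 <= s <= 1 by rewrite !ltW.
have [f' [_ ->] [f0 fz]] := df s sI; rewrite subr0 mulr1.
have -> : f 1 - f 0 = D.
  rewrite /f DE X0 Y0 Z0 X1 Y1 Z1; clearbody A B C; clear.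
  by move: (g x1 _ _) (g y1 _ _) (g z1 _ _) (g x0 _ _) (g y0 _ _) (g z0 _ _) => *; ring.
move=> ->; split; first exact: f0.
have inj u0 u1 : good Spherical (pi / 2 - u0) -> good Spherical (pi / 2 - u1) ->
    Jcos lam u1 - Jcos lam u0 = 0 -> u0 = u1.
  move=> g0 g1 /eqP; rewrite subr_eq0 => /eqP E.
  have : pi / 2 - u0 = pi / 2 - u1.
    by apply: (good_inj dh k0 g0 g1); rewrite /h !subKr E.
  by move=> /addrI/oppr_inj.
have [gx0 gx1] := (gP d0, gP d1).
have [gy0 gy1] := (gP (angular_rot d0), gP (angular_rot d1)).
have [gz0 gz1] := (gP (angular_rot (angular_rot d0)), gP (angular_rot (angular_rot d1))).
by move=> /fz[eA eB eC]; split; [exact: inj eA|exact: inj eB|exact: inj eC].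
Qed.

End large_exponent.

Lemma hyperbolic_tri_path (h : R -> R) (mu : R) a0 b0 c0 a1 b1 c1 (a b c : R -> R) :
  let k x := tanh_half x `^ mu in
  0 <= mu -> (forall x, good Hyperbolic x -> is_derive x 1 h (k x)) ->
  tri Hyperbolic a0 b0 c0 -> tri Hyperbolic a1 b1 c1 ->
  hpath Hyperbolic h k a0 a1 a -> hpath Hyperbolic h k b0 b1 b ->
  hpath Hyperbolic h k c0 c1 c ->
  forall s, 0 <= s <= 1 -> tri Hyperbolic (a s) (b s) (c s).
Proof.
move=> k mu0 dh T0 T1 pa pb pc.
have k0 x : good Hyperbolic x -> 0 < k x.
  by move=> /good_gt0/tanh_half_gt0 ?; exact: powR_gt0.
have [ga0 gb0 gc0] := tri_gt0 T0; have [ga1 gb1 gc1] := tri_gt0 T1.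
have [i1 i2 i3 _] := tri_ineqV T0.
have [j1 j2 j3 _] := tri_ineqV T1.
(* The logarithmic derivative of tanh (x / 2) is 1 / sinh x. *)
have dk x : good Hyperbolic x -> is_derive x 1 k (k x * (mu * (sinh x)^-1)).
  move=> gx; have x0 := good_gt0 gx; have t0 := tanh_half_gt0 x0.
  have := is_derc (f := fun y => y `^ mu) (is_derive1_powR mu t0) (is_derive_tanh_half x).
  move=> dd; apply: is_derive_eq dd _; rewrite /k.
  rewrite powRB ?(gt_eqF t0) ?implybT// powRr1 ?ltW//.
  have s0 := sn_gt0 (good_half gx); have c0' := cn_half_gt0 gx.
  have := cn2sn2 Hyperbolic (x / 2); have := snD Hyperbolic (x / 2) (x / 2).
  rewrite -mulrDl -mulr2n -[_ *+ 2]mulr_natr mulfK ?pnatr_eq0//= => -> e.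
  rewrite /tanh_half in t0 *; move: (_ `^ mu) => w; rewrite /= in s0 c0'.
  move: (sinh _) (cosh _) s0 c0' e => p q p0 q0 e.
  rewrite (_ : 1 - (p / q) ^+ 2 = (q ^+ 2)^-1).
    by field; rewrite !gt_eqF//= addr_gt0 ?mulr_gt0.
  have p2 : p ^+ 2 = q ^+ 2 - 1 by rewrite -e; ring.
  by rewrite expr_div_n p2; field; rewrite gt_eqF.
have ec : (forall x, good Hyperbolic x -> mu * (sinh x)^-1 = 0) \/
  forall x y z p q r, good Hyperbolic x -> good Hyperbolic y -> good Hyperbolic z ->
    x + y + 0 <= 1 * z -> 1 * r = p + q -> p != 0 \/ q != 0 ->
    1 * (mu * (sinh z)^-1 * r ^+ 2) <
    mu * (sinh x)^-1 * p ^+ 2 + mu * (sinh y)^-1 * q ^+ 2.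
  have [->|mun0] := eqVneq mu 0; first by left => x _; rewrite mul0r.
  right=> x y z p q r gx gy gz; rewrite addr0 !mul1r => h1 h2 h3.
  have mup : 0 < mu by rewrite lt_neqAle eq_sym mun0.
  have [x0 y0] := (good_gt0 gx, good_gt0 gy).
  have [sx sy] := (sn_gt0 gx, sn_gt0 gy).
  have gt1 (u : R) : 0 < u -> 1 < cosh u.
    move=> u0; have e := cn2sn2 Hyperbolic u; have su := sinh_gt0 u0.
    have cu := cosh_gt0 u; rewrite ltNge; apply/negP => cu1.
    have : cosh u ^+ 2 <= 1 by rewrite expr_le1// ltW.
    have : 0 < sinh u ^+ 2 by rewrite exprn_gt0.
    by rewrite /= in e; lra.
  (* sinh is strictly superadditive, so the Euclidean convexity lemma applies to the numbers sinh x,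
     sinh y, sinh z with this gap as d. *)
  have sxy : 0 < sinh z - sinh x - sinh y.
    have : sinh (x + y) <= sinh z.
      rewrite /sinh ler_pM2r ?invr_gt0// lerB// ler_expR//; lra.
    have := snD Hyperbolic x y; rewrite /= => ->.
    have := gt1 _ x0; have := gt1 _ y0.
    rewrite /= in sx sy; move: (sinh x) (sinh y) (cosh x) (cosh y) sx sy; clear.
    by move=> p q p' q' p0 q0 h1 h2; nra.
  have := @euclidean_eta_convex R (sinh x) (sinh y) (sinh z) p q r 1 (sinh z - sinh x - sinh y)
    sx sy (sn_gt0 gz) ltr01 sxy.
  rewrite /ct /= !mul1r => /(_ ltac:(lra) h2 h3) hh.
  by rewrite -!(mulrA mu) -mulrDr ltr_pM2l.
have key x0 y0 z0 x1 y1 z1 (x y z : R -> R) : good Hyperbolic x0 -> good Hyperbolic y0 ->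
    good Hyperbolic z0 -> hpath Hyperbolic h k x0 x1 x -> hpath Hyperbolic h k y0 y1 y ->
    hpath Hyperbolic h k z0 z1 z -> x0 < y0 + z0 -> x1 < y1 + z1 ->
    forall s, 0 <= s <= 1 -> x s < y s + z s.
  move=> gx gy gz px py pz e0 e1 s sI.
  have := triangle_inequality_path dh k0 dk ltr01 ec gx gy gz px py pz _ _ sI.
  by rewrite !mul1r !addr0; apply.
move=> s sI; apply: tri_ineq => //.
- exact: (key _ _ _ _ _ _ _ _ _ ga0 gb0 gc0 pa pb pc).
- exact: (key _ _ _ _ _ _ _ _ _ gb0 gc0 ga0 pb pc pa).
- exact: (key _ _ _ _ _ _ _ _ _ gc0 ga0 gb0 pc pa pb).
Qed.

Lemma hyperbolic_monotone (lam : R) a0 b0 c0 a1 b1 c1 :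
  lam <= -1 \/ 0 <= lam -> tri Hyperbolic a0 b0 c0 -> tri Hyperbolic a1 b1 c1 ->
  let J := Jcos lam in let h x := Jtanh lam (tanh_half x) in
  let D := (h a1 - h a0) * (J (dfct a1 b1 c1) - J (dfct a0 b0 c0))
         + (h b1 - h b0) * (J (dfct b1 c1 a1) - J (dfct b0 c0 a0))
         + (h c1 - h c0) * (J (dfct c1 a1 b1) - J (dfct c0 a0 b0)) in
  D <= 0 /\ (D = 0 -> [/\ a0 = a1, b0 = b1 & c0 = c1]).
Proof.
move=> [lam1|lam0] T0 T1 J h D; last first.
  have [d0 A0 B0 C0] := tri_angular T0; have [d1 A1 B1 C1] := tri_angular T1.
  have [D0 Dz] := angular_monotone lam0 d0 d1.
  rewrite A0 B0 C0 A1 B1 C1 in D0 Dz; split; first exact: D0.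
  move=> /Dz[e1 e2 e3]; rewrite e1 e2 e3 in A0 B0 C0.
  have [/good_gt0 a00 /good_gt0 b00 /good_gt0 c00] := tri_gt0 T0.
  have [/good_gt0 a10 /good_gt0 b10 /good_gt0 c10] := tri_gt0 T1.
  by split; apply: tanh_half_inj => //; rewrite -?A0 -?B0 -?C0.
pose k x := tanh_half x `^ (- lam - 1).
have k0 x : good Hyperbolic x -> 0 < k x.
  by move=> /good_gt0/tanh_half_gt0 ?; exact: powR_gt0.
have dh x : good Hyperbolic x -> is_derive x 1 h (k x).
  by move=> /good_gt0 x0; exact: (is_derive_Jtanh_half lam x0).
have mu0 : 0 <= - lam - 1 by lra.
have [ga0 gb0 gc0] := tri_gt0 T0; have [ga1 gb1 gc1] := tri_gt0 T1.
have [a pa] := inverse_path dh k0 ga0 ga1; have [b pb] := inverse_path dh k0 gb0 gb1.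
have [c pc] := inverse_path dh k0 gc0 gc1.
have Ts s : 0 <= s <= 1 -> tri Hyperbolic (a s) (b s) (c s).
  exact: (hyperbolic_tri_path mu0 dh T0 T1 pa pb pc).
pose f s := (h a1 - h a0) * J (dfct (a s) (b s) (c s))
  + (h b1 - h b0) * J (dfct (b s) (c s) (a s))
  + (h c1 - h c0) * J (dfct (c s) (a s) (b s)).
have df s : 0 <= s <= 1 -> exists2 f', is_derive s 1 f f' &
    f' <= 0 /\ (f' = 0 -> [/\ h a1 - h a0 = 0, h b1 - h b0 = 0 & h c1 - h c0 = 0]).
  move=> sI; have [_ _ /(_ s sI)[ga _ da]] := pa; have [_ _ /(_ s sI)[gb _ db]] := pb.
  have [_ _ /(_ s sI)[gc _ dc]] := pc.
  have kn x e : good Hyperbolic x -> e / k x * tanh_half x `^ (- lam - 1) = e.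
    by move=> /k0/gt_eqF kn; rewrite divfK// kn.
  have [u [v [w [du dv dw [m [H [m0 H0 Hz E]]]]]]] := hyperbolic_weighted_form (kn _ _ ga)
    (kn _ _ gb) (kn _ _ gc) (Ts _ sI) da db dc.
  have dd := is_derD (is_derD (is_derMl (h a1 - h a0) du) (is_derMl (h b1 - h b0) dv))
    (is_derMl (h c1 - h c0) dw).
  eexists; first exact: dd.
  rewrite E; split; first by rewrite oppr_le0 mulr_ge0// ltW.
  move/eqP; rewrite oppr_eq0 mulf_eq0 (gt_eqF m0)/= => /eqP /Hz.
  have z0 (e x : R) : good Hyperbolic x -> e / k x = 0 -> e = 0.
    by move=> /k0 kx /eqP; rewrite mulf_eq0 invr_eq0 (gt_eqF kx) orbF => /eqP.
  by move=> [e1 e2 e3]; split; [exact: z0 ga e1|exact: z0 gb e2|exact: z0 gc e3].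
have df' s : 0 <= s <= 1 -> is_derive s 1 f ('D_1 f s).
  by move=> /df[m [dm _] _]; exact: DeriveDef.
have [s /andP[s0 s1]] := MVT_closed ltr01 df'.
have sI : 0 <= s <= 1 by rewrite !ltW.
have [f' [_ ->] [f0 fz]] := df s sI; rewrite subr0 mulr1.
have -> : f 1 - f 0 = D.
  have [a_0 a_1 _] := pa; have [b_0 b_1 _] := pb; have [c_0 c_1 _] := pc.
  rewrite /f /D a_0 a_1 b_0 b_1 c_0 c_1; clearbody J h; clear.
  move: (J (dfct a1 b1 c1)) (J (dfct b1 c1 a1)) (J (dfct c1 a1 b1)).
  by move: (J (dfct a0 b0 c0)) (J (dfct b0 c0 a0)) (J (dfct c0 a0 b0)) => *; ring.
move=> ->; split; first exact: f0.
have inj x y : good Hyperbolic x -> good Hyperbolic y -> h y - h x = 0 -> x = y.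
  move=> gx gy /eqP; rewrite subr_eq0 => /eqP E.
  exact: (good_inj dh k0 gx gy (esym E)).
by move=> /fz[eA eB eC]; split; [exact: inj eA|exact: inj eB|exact: inj eC].
Qed.

End hyperbolic_monotonicity.

(** * Triangulated surfaces *)

Section surfaces.
Variable S : closed_surface.
Implicit Types (c s : corner S) (f g : face S).

Lemma next_next_corner c : next_corner (next_corner c) = prev_corner c.
Proof.
case: c => f i; rewrite /next_corner /prev_corner /=; congr (_, _); apply: val_inj.
by case: i => [[|[|[|[]]]]].
Qed.

Lemma prev_cornerK c : next_corner (prev_corner c) = c.
Proof. by case: c => f i; rewrite /next_corner /prev_corner /= ord_predK. Qed.

Lemma next_cornerK c : prev_corner (next_corner c) = c.
Proof. by case: c => f i; rewrite /next_corner /prev_corner /= ordSK. Qed.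

Lemma prev_prev_corner c : prev_corner (prev_corner c) = next_corner c.
Proof. by rewrite -next_next_corner prev_cornerK. Qed.

Lemma corner_sum (V : nmodType) (F : corner S -> V) :
  (\sum_c F c = \sum_f (F (f, ord0) + F (next_corner (f, ord0)) + F (prev_corner (f, ord0))))%R.
Proof.
rewrite (eq_bigr (fun p => F (p.1, p.2))) => [|[] //].
rewrite -(pair_bigA _ (fun f i => F (f, i))) /=; apply: eq_bigr => f _.
rewrite !big_ord_recl big_ord0 addr0 addrA /next_corner /prev_corner /=.
by congr (_ + F (_, _) + F (_, _))%R; exact: val_inj.
Qed.

Lemma face_corner (P : corner S -> Prop) f :
  P (f, ord0) -> P (next_corner (f, ord0)) -> P (prev_corner (f, ord0)) ->
  forall c, c.1 = f -> P c.
Proof.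
move=> h0 h1 h2 [g i] /= ->.
have [->|[->|->]] : i = ord0 \/ i = ordS ord0 \/ i = ord_pred (ord0 : 'I_3).
  case: i => [[|[|[|//]]]] ilt; [left|right; left|right; right]; exact: val_inj.
- exact: h0.
- exact: h1.
- exact: h2.
Qed.

Lemma face_connected_ind (P : face S -> Prop) f0 :
  P f0 -> (forall s, P s.1 -> P (gluing s).1) -> forall f, P f.
Proof.
move=> P0 Pg f; have /connectP[p + ->] := face_connected f0 f.
elim: p f0 P0 => [|g p IH] f0 P0 //= /andP[/existsP[i /eqP e] hp].
by apply: IH hp; rewrite -e; exact: (Pg (f0, i)).
Qed.

Lemma edge_of_gluing s : edge_of (gluing s) = edge_of s.
Proof.
by apply: val_inj; rewrite /= /edge_class gluingK; apply/setP => c; rewrite !inE orbC.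
Qed.

Lemma in_edge (e : edge S) c : (c \in val e) = (edge_of c == e).
Proof.
apply/idP/eqP => [|<-]; last by rewrite /= /edge_class !inE eqxx.
case: e => e he /=; have /codomP[s E] := he => ce.
apply: val_inj; rewrite /= E; move: ce; rewrite E !inE => /orP[/eqP ->//|/eqP ->].
exact: (congr1 val (edge_of_gluing s)).
Qed.

Lemma edge_ofP (e : edge S) : exists s, e = edge_of s.
Proof. by case: e => e he; have /codomP[s E] := he; exists s; exact: val_inj. Qed.

Lemma edge_rank_ind (P : 'I_#|edge S| -> Prop) :
  (forall s, P (enum_rank (edge_of s))) -> forall i, P i.
Proof. by move=> h i; rewrite -(enum_valK i); have [s ->] := edge_ofP (enum_val i). Qed.

Lemma glued_corners_sym : symmetric (@glued_corners S).
Proof.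
suff h c d : glued_corners c d -> glued_corners d c by move=> c d; apply/idP/idP; exact: h.
move=> /existsP[s h]; apply/existsP; exists (gluing s); move: h.
rewrite /= gluingK aligned_gluing; case: (aligned s).
  by case/orP => /andP[/eqP -> /eqP ->]; rewrite !eqxx ?orbT.
by case/orP => /andP[/eqP -> /eqP ->]; rewrite !eqxx ?orbT.
Qed.

Lemma vertex_of_connect c d : connect (@glued_corners S) c d -> vertex_of c = vertex_of d.
Proof.
move=> h; apply: val_inj; apply/setP => x; rewrite !inE.
exact: (same_connect (sym_connect_sym glued_corners_sym) h).
Qed.

Lemma vertex_of_gluing s :
  let n := vertex_of (next_corner (gluing s)) in let p := vertex_of (prev_corner (gluing s)) in
  vertex_of (next_corner s) = (if aligned s then n else p) /\
  vertex_of (prev_corner s) = (if aligned s then p else n).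
Proof.
split; rewrite -[RHS](fun_if (@vertex_of S)); apply/vertex_of_connect/connect1/existsP; exists s => /=.
  by rewrite !eqxx.
by rewrite !eqxx orbT.
Qed.

Lemma in_vertex (v : vertex S) c : (c \in val v) = (vertex_of c == v).
Proof.
apply/idP/eqP => [|<-]; last by rewrite /= inE connect0.
case: v => v hv /=; have /codomP[d E] := hv => cv.
have h : connect (@glued_corners S) d c by move: cv; rewrite E inE.
by apply: val_inj; rewrite /= E; apply/esym/(congr1 val (vertex_of_connect h)).
Qed.

Lemma vertex_ofP (v : vertex S) : exists c, v = vertex_of c.
Proof. by case: v => v hv; have /codomP[c E] := hv; exists c; exact: val_inj. Qed.

Lemma vertex_rank_ind (P : 'I_#|vertex S| -> Prop) :
  (forall c, P (enum_rank (vertex_of c))) -> forall i, P i.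
Proof. by move=> h i; rewrite -(enum_valK i); have [c ->] := vertex_ofP (enum_val i). Qed.

Variable R : realType.
Implicit Types (l : 'rV[R]_#|edge S|) (r : 'rV[R]_#|vertex S|).
Local Open Scope ring_scope.

Lemma edge_sum (t : 'I_#|edge S| -> R) (u : corner S -> R) :
  \sum_i t i * \sum_(c in val (enum_val i)) u c =
  \sum_c t (enum_rank (edge_of c)) * u c.
Proof.
rewrite (partition_big (fun c => enum_rank (edge_of c)) predT)//=.
apply: eq_bigr => i _; rewrite mulr_sumr; apply: eq_big => [c|c ci].
  by rewrite in_edge -(can_eq enum_rankK) enum_valK.
by move: ci; rewrite in_edge => /eqP ->; rewrite enum_valK.
Qed.

Definition vertex_radius r c := r 0 (enum_rank (vertex_of c)).

(** [iinv] selects one of the two sides of the edge; the gluing matches their end points up to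
    order, and the sum of radii is symmetric. *)
Lemma side_packing r s :
  side_length (packing_metric r) s = vertex_radius r (next_corner s) + vertex_radius r (prev_corner s).
Proof.
rewrite /side_length mxE.
set t := iinv _; have : edge_of t = edge_of s.
  by apply: val_inj; rewrite /= f_iinv enum_rankK.
move=> /eqP; rewrite eq_sym -in_edge /= !inE => /orP[/eqP <-//|/eqP E].
have [-> ->] := vertex_of_gluing t; rewrite -E.
by rewrite /vertex_radius; case: (aligned t); rewrite // addrC.
Qed.

End surfaces.

(** * Circle packings *)

Section packings.
Variable R : realType.
Implicit Types (K : geometry) (p q w : R).
Local Notation kappa := (curvature R).

(** In a packing the sides are sums of two radii, so the radii themselves are the deficits of the
    triangle and no triangle inequality constrains them. *)
Definition packing_angle K p q w : R := ang K (p + q + w) p q w.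

Lemma good_unbounded K x : K <> Spherical -> good K x = (0 < x :> R).
Proof. by case: K => // _; rewrite /good andbT. Qed.

Lemma tri_packing K p q w : K <> Spherical -> 0 < p -> 0 < q -> 0 < w ->
  tri K (q + w) (w + p) (p + q) /\
  tri_angle K (q + w) (w + p) (p + q) = packing_angle K p q w.
Proof.
move=> KS p0 q0 w0; rewrite /tri /tri_angle /packing_angle.
have [-> -> -> ->] : [/\ (w + p + (p + q) - (q + w)) / 2 = p,
  (p + q + (q + w) - (w + p)) / 2 = q, (q + w + (w + p) - (p + q)) / 2 = w &
  (q + w + (w + p) + (p + q)) / 2 = p + q + w] by split; field.
by split=> //; split=> //; rewrite good_unbounded// !addr_gt0.
Qed.

Section tangent_weight.
Variable lam : R.

Definition Jtan (t : R) := oriented_integral (pi / 2) t (fun t => tan (t / 2) `^ lam).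

Lemma tan_half_gt0 t : 0 < t < pi -> 0 < tan (t / 2) :> R.
Proof.
move=> /andP[t0 tpi]; rewrite /tan divr_gt0 ?sin_gt0_pi ?cos_gt0_pihalf//;
  by apply/andP; split; lra.
Qed.

Lemma is_derive_Jtan t : 0 < t < pi -> is_derive t 1 Jtan (tan (t / 2) `^ lam).
Proof.
move=> tI; apply: (@is_derive_oriented_integral _ (fun t => tan (t / 2) `^ lam) 0 pi) => //.
  exact: pi_half_itv.
move=> u uI; have t0 := tan_half_gt0 uI.
have c0 : cos (u / 2) != 0.
  by case/andP: uI => u0 upi; rewrite gt_eqF// cos_gt0_pihalf//; apply/andP; split; lra.
have dh : is_derive u 1 (fun u : R => u / 2) (2^-1).
  have := is_derM (is_derive_id u 1) (is_derive_cst (2^-1 : R) u 1).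
  by rewrite mulr0 addr0 mul1r.
exact: is_derive_continuous (is_derc (g := fun u : R => tan (u / 2)) (is_derive1_powR lam t0)
  (is_derc (g := fun u : R => u / 2) (is_derive_tan c0) dh)).
Qed.

(** The weight is positive for every exponent, which lets the maximum principle work for all
    lambda. *)
Lemma Jtan_increasing s t : 0 < s < pi -> 0 < t < pi -> s < t -> Jtan s < Jtan t.
Proof.
move=> /andP[s0 _] /andP[_ tpi] st.
have I u : s <= u <= t -> 0 < u < pi.
  by move=> /andP[su ut]; rewrite (lt_le_trans s0 su) (le_lt_trans ut tpi).
have [z /andP[sz zt] E] : exists2 c, s < c < t & Jtan t - Jtan s = tan (c / 2) `^ lam * (t - s).
  by apply: MVT_closed => // u /I; exact: is_derive_Jtan.
rewrite -subr_gt0 E mulr_gt0 ?subr_gt0//; apply/powR_gt0/tan_half_gt0/I.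
by rewrite !ltW.
Qed.

End tangent_weight.

(** The squared cotangent of half the angle at the centre of the circle of radius p, arranged so as
    to be monotone in sn p * ct q, sn p * ct w and cn p. *)
Definition cot2_half K p q w : R :=
  sn K p * ct K q * (sn K p * ct K w) - kappa K * sn K p ^+ 2 +
  cn K p * (sn K p * ct K q + sn K p * ct K w).

Lemma tau_packing K p q w : K <> Spherical -> 0 < p -> 0 < q -> 0 < w ->
  tau K (p + q + w) p q w = Num.sqrt (cot2_half K p q w)^-1 /\ 0 < cot2_half K p q w.
Proof.
move=> KS p0 q0 w0; have g (x : R) : 0 < x -> good K x by rewrite good_unbounded.
have [sp [sq sw]] := (sn_gt0 (g _ p0), (sn_gt0 (g _ q0), sn_gt0 (g _ w0))).
have sW : 0 < sn K (p + q + w) by apply/sn_gt0/g; rewrite !addr_gt0.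
have E : cot2_half K p q w = sn K p * sn K (p + q + w) / (sn K q * sn K w).
  rewrite /cot2_half /ct -addrA snD snD cnD.
  by move: (kappa K) => kk; field; rewrite !gt_eqF.
by rewrite E; split; [rewrite /tau invf_div|rewrite divr_gt0 ?mulr_gt0].
Qed.

Lemma cn_gt0 K x : K <> Spherical -> 0 < cn K x :> R.
Proof. by case: K => // _; exact: cosh_gt0. Qed.

(* Squaring, sn p * ct q is increasing in sn p / sn q and, when the curvature
   is negative, in sn p. *)
Lemma packing_angle_le K p q w p' q' w' m : K <> Spherical ->
  0 < p -> 0 < q -> 0 < w -> 0 < p' -> 0 < q' -> 0 < w' -> 0 < m ->
  (K = Hyperbolic -> 1 < m) -> sn K p' = m * sn K p ->
  sn K q' <= m * sn K q -> sn K w' <= m * sn K w ->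
  packing_angle K p' q' w' <= packing_angle K p q w /\
  (packing_angle K p' q' w' = packing_angle K p q w ->
   [/\ K = Euclidean, sn K q' = m * sn K q & sn K w' = m * sn K w]).
Proof.
move=> KS p0 q0 w0 p0' q0' w0' m0 m1 Ep hq hw.
have g (x : R) : 0 < x -> 0 < sn K x by move=> x0; apply: sn_gt0; rewrite good_unbounded.
have [tE z0] := tau_packing KS p0 q0 w0; have [tE' z0'] := tau_packing KS p0' q0' w0'.
have cnE x : cn K x ^+ 2 = 1 - kappa K * sn K x ^+ 2 by rewrite -(cn2sn2 K x) addrK.
have s2 : - kappa K * sn K p ^+ 2 <= - kappa K * sn K p' ^+ 2 /\
    (K = Hyperbolic -> - kappa K * sn K p ^+ 2 < - kappa K * sn K p' ^+ 2).
  case: K KS m1 Ep g {hq hw tE z0 tE' z0' cnE} => // _ m1 Ep g.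
    by rewrite /= oppr0 !mul0r.
  have lt : - kappa Hyperbolic * sn Hyperbolic p ^+ 2 < - kappa Hyperbolic * sn Hyperbolic p' ^+ 2.
    have kE u : - kappa Hyperbolic * u = u by rewrite /= opprK mul1r.
    rewrite 2!kE; apply: ltrXn2r => //; first exact/ltW/g.
    have sp := g _ p0; rewrite Ep; move: (sn Hyperbolic p) sp => u u0.
    by rewrite -[ltLHS]mul1r ltr_pM2r// m1.
  by split=> //; exact: ltW.
have c2 : cn K p <= cn K p'.
  rewrite -(ler_sqr (ltW (cn_gt0 p KS)) (ltW (cn_gt0 p' KS))) !cnE -!mulNr.
  by rewrite lerD2l s2.1.
have X (x x' : R) : 0 < x -> 0 < x' -> sn K x' <= m * sn K x ->
   [/\ 0 < sn K p * ct K x, sn K p * ct K x <= sn K p' * ct K x' &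
       K = Euclidean -> sn K p * ct K x = sn K p' * ct K x' -> sn K x' = m * sn K x].
  move=> x0 x0' hx; have [sx sx'] := (g _ x0, g _ x0').
  have P0 (y z : R) : 0 < y -> 0 < z -> 0 < sn K y * ct K z.
    by move=> y0 z00; rewrite mulr_gt0 ?divr_gt0 ?cn_gt0 ?g.
  have sq (y z : R) : 0 < z -> (sn K y * ct K z) ^+ 2 = (sn K y / sn K z) ^+ 2 - kappa K * sn K y ^+ 2.
    move=> /g z00; rewrite /ct !exprMn exprVn cnE; move: (kappa K) => kk.
    by field; rewrite gt_eqF.
  have rt : sn K p / sn K x <= sn K p' / sn K x'.
    by rewrite Ep ler_pdivlMr// mulrAC ler_pdivrMr// (mulrC m) -mulrA ler_pM2l// g.
  split; first exact: P0.
    rewrite -(ler_sqr (ltW (P0 _ _ p0 x0)) (ltW (P0 _ _ p0' x0'))) !sq// -!mulNr.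
    by rewrite lerD ?s2.1// ler_sqr// ?nnegrE ?divr_ge0 ?ltW ?g.
  move=> KE; have [-> ->] : ct K x = (sn K x)^-1 /\ ct K x' = (sn K x')^-1.
    by rewrite KE /ct /= !div1r.
  rewrite Ep => e; have sp := g _ p0.
  move: e; move: (sn K p) (sn K x) (sn K x') sp sx sx'; clear => a b c a0 b0 c0 e.
  have := congr1 (fun t => t * b * c / a) e.
  have -> : a / b * b * c / a = c by field; rewrite !gt_eqF.
  by move=> ->; field; rewrite !gt_eqF.
have [xq xq' xqE] := X _ _ q0 q0' hq; have [xw xw' xwE] := X _ _ w0 w0' hw.
have cp := cn_gt0 p KS.
have zz : cot2_half K p q w <= cot2_half K p' q' w' /\
   (cot2_half K p q w = cot2_half K p' q' w' -> [/\ K = Euclidean, sn K p * ct K q = sn K p' * ct K q' &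
     sn K p * ct K w = sn K p' * ct K w']).
  have [s2' s2s] := s2; rewrite /cot2_half -!mulNr.
  have KH : K <> Hyperbolic -> K = Euclidean by case: (K) KS.
  move: s2' s2s KH cp c2 xq xq' xw xw'; clear.
  move: (- kappa K * sn K p ^+ 2) (- kappa K * sn K p' ^+ 2) (cn K p) (cn K p') => s s' c c'.
  move: (sn K p * ct K q) (sn K p' * ct K q') (sn K p * ct K w) (sn K p' * ct K w').
  move=> x x' y y' s1 s2 KH c0 c1 x0 x1 y0 y1.
  have h1 : x * y <= x' * y' by rewrite ler_pM// ltW.
  have h2 : c * (x' + y') <= c' * (x' + y').
    by rewrite ler_wpM2r// addr_ge0//; [exact: le_trans (ltW x0) x1|exact: le_trans (ltW y0) y1].
  have h3 : c * x <= c * x' by rewrite ler_pM2l.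
  have h4 : c * y <= c * y' by rewrite ler_pM2l.
  rewrite mulrDr in h2; split; first by rewrite !mulrDr; clear - h1 h2 h3 h4 s1; lra.
  rewrite !mulrDr => e; split.
  - by apply: KH => /s2 h5; clear - h1 h2 h3 h4 h5 e; lra.
  - by apply: (mulfI (lt0r_neq0 c0)); clear - h1 h2 h3 h4 s1 e; lra.
  - by apply: (mulfI (lt0r_neq0 c0)); clear - h1 h2 h3 h4 s1 e; lra.
have [z1 ze] := zz.
have aE : packing_angle K p q w = 2 * atan (Num.sqrt (cot2_half K p q w)^-1).
  by rewrite /packing_angle /ang tE.
have aE' : packing_angle K p' q' w' = 2 * atan (Num.sqrt (cot2_half K p' q' w')^-1).
  by rewrite /packing_angle /ang tE'.
split.
  rewrite aE aE' ler_pM2l//; apply: le_atan; apply: ler_wsqrtr.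
  by rewrite lef_pV2 ?posrE.
rewrite aE aE' => /(mulfI _) => /(_ ltac:(by rewrite pnatr_eq0)) /(congr1 tan).
rewrite !atanK => /(congr1 (fun x => x ^+ 2)); rewrite !sqr_sqrtr ?invr_ge0 ?(ltW z0) ?(ltW z0')//.
move=> /invr_inj/esym/ze[KE e1 e2]; split; [exact: KE|exact: xqE|exact: xwE].
Qed.

(** ct p * p' is the variation of log (sn p), so this is the infinitesimal form of
    [packing_angle_le], y standing for the maximal rate. *)
Lemma packing_dlog_le K p q w p' q' w' y : K <> Spherical ->
  0 < p -> 0 < q -> 0 < w -> (K = Hyperbolic -> 0 < y) ->
  ct K p * p' = y -> ct K q * q' <= y -> ct K w * w' <= y ->
  let d := dlog_angle K (q + w) (w + p) (p + q) (q' + w') (w' + p') (p' + q') in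
  d <= 0 /\ (d = 0 -> [/\ K = Euclidean, ct K q * q' = y & ct K w * w' = y]).
Proof.
move=> KS p0 q0 w0 y0 Ey hq hw.
have g (x : R) : 0 < x -> good K x by rewrite good_unbounded.
have ct0 (x : R) : 0 < x -> 0 < ct K x by move=> x0; rewrite divr_gt0 ?cn_gt0 ?sn_gt0 ?g.
have ctlt (x x' : R) : 0 < x -> 0 < x' -> 0 < 1 - ct K (x + x') / ct K x.
  move=> x0 x0'; rewrite subr_gt0 ltr_pdivrMr ?ct0// mul1r ctD ?g ?addr_gt0//.
  rewrite ltr_pdivrMr ?addr_gt0 ?ct0// mulrDr -subr_gt0 (_ : _ - _ = ct K x ^+ 2 + kappa K); last by ring.
  have s0 := sn_gt0 (g _ x0).
  rewrite (_ : _ + _ = (sn K x ^+ 2)^-1) ?invr_gt0 ?exprn_gt0//.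
  by rewrite -[RHS]div1r -(cn2sn2 K x) /ct; move: (kappa K) => kk; field; rewrite gt_eqF.
have W0 : 0 < p + q + w by rewrite !addr_gt0.
have qw : 0 < 1 - ct K (p + q + w) / ct K q.
  by rewrite (_ : p + q + w = q + (p + w)) ?ctlt ?addr_gt0//; ring.
have ww : 0 < 1 - ct K (p + q + w) / ct K w.
  by rewrite (_ : p + q + w = w + (p + q)) ?ctlt ?addr_gt0//; ring.
have [cp [cq cw]] := (ct0 _ p0, (ct0 _ q0, ct0 _ w0)).
(* The reciprocal of [ct] is the identity in the Euclidean case, where the bracket is zero, and tanh
   in the hyperbolic case, where strict subadditivity makes it negative. *)
have sub : let e := 1 - ct K (p + q + w) * ((ct K p)^-1 + (ct K q)^-1 + (ct K w)^-1) in
   y * e <= 0 /\ (K = Hyperbolic -> y * e < 0).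
  case: K KS g ct0 ctlt y0 Ey hq hw qw ww cp cq cw => // _ g ct0 ctlt y0 _ _ _ qw ww cp cq cw.
    rewrite /ct /= !div1r !invrK mulVf ?gt_eqF// subrr mulr0; split=> //.
  have lt (x x' : R) : 0 < x -> 0 < x' -> (ct Hyperbolic (x + x'))^-1 < (ct Hyperbolic x)^-1 + (ct Hyperbolic x')^-1.
    move=> x0 x0'; have [cx cx'] := (ct0 _ x0, ct0 _ x0').
    rewrite ctD ?g ?addr_gt0// invf_div /= opprK.
    rewrite (_ : (ct _ x)^-1 + _ = (ct Hyperbolic x + ct Hyperbolic x') / (ct Hyperbolic x * ct Hyperbolic x')).
      have cxx := mulr_gt0 cx cx'; rewrite ltr_pM2l ?addr_gt0// ltf_pV2 ?posrE ?ltrDl//.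
      exact: addr_gt0.
    by field; rewrite !gt_eqF.
  have n : y * (1 - ct Hyperbolic (p + q + w) *
      ((ct Hyperbolic p)^-1 + (ct Hyperbolic q)^-1 + (ct Hyperbolic w)^-1)) < 0.
    rewrite pmulr_rlt0 ?y0// subr_lt0 -ltr_pdivrMl ?ct0// mulr1.
    by rewrite (lt_trans (lt _ _ _ w0)) ?addr_gt0// ltrD2r lt.
  by split=> //; exact: ltW.
have -> : dlog_angle K (q + w) (w + p) (p + q) (q' + w') (w' + p') (p' + q') =
   (y * (1 - ct K (p + q + w) * ((ct K p)^-1 + (ct K q)^-1 + (ct K w)^-1)) +
    (1 - ct K (p + q + w) / ct K q) * (ct K q * q' - y) +
    (1 - ct K (p + q + w) / ct K w) * (ct K w * w' - y)) / 2.
  rewrite /dlog_angle -Ey.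
  have [-> -> -> ->] : [/\ (w + p + (p + q) - (q + w)) / 2 = p,
    (p + q + (q + w) - (w + p)) / 2 = q, (q + w + (w + p) - (p + q)) / 2 = w &
    (q + w + (w + p) + (p + q)) / 2 = p + q + w] by split; field.
  by move: (ct K (p + q + w)) => cW; field; rewrite !gt_eqF.
have [e1 e2] := sub.
have h1 : (1 - ct K (p + q + w) / ct K q) * (ct K q * q' - y) <= 0.
  by rewrite pmulr_rle0// subr_le0.
have h2 : (1 - ct K (p + q + w) / ct K w) * (ct K w * w' - y) <= 0.
  by rewrite pmulr_rle0// subr_le0.
move=> d; have dE : d = (_ + _ + _) / 2 := erefl.
split; first by rewrite dE pmulr_lle0 ?invr_gt0//; clear - e1 h1 h2; lra.
move=> /eqP; rewrite dE mulf_eq0 invr_eq0 pnatr_eq0 orbF => /eqP d0.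
have KH : K <> Hyperbolic by move=> /e2 e3; clear - e3 h1 h2 d0; lra.
have [z1 z2] : (1 - ct K (p + q + w) / ct K q) * (ct K q * q' - y) = 0 /\
   (1 - ct K (p + q + w) / ct K w) * (ct K w * w' - y) = 0 by clear - e1 h1 h2 d0; split; lra.
split; first by case: (K) KS KH.
- by apply/eqP; rewrite -subr_eq0 -(mulrI_eq0 _ (mulfI (lt0r_neq0 qw))) z1.
- by apply/eqP; rewrite -subr_eq0 -(mulrI_eq0 _ (mulfI (lt0r_neq0 ww))) z2.
Qed.

End packings.

(** * Embeddings modulo scaling *)

Section quotient_embedding.
Variables (R : realType) (n : nat) (U : set 'rV[R]_n) (f : 'rV[R]_n -> 'rV[R]_n).
Variable rho : 'rV[R]_n -> R.
Hypotheses (oU : open U) (coneU : forall c x, 0 < c -> U x -> U (c *: x)).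
Hypotheses (sf : smooth_on U f) (fZ : forall c x, 0 < c -> U x -> f (c *: x) = f x).

Lemma scaling_orbitZ (c : R) (x : 'rV[R]_n) : 0 < c -> scaling_orbit (c *: x) = scaling_orbit x.
Proof.
move=> c0; apply/seteqP; split=> y [d /= d0 <-].
  by exists (d * c); rewrite /= ?mulr_gt0// scalerA.
by exists (d / c); rewrite /= ?divr_gt0// scalerA divfK// gt_eqF.
Qed.

Lemma scaling_orbit_refl (x : 'rV[R]_n) : scaling_orbit x x.
Proof. by exists 1; rewrite /= ?scale1r. Qed.

Definition orbit_map (o : set 'rV[R]_n) : 'rV[R]_n := f (xget 0 o).

Lemma orbit_mapE : induced_on_orbits U f orbit_map.
Proof.
move=> x Ux; rewrite /orbit_map; case: xgetP => [y -> [c c0 <-]|].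
  exact: fZ.
by move=> /(_ x); case; exact: scaling_orbit_refl.
Qed.

Lemma immersion_mod_scalingP :
  (forall x v, U x -> 'd f x v = 0 -> exists c : R, v = c *: x) ->
  immersion_mod_scaling U f.
Proof. by move=> h; split=> //; exists orbit_map; exact: orbit_mapE. Qed.

Lemma diff_radial x : U x -> 'd f x x = 0.
Proof.
move=> Ux; have [df _] := sf.2 1%N; have dfx := df _ Ux.
rewrite -deriveE//.
have h : is_derive (0 : R) 1 (fun s : R => f (x + s *: x)) ('D_x f x).
  have := @is_derive_line R _ _ f x x 0; rewrite scale0r addr0; apply.
  exact: diff_derivable.
have E : \forall s \near (0 : R), cst (f x) s = f (x + s *: x).
  near=> s; have -> : x + s *: x = (1 + s) *: x by rewrite scalerDl scale1r.
  rewrite fZ//.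
  near: s; have : \forall s \near (0 : R), -1 < s by apply: lt_nbhsr; rewrite ltrN10.
  by apply: filterS => s; rewrite -ltrBlDl sub0r.
have [_ <-] := h; rewrite -(near_eq_derive _ E); exact: derive_cst.
Unshelve. all: by end_near. Qed.

Let G x := f x + const_mx (rho x).

Hypothesis srho : smooth U rho.
(** Each orbit meets every level of rho, so two orbits can be compared through representatives on
    one level. *)
Hypothesis rhoZ : forall x y, U x -> U y -> exists2 c : R, 0 < c & rho (c *: y) = rho x.
Hypothesis rho_radial : forall x, U x -> 'D_x rho x != 0.
Hypothesis immG : forall x v, U x -> 'd f x v + const_mx ('D_v rho x) = 0 -> v = 0.
Hypothesis injG : forall x y, U x -> U y -> G x = G y -> x = y.

Let smooth_coord i : smooth U (fun x => f x 0 i).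
Proof. by move=> k; apply: (C_on_coord k f oU).1; exact: sf.2. Qed.

Let sG : smooth_on U G.
Proof.
apply: smooth_on_coord => // i k; apply: (@Ck_eq _ _ _ _ (fun x => f x 0 i + rho x)) => //.
  by move=> x _; rewrite !mxE.
by apply: CkD => //; exact: smooth_coord.
Qed.

Let dG x v : U x -> 'd G x v = 'd f x v + const_mx ('D_v rho x).
Proof.
move=> Ux; have [df _] := sf.2 1%N; have [dG _] := sG.2 1%N; have [dr _] := srho 1%N.
apply: etrans (esym (deriveE v (dG _ Ux))) _; rewrite -(deriveE v (df _ Ux)).
have dGx : derivable G x v by apply: diff_derivable; exact: dG.
have dfx : derivable f x v by apply: diff_derivable; exact: df.
have drx : derivable rho x v by apply: diff_derivable; exact: dr.
apply/rowP => i; rewrite -derivable_coord// !mxE -derivable_coord//.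
rewrite (_ : (fun x => G x 0 i) = (fun x => f x 0 i) + rho); last first.
  by apply/funext => y; rewrite /G !mxE.
have [dfi _] := smooth_coord i 1%N; apply: deriveD drx.
by apply: diff_derivable; exact: dfi.
Qed.

Lemma embedding_mod_scaling : smooth_embedding_mod_scaling U f.
Proof.
have immG' : immersion_on U G by move=> x v Ux; rewrite dG//; exact: immG.
have finj x y : U x -> U y -> f x = f y -> scaling_orbit x = scaling_orbit y.
  move=> Ux Uy E; have [c c0 rc] := rhoZ Ux Uy.
  have <- : c *: y = x; last by rewrite scaling_orbitZ.
  by apply: injG => //; [exact: coneU|rewrite /G rc fZ// E].
split.
  apply: immersion_mod_scalingP => x v Ux dv.
  (* Both terms of dG vanish on v - c x: rho is stationary along it by the choice of c, and df kills
     v and the radial vector x. *)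
  pose c := 'D_v rho x / 'D_x rho x; exists c; apply/eqP; rewrite -subr_eq0; apply/eqP.
  apply: (immG Ux); have [dr _] := srho 1%N.
  rewrite linearB linearZ /= dv diff_radial// scaler0 subr0 add0r.
  rewrite (deriveE _ (dr _ Ux)) linearB linearZ /=.
  rewrite -(deriveE v (dr _ Ux)) -(deriveE x (dr _ Ux)).
  rewrite /c /GRing.scale /= divfK ?rho_radial// subrr.
  by apply/rowP => i; rewrite !mxE.
exists orbit_map; split; first exact: orbit_mapE.
  move=> _ _ [x Ux <-] [y Uy <-]; rewrite !orbit_mapE//; exact: finj.
move=> O OU; have orb o x : O o -> U x -> orbit_map o = f x -> o = scaling_orbit x.
  by move=> /OU [y Uy <-] Ux; rewrite orbit_mapE//; exact: finj.
split=> [[_ oA]|[W oW EW]].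
- set A := \bigcup_(o in O) o in oA.
  have AU : A `<=` U by move=> x [ o /OU [y Uy <-]] [c c0 <-]; exact: coneU.
  have AO x : A x -> O (scaling_orbit x).
    by move=> [ o Oo ox]; move: (Oo); have [y Uy E] := OU _ Oo; move: ox; rewrite -E => -[c c0 <-];
      rewrite scaling_orbitZ.
  (* G is an open map, so its image of the cone A can be shifted back by rho x to give an open set
     of values of f. If f z lies in it, z can be rescaled to the level of x, and injectivity of G
     puts it into A. *)
  exists (\bigcup_(x in A) [set w | (G @` A) (w + const_mx (rho x))]).
    apply: bigcup_open => x Ax.
    have oGA : open (G @` A) by apply: (open_image oU sG immG').
    have cW : continuous (fun w : 'rV[R]_n => w + const_mx (rho x)).
      by move=> w; exact: (cvgD (@cvg_id _ (nbhs w)) (cvg_cst _)).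
    exact: (open_comp (fun w _ => cW w) oGA).
  apply/seteqP; split.
    move=> _ [ o Oo <-]; have [y Uy E] := OU _ Oo; split; last by exists o => //; exact: OU.
    have Ay : A y by exists o => //; rewrite -E; exact: scaling_orbit_refl.
    by exists y => //=; exists y => //; rewrite -E orbit_mapE.
  move=> w [[x Ax [y Ay Ey]] [ _ [z Uz <-] Ez]].
  rewrite orbit_mapE// in Ez; rewrite -Ez in Ey *.
  have [c c0 rc] := rhoZ (AU _ Ax) Uz.
  have Ec : c *: z = y.
    by apply: injG; [exact: coneU|exact: AU|rewrite Ey /G rc fZ].
  exists (scaling_orbit z); last by rewrite orbit_mapE.
  by rewrite -(scaling_orbitZ z c0) Ec; exact: AO.
- split=> //.
  suff -> : \bigcup_(o in O) o = U `&` f @^-1` W.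
    rewrite openE => x [Ux Wx]; rewrite /interior; apply: filterI.
      exact: open_nbhs_nbhs.
    by apply: (sf.2 0%N x Ux); exact: open_nbhs_nbhs.
  apply/seteqP; split=> x.
    move=> [ o Oo]; have [y Uy Ey] := OU _ Oo; rewrite -Ey => -[c c0 <-].
    split; [exact: coneU|rewrite /preimage/= fZ//].
    suff [] : (W `&` orbit_map @` orbits U) (f y) by [].
    by rewrite -EW; exists o => //; rewrite -Ey orbit_mapE.
  move=> [Ux Wx]; have : (orbit_map @` O) (f x).
    by rewrite EW; split=> //; exists (scaling_orbit x); [exists x|rewrite orbit_mapE].
  move=> [ o Oo E]; exists o => //; rewrite (orb _ _ Oo Ux E); exact: scaling_orbit_refl.
Qed.

End quotient_embedding.

(** * The curvature maps *)

Section smooth_curvatures.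
Variable R : realType.

Lemma smooth_primitive n (U : set 'rV[R]_n) (f : 'rV[R]_n -> R) (phi psi : R -> R) :
  open U -> (forall x, U x -> is_derive (f x) 1 phi (psi (f x))) ->
  smooth U f -> smooth U (fun x => psi (f x)) -> smooth U (fun x => phi (f x)).
Proof.
move=> oU dphi sf spsi [|k]; last exact: (Ck_comp oU dphi (sf _) (spsi _)).
by apply: Ck_comp0 (sf 0%N) => x /dphi; exact: is_derive_continuous.
Qed.

Lemma smooth_tri_angle n K (U : set 'rV[R]_n) (a b c : 'rV[R]_n -> R) : open U ->
  (forall x, U x -> tri K (a x) (b x) (c x)) ->
  smooth U a -> smooth U b -> smooth U c ->
  smooth U (fun x => tri_angle K (a x) (b x) (c x)).
Proof.
move=> oU T sa sb sc k; have half (g : 'rV[R]_n -> R) : Ck k U g -> Ck k U (fun x => g x / 2).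
  by move=> Cg; apply: CkM => //; exact: Ck_cst.
apply: (Ck_ang (W := fun x => (a x + b x + c x) / 2) (a := fun x => (b x + c x - a x) / 2)
  (b := fun x => (c x + a x - b x) / 2) (c := fun x => (a x + b x - c x) / 2)) => //.
- move=> x /T Tx; have [[ga gb gc] _] := deficits_good Tx.
  by have [_ _ _] := Tx; have [[-> _ _ _] _] := tri_halves (a x) (b x) (c x).
- by apply: half; apply: CkD => //; apply: CkD.
- by apply: half; apply: CkB => //; apply: CkD.
- by apply: half; apply: CkB => //; apply: CkD.
- by apply: half; apply: CkB => //; apply: CkD.
Qed.

Section row_sums.
Variables (n m : nat) (I : finType) (U : set 'rV[R]_n) (F : 'rV[R]_n -> 'rV[R]_m).
Variables (A : 'I_m -> pred I) (u : I -> 'rV[R]_n -> R).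
Hypotheses (oU : open U) (su : forall c, smooth U (u c)).
Hypothesis FE : forall x i, U x -> F x 0 i = \sum_(c | A i c) u c x.

Lemma smooth_row_sum : smooth_on U F.
Proof.
apply: smooth_on_coord => // i k; apply: (@Ck_eq _ _ _ _ (fun x => \sum_(c | A i c) u c x)) => //.
  by move=> x Ux; rewrite FE.
by apply: Ck_sum => // c _; exact: su.
Qed.

Lemma diff_row_sum x v i : U x -> ('d F x v) 0 i = \sum_(c | A i c) 'D_v (u c) x.
Proof.
move=> Ux; have [dF _] := smooth_row_sum.2 1%N.
rewrite -(deriveE v (dF _ Ux)) -derivable_coord; last exact/diff_derivable/dF.
have -> : 'D_v (fun x => F x 0 i) x = 'D_v (fun x => \sum_(c | A i c) u c x) x.
  apply: near_eq_derive; apply: (near_open oU Ux) => y Uy; exact: FE.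
have h : is_derive x v (fun x => \sum_(c | A i c) u c x) (\sum_(c | A i c) 'D_v (u c) x).
  apply: is_der_sum => c; apply: DeriveDef => //.
  by have [dsu _] := su c 1%N; apply: diff_derivable; exact: dsu.
by have [_ ->] := h.
Qed.

End row_sums.

Lemma is_derive_smooth_line n (U : set 'rV[R]_n) (f : 'rV[R]_n -> R) x v : U x ->
  smooth U f -> is_derive (0 : R) 1 (fun s => f (x + s *: v)) ('D_v f x).
Proof.
move=> Ux sf; have := @is_derive_line R _ _ f x v 0; rewrite scale0r addr0; apply.
by have [df _] := sf 1%N; apply: diff_derivable; exact: df.
Qed.

(** Directional derivatives on R^E or R^V are read off along a line, where the one-variable formulas
    for triangles apply. *)
Lemma derive_line_unique n (U : set 'rV[R]_n) (f : 'rV[R]_n -> R) x v (d : R) : U x ->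
  smooth U f -> is_derive (0 : R) 1 (fun s => f (x + s *: v)) d -> 'D_v f x = d.
Proof. by move=> Ux sf [_ <-]; have [_ ->] := is_derive_smooth_line v Ux sf. Qed.

Variable S : closed_surface.
Implicit Types (K : geometry) (l : 'rV[R]_#|edge S|) (r : 'rV[R]_#|vertex S|) (c : corner S).

Definition corner_tri K l c :=
  tri K (side_length l c) (side_length l (next_corner c)) (side_length l (prev_corner c)).

Definition model_angle K l c :=
  tri_angle K (side_length l c) (side_length l (next_corner c)) (side_length l (prev_corner c)).

Lemma polyhedralP K l : polyhedral K l <-> forall c, corner_tri K l c.
Proof.
split=> [[_ h] c|h].
  by have [x [y [z /triangle_withP[]]]] := h c.
split=> [|s]; last exact/triangle_exists/h.
by apply: edge_rank_ind => s; have [/good_gt0] := tri_gt0 (h s).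
Qed.

Lemma corner_angleE K l c : polyhedral K l -> corner_angle K l c = model_angle K l c.
Proof. by move=> /polyhedralP/(_ c); exact: inner_angleE. Qed.

Lemma smooth_side (U : set 'rV[R]_#|edge S|) c : smooth U (fun l => side_length l c).
Proof. by move=> k; exact: Ck_coord. Qed.

Lemma open_polyhedral K : open (@polyhedral R S K).
Proof.
have -> : @polyhedral R S K = [set l | forall c, corner_tri K l c].
  by apply/seteqP; split=> l /=; rewrite polyhedralP.
rewrite openE => l h.
have sc c : {for l, continuous (fun l => side_length l c)} by exact: (smooth_side setT c 0%N).
have nt c : \forall l' \near l, corner_tri K l' c by exact: tri_near (h c).
exact: (@filter_forall _ _ (fun c l => corner_tri K l c) (nbhs l) _ nt).
Qed.

Lemma smooth_model_angle K c : smooth (@polyhedral R S K) (fun l => model_angle K l c).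
Proof.
apply: smooth_tri_angle (@open_polyhedral K) (fun l Pl => (polyhedralP K l).1 Pl c) _ _ _;
  exact: smooth_side.
Qed.

Lemma smooth_Jsin (lam : R) K c :
  smooth (@polyhedral R S K) (fun l => Jsin lam (model_angle K l c)).
Proof.
have I l : polyhedral K l -> 0 < model_angle K l c < pi.
  by move=> /polyhedralP/(_ c)/tri_angle_itv.
apply: (smooth_primitive (psi := fun t => sin t `^ lam)).
- exact: open_polyhedral.
- by move=> l /I; exact: is_derive_Jsin.
- exact: smooth_model_angle.
- move=> k; apply: Ck_powR; [exact: open_polyhedral|by move=> l /I/sin_gt0_pi|].
  exact: (Ck_sin_cos (@open_polyhedral K) (@smooth_model_angle K c k)).1.
Qed.

Lemma PhiE (lam : R) K l i : polyhedral K l ->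
  Phi K lam l 0 i = \sum_(c in val (enum_val i)) Jsin lam (model_angle K l c).
Proof. by move=> Pl; rewrite mxE; apply: eq_bigr => c _; rewrite corner_angleE. Qed.

Lemma smooth_Phi (lam : R) K : smooth_on (@polyhedral R S K) (Phi K lam).
Proof.
exact: (smooth_row_sum (F := Phi K lam) (A := fun i c => c \in val (enum_val i)) (@open_polyhedral K)
  (smooth_Jsin lam K) (fun l i => @PhiE lam K l i)).
Qed.

Definition model_defect l c :=
  half_defect Hyperbolic (side_length l c) (side_length l (next_corner c))
    (side_length l (prev_corner c)).

Lemma model_defectE l c : polyhedral Hyperbolic l ->
  (corner_angle Hyperbolic l (next_corner c) + corner_angle Hyperbolic l (prev_corner c)
        - corner_angle Hyperbolic l c) / 2 = model_defect l c.
Proof.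
by move=> Pl; rewrite !corner_angleE// /model_angle next_next_corner next_cornerK prev_cornerK prev_prev_corner.
Qed.

Lemma model_defect_itv l c : polyhedral Hyperbolic l -> - (pi / 2) < model_defect l c < pi / 2.
Proof.
move=> /polyhedralP/(_ c)/tri_angular[d _ _ _]; exact: angular_itv d.
Qed.

Lemma smooth_Jcos (lam : R) c :
  smooth (@polyhedral R S Hyperbolic) (fun l => Jcos lam (model_defect l c)).
Proof.
have oP := @open_polyhedral Hyperbolic.
have sd : smooth (@polyhedral R S Hyperbolic) (fun l => model_defect l c).
  move=> k; apply: CkM => //; last exact: Ck_cst.
  have sa := @smooth_model_angle Hyperbolic.
  have := sa (next_corner c) k; have := sa (prev_corner c) k; have := sa c k.
  rewrite /model_angle next_next_corner next_cornerK prev_cornerK prev_prev_corner => s1 s2 s3.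
  by apply: CkB => //; apply: CkD.
apply: (smooth_primitive (psi := fun t => cos t `^ lam)) => //.
- by move=> l Pl; apply: is_derive_Jcos; exact: model_defect_itv.
- move=> k; apply: Ck_powR => //.
    by move=> l Pl; apply: cos_gt0_pihalf; exact: model_defect_itv.
  exact: (Ck_sin_cos oP (sd k)).2.
Qed.

Lemma PsiE (lam : R) l i : polyhedral Hyperbolic l ->
  Psi Hyperbolic lam l 0 i = \sum_(c in val (enum_val i)) Jcos lam (model_defect l c).
Proof. by move=> Pl; rewrite mxE; apply: eq_bigr => c _; rewrite model_defectE. Qed.

Lemma smooth_Psi (lam : R) : smooth_on (@polyhedral R S Hyperbolic) (Psi Hyperbolic lam).
Proof.
exact: (smooth_row_sum (F := Psi Hyperbolic lam) (A := fun i c => c \in val (enum_val i)) (@open_polyhedral _)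
  (smooth_Jcos lam) (fun l i => @PsiE lam l i)).
Qed.

Lemma open_radii : open (@radii R S).
Proof.
rewrite openE => r r0.
have nt v : nbhs r [set r' : 'rV[R]_#|vertex S| | 0 < r' 0 v].
  exact: (cvgr_gt _ (@Ck_coord _ _ 0 setT v r I) _ (r0 v)).
exact: (@filter_forall _ _ (fun v r => 0 < r 0 v) (nbhs r) _ nt).
Qed.

Definition corner_packing_angle K r c :=
  packing_angle K (vertex_radius r c) (vertex_radius r (next_corner c)) (vertex_radius r (prev_corner c)).

Lemma model_angle_packing K r c : K <> Spherical -> radii r ->
  corner_tri K (packing_metric r) c /\
  model_angle K (packing_metric r) c = corner_packing_angle K r c.
Proof.
move=> KS r0; rewrite /corner_tri /model_angle !side_packing next_next_corner next_cornerK prev_cornerK prev_prev_corner.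
exact: tri_packing KS (r0 _) (r0 _) (r0 _).
Qed.

Lemma polyhedral_packing K r : K <> Spherical -> radii r -> polyhedral K (packing_metric r).
Proof. by move=> KS r0; apply/polyhedralP => c; exact: (model_angle_packing c KS r0).1. Qed.

Lemma corner_packing_angle_itv K r c : K <> Spherical -> radii r ->
  0 < corner_packing_angle K r c < pi.
Proof.
move=> KS r0; have [T <-] := model_angle_packing c KS r0; exact: tri_angle_itv T.
Qed.

Lemma smooth_Jtan (lam : R) K c : K <> Spherical ->
  smooth (@radii R S) (fun r => Jtan lam (corner_packing_angle K r c)).
Proof.
move=> KS; have oR := open_radii.
have gW r : radii r -> [/\ good K (vertex_radius r c + vertex_radius r (next_corner c) + vertex_radius r (prev_corner c)),
    good K (vertex_radius r c), good K (vertex_radius r (next_corner c)) & good K (vertex_radius r (prev_corner c))].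
  by move=> r0; rewrite !good_unbounded//; split; rewrite ?addr_gt0 ?r0.
have sa : smooth (@radii R S) (fun r => corner_packing_angle K r c).
  move=> k; apply: (Ck_ang oR gW); [|exact: Ck_coord..].
  by apply: CkD => //; [apply: CkD => //|]; exact: Ck_coord.
apply: (smooth_primitive (psi := fun t => tan (t / 2) `^ lam)) => //.
- by move=> r r0; apply: is_derive_Jtan; exact: corner_packing_angle_itv.
- move=> k; apply: Ck_powR => //.
    by move=> r r0; apply: tan_half_gt0; exact: corner_packing_angle_itv.
  have Ch : Ck k (@radii R S) (fun r => corner_packing_angle K r c / 2).
      by apply: CkM => //; exact: Ck_cst.
  have [Cs Cc] := Ck_sin_cos oR Ch; apply: Ck_div => // r r0.
  have /andP[a0 api] := corner_packing_angle_itv c KS r0.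
  by rewrite gt_eqF// cos_gt0_pihalf//; apply/andP; split; lra.
Qed.

Lemma KcurvE (lam : R) K r i : K <> Spherical -> radii r ->
  Kcurv K lam (packing_metric r) 0 i =
  \sum_(c in val (enum_val i)) Jtan lam (corner_packing_angle K r c).
Proof.
move=> KS r0; rewrite mxE; apply: eq_bigr => c _.
by rewrite corner_angleE ?(model_angle_packing c KS r0).2//; exact: polyhedral_packing.
Qed.

Lemma smooth_Kcurv (lam : R) K : K <> Spherical ->
  smooth_on (@radii R S) (fun r => Kcurv K lam (packing_metric r)).
Proof.
move=> KS; exact: (smooth_row_sum (F := fun r => Kcurv K lam (packing_metric r)) (A := fun i c => c \in val (enum_val i)) open_radii
  (fun c => smooth_Jtan lam c KS) (fun r i => @KcurvE lam K r i KS)).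
Qed.

End smooth_curvatures.

(** * Phi and Psi: from single faces to the whole surface *)

Section edge_maps.
Variables (R : realType) (S : closed_surface).
Implicit Types (K : geometry) (l v : 'rV[R]_#|edge S|) (c : corner S) (lam : R).
Local Notation rank c := (enum_rank (edge_of c)).

Definition face_sum (t : 'I_#|edge S| -> R) (D : corner S -> R) (f : face S) : R :=
  let s : corner S := (f, ord0) in t (rank s) * D s +
  t (rank (next_corner s)) * D (next_corner s) + t (rank (prev_corner s)) * D (prev_corner s).

(** Each edge collects its two facing corners, so pairing over edges is a sum over all corners,
    regrouped by faces. Since the face terms are nonnegative, a vanishing total forces equality in
    every face. *)
Lemma edge_face_sum (t : 'I_#|edge S| -> R) (D : corner S -> R) (P : face S -> Prop) :
  (forall f, 0 <= face_sum t D f /\ (face_sum t D f = 0 -> P f)) ->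
  0 <= \sum_i t i * \sum_(c in val (enum_val i)) D c /\
  (\sum_i t i * \sum_(c in val (enum_val i)) D c = 0 -> forall f, P f).
Proof.
move=> h; rewrite edge_sum (corner_sum (fun c => t (rank c) * D c)).
split=> [|/eqP]; first by apply: sumr_ge0 => f _; have [] := h f.
rewrite psumr_eq0 => [|f _]; last by have [] := h f.
by move=> /allP z f; apply: (h f).2; apply/eqP/z; rewrite mem_index_enum.
Qed.

(** Neighbouring faces share an edge, on which L does not vanish, so their factors agree;
    connectedness does the rest. *)
Lemma face_ratio (F L : 'I_#|edge S| -> R) : (forall i, L i != 0) ->
  (forall f, exists t, forall c : corner S, c.1 = f -> F (rank c) = t * L (rank c)) ->
  exists t, forall i, F i = t * L i.
Proof.
move=> L0 h; have /card_gt0P[f0 _] := face_gt0 S; have [t tE] := h f0; exists t.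
apply: edge_rank_ind => s.
apply: (@face_connected_ind S (fun f => forall c : corner S, c.1 = f -> F (rank c) = t * L (rank c))
  f0) (erefl s.1) => // s' hs' c cE; have [t' tE'] := h (gluing s').1.
suff -> : t = t' by exact: tE'.
by apply: (mulIf (L0 (rank s'))); rewrite -hs'// -(edge_of_gluing s') -tE'.
Qed.

Lemma face_eq (F L : 'I_#|edge S| -> R) : (forall f, let s : corner S := (f, ord0) in
   [/\ F (rank s) = L (rank s), F (rank (next_corner s)) = L (rank (next_corner s)) &
       F (rank (prev_corner s)) = L (rank (prev_corner s))]) -> forall i, F i = L i.
Proof.
move=> h; apply: edge_rank_ind => s; have [h1 h2 h3] := h s.1.
exact: (@face_corner S (fun c => F (rank c) = L (rank c)) s.1 h1 h2 h3 s erefl).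
Qed.

Lemma edge_gt0 : (0 < #|edge S|)%N.
Proof. by have /card_gt0P[f _] := face_gt0 S; apply/card_gt0P; exists (edge_of (f, ord0)). Qed.

Lemma polyhedral_gt0 K l i : polyhedral K l -> good K (l 0 i).
Proof. by move=> /polyhedralP h; move: i; apply: edge_rank_ind => s; have [] := tri_gt0 (h s). Qed.

Lemma is_derive_coord_line l v i : is_derive (0 : R) 1 (fun s => (l + s *: v) 0 i) (v 0 i).
Proof.
have := is_derD (is_derive_cst (l 0 i) (0 : R) 1) (is_derM (is_derive_id (0 : R) 1)
  (is_derive_cst (v 0 i) (0 : R) 1)).
rewrite mulr0 addr0 mul1r add0r; congr is_derive.
by apply/funext => s; rewrite !mxE.
Qed.

Lemma model_angle_next K l c : model_angle K l (next_corner c) =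
  tri_angle K (side_length l (next_corner c)) (side_length l (prev_corner c)) (side_length l c).
Proof. by rewrite /model_angle next_next_corner next_cornerK. Qed.

Lemma model_angle_prev K l c : model_angle K l (prev_corner c) =
  tri_angle K (side_length l (prev_corner c)) (side_length l c) (side_length l (next_corner c)).
Proof. by rewrite /model_angle prev_prev_corner prev_cornerK. Qed.

Lemma model_defect_next l c : model_defect l (next_corner c) =
  half_defect Hyperbolic (side_length l (next_corner c)) (side_length l (prev_corner c))
    (side_length l c).
Proof. by rewrite /model_defect next_next_corner next_cornerK. Qed.

Lemma model_defect_prev l c : model_defect l (prev_corner c) =
  half_defect Hyperbolic (side_length l (prev_corner c)) (side_length l c)
    (side_length l (next_corner c)).
Proof. by rewrite /model_defect prev_prev_corner prev_cornerK. Qed.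

Definition dPhi_sum lam K l v :=
  \sum_i v 0 i * sn K (l 0 i) `^ (- lam - 1) * ('d (Phi K lam) l v) 0 i.

Lemma dPhi_form lam K l v : K <> Hyperbolic -> polyhedral K l ->
  0 <= dPhi_sum lam K l v /\ (dPhi_sum lam K l v = 0 ->
    (K = Spherical -> v = 0) /\ (K = Euclidean -> exists e : R, v = e *: l)).
Proof.
move=> KH Pl; pose t i := v 0 i * sn K (l 0 i) `^ (- lam - 1).
pose D c := 'D_v (fun l => Jsin lam (model_angle K l c)) l.
have E : dPhi_sum lam K l v = \sum_i t i * \sum_(c in val (enum_val i)) D c.
  apply: eq_bigr => i _; congr (_ * _).
  exact: (diff_row_sum (F := Phi K lam) (A := fun i c => c \in val (enum_val i))
    (@open_polyhedral R S K) (smooth_Jsin lam K) (fun l i => @PhiE R S lam K l i)).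
pose P f := forall s : corner S, s = (f, ord0) -> exists e, [/\ v 0 (rank s) = e * l 0 (rank s),
  v 0 (rank (next_corner s)) = e * l 0 (rank (next_corner s)),
  v 0 (rank (prev_corner s)) = e * l 0 (rank (prev_corner s)) & K = Spherical -> e = 0].
have [] := @edge_face_sum t D P.
  move=> f; pose s : corner S := (f, ord0).
  pose a u := side_length (l + u *: v) s; pose b u := side_length (l + u *: v) (next_corner s).
  pose c u := side_length (l + u *: v) (prev_corner s).
  have da := is_derive_coord_line l v (rank s).
  have db := is_derive_coord_line l v (rank (next_corner s)).
  have dc := is_derive_coord_line l v (rank (prev_corner s)).
  have l0 : l + 0 *: v = l by rewrite scale0r addr0.
  have T : tri K (a 0) (b 0) (c 0).
    by rewrite /a /b /c l0; exact: (polyhedralP K l).1 Pl s.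
  have [u1 [u2 [u3 [d1 d2 d3 [m m0 Em]]]]] :=
    weighted_form (a := a) (b := b) (c := c) (lam := lam) erefl erefl erefl T da db dc.
  have Du c' u : is_derive (0 : R) 1 (fun u => Jsin lam (model_angle K (l + u *: v) c')) u ->
      D c' = u := derive_line_unique Pl (smooth_Jsin lam K c').
  have e1 : D s = u1 by exact: Du d1.
  have e2 : D (next_corner s) = u2.
    have e : (fun u => Jsin lam (model_angle K (l + u *: v) (next_corner s))) =
        (fun u => Jsin lam (tri_angle K (b u) (c u) (a u))) by apply/funext => u; rewrite model_angle_next.
    exact: (Du _ _ (eq_ind_r (fun g => is_derive (0 : R) 1 g u2) d2 e)).
  have e3 : D (prev_corner s) = u3.
    have e : (fun u => Jsin lam (model_angle K (l + u *: v) (prev_corner s))) =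
        (fun u => Jsin lam (tri_angle K (c u) (a u) (b u))) by apply/funext => u; rewrite model_angle_prev.
    exact: (Du _ _ (eq_ind_r (fun g => is_derive (0 : R) 1 g u3) d3 e)).
  have XE : face_sum t D f = m * Qform K ((b 0 + c 0 - a 0) / 2) ((c 0 + a 0 - b 0) / 2)
      ((a 0 + b 0 - c 0) / 2) ((v 0 (rank (next_corner s)) + v 0 (rank (prev_corner s)) - v 0 (rank s)) / 2)
      ((v 0 (rank (prev_corner s)) + v 0 (rank s) - v 0 (rank (next_corner s))) / 2)
      ((v 0 (rank s) + v 0 (rank (next_corner s)) - v 0 (rank (prev_corner s))) / 2).
    by rewrite -Em /face_sum -/s e1 e2 e3 /t /a /b /c l0.
  have [Q0 Qz] := Qform_ge0 ((v 0 (rank (next_corner s)) + v 0 (rank (prev_corner s)) - v 0 (rank s)) / 2)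
    ((v 0 (rank (prev_corner s)) + v 0 (rank s) - v 0 (rank (next_corner s))) / 2)
    ((v 0 (rank s) + v 0 (rank (next_corner s)) - v 0 (rank (prev_corner s))) / 2) KH T.
  rewrite XE; split; first exact: mulr_ge0 (ltW m0) Q0.
  move=> /eqP; rewrite mulf_eq0 (gt_eqF m0)/= => /eqP /Qz[e [h1 h2 h3 hS]] s' ->.
  exists e; move: h1 h2 h3; rewrite /a /b /c l0 /side_length.
  move: (v 0 (rank s)) (v 0 (rank (next_corner s))) (v 0 (rank (prev_corner s))).
  move: (l 0 (rank s)) (l 0 (rank (next_corner s))) (l 0 (rank (prev_corner s))) => x y z x' y' z' h1 h2 h3.
  by split; [clear - h1 h2 h3; lra..|exact: hS].
rewrite -E => S0 Sz; split; first exact: S0.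
move=> /Sz Pf; split=> KE.
  apply/rowP => i; rewrite mxE; move: i.
  apply: (@face_eq (fun i => v 0 i) (fun=> 0)) => f s.
  have [e [-> -> -> /(_ KE) ->]] := Pf f s erefl.
  by rewrite !mul0r.
have [e eE] : exists e, forall i, v 0 i = e * l 0 i.
  apply: face_ratio => [i|f]; first by rewrite gt_eqF// (good_gt0 (polyhedral_gt0 i Pl)).
  have [e [h1 h2 h3 _]] := Pf f (f, ord0) erefl; exists e => c cf.
  exact: (@face_corner S (fun c => v 0 (rank c) = e * l 0 (rank c)) f h1 h2 h3 c cf).
by exists e; apply/rowP => i; rewrite eE !mxE.
Qed.

Lemma dPsi_form lam l v : polyhedral Hyperbolic l ->
  let X := \sum_i v 0 i * tanh_half (l 0 i) `^ (- lam - 1) * ('d (Psi Hyperbolic lam) l v) 0 i in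
  X <= 0 /\ (X = 0 -> v = 0).
Proof.
move=> Pl X; pose t i := v 0 i * tanh_half (l 0 i) `^ (- lam - 1).
(* The form for Psi is negative; the sign brings it into the shape of [edge_face_sum]. *)
pose D c := - 'D_v (fun l => Jcos lam (model_defect l c)) l.
have E : - X = \sum_i t i * \sum_(c in val (enum_val i)) D c.
  rewrite -sumrN; apply: eq_bigr => i _; rewrite -mulrN; congr (_ * _).
  rewrite sumrN; congr (- _).
  exact: (diff_row_sum (F := Psi Hyperbolic lam) (A := fun i c => c \in val (enum_val i))
    (@open_polyhedral R S _) (smooth_Jcos lam) (fun l i => @PsiE R S lam l i)).
pose P f := let s : corner S := (f, ord0) in [/\ v 0 (rank s) = 0,
  v 0 (rank (next_corner s)) = 0 & v 0 (rank (prev_corner s)) = 0].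
have [] := @edge_face_sum t D P.
  move=> f; pose s : corner S := (f, ord0).
  pose a u := side_length (l + u *: v) s; pose b u := side_length (l + u *: v) (next_corner s).
  pose c u := side_length (l + u *: v) (prev_corner s).
  have da := is_derive_coord_line l v (rank s).
  have db := is_derive_coord_line l v (rank (next_corner s)).
  have dc := is_derive_coord_line l v (rank (prev_corner s)).
  have l0 : l + 0 *: v = l by rewrite scale0r addr0.
  have T : tri Hyperbolic (a 0) (b 0) (c 0).
    by rewrite /a /b /c l0; exact: (polyhedralP _ l).1 Pl s.
  have [u1 [u2 [u3 [d1 d2 d3 [m [H [m0 H0 Hz Em]]]]]]] :=
    hyperbolic_weighted_form (a := a) (b := b) (c := c) (lam := lam) erefl erefl erefl T da db dc.
  have Du c' u : is_derive (0 : R) 1 (fun u => Jcos lam (model_defect (l + u *: v) c')) u ->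
      'D_v (fun l => Jcos lam (model_defect l c')) l = u := derive_line_unique Pl (smooth_Jcos lam c').
  have e1 : D s = - u1 by congr (- _); exact: Du d1.
  have e2 : D (next_corner s) = - u2.
    congr (- _); have e : (fun u => Jcos lam (model_defect (l + u *: v) (next_corner s))) =
        (fun u => Jcos lam (half_defect Hyperbolic (b u) (c u) (a u))) by apply/funext => u; rewrite model_defect_next.
    exact: (Du _ _ (eq_ind_r (fun g => is_derive (0 : R) 1 g u2) d2 e)).
  have e3 : D (prev_corner s) = - u3.
    congr (- _); have e : (fun u => Jcos lam (model_defect (l + u *: v) (prev_corner s))) =
        (fun u => Jcos lam (half_defect Hyperbolic (c u) (a u) (b u))) by apply/funext => u; rewrite model_defect_prev.
    exact: (Du _ _ (eq_ind_r (fun g => is_derive (0 : R) 1 g u3) d3 e)).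
  have YE : face_sum t D f = m * H.
    have alg (x y z p q r M : R) : x * p + y * q + z * r = - M -> x * - p + y * - q + z * - r = M.
      by rewrite !mulrN -!opprD => ->; rewrite opprK.
    rewrite /face_sum -/s e1 e2 e3 /t; apply: alg; move: Em; rewrite /a /b /c l0; exact: id.
  rewrite YE; split; first exact: mulr_ge0 (ltW m0) H0.
  by move=> /eqP; rewrite mulf_eq0 (gt_eqF m0)/= => /eqP /Hz.
rewrite -E => S0 Sz; split; first by rewrite -oppr_ge0.
move=> X0; apply/rowP => i; rewrite mxE; move: i.
by apply: (@face_eq (fun i => v 0 i) (fun=> 0)); apply: Sz; rewrite X0 oppr0.
Qed.

Lemma Phi_monotone lam l l' : 0 <= lam \/ lam <= -1 ->
  polyhedral Spherical l -> polyhedral Spherical l' ->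
  Phi Spherical lam l = Phi Spherical lam l' -> l = l'.
Proof.
move=> hlam Pl Pl' E; pose h := Jsin (- lam - 1).
pose D c := Jsin lam (model_angle Spherical l' c) - Jsin lam (model_angle Spherical l c).
pose P f := let s : corner S := (f, ord0) in [/\ l 0 (rank s) = l' 0 (rank s),
  l 0 (rank (next_corner s)) = l' 0 (rank (next_corner s)) &
  l 0 (rank (prev_corner s)) = l' 0 (rank (prev_corner s))].
have [] := @edge_face_sum (fun i => h (l' 0 i) - h (l 0 i)) D P.
  move=> f; pose s : corner S := (f, ord0).
  have := spherical_monotone hlam ((polyhedralP _ _).1 Pl s) ((polyhedralP _ _).1 Pl' s).
  by rewrite /face_sum -/s /D !model_angle_next !model_angle_prev.
move=> _ Sz; apply/rowP; apply: face_eq; apply: Sz.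
apply: big1 => i _.
have -> : \sum_(c in val (enum_val i)) D c = Phi Spherical lam l' 0 i - Phi Spherical lam l 0 i.
  by rewrite (PhiE lam i Pl) (PhiE lam i Pl') -sumrB.
by rewrite E (subrr (Phi _ _ l' 0 i)) mulr0.
Qed.

(** A common difference d is allowed because the map to be proved injective is Phi + rho.(1, ...,
    1); with rho the sum of the coordinates h, the pairing becomes d times the increment of rho. *)
Lemma Phi_monotone_mod_scaling lam l l' (d : R) : lam <= -1 ->
  polyhedral Euclidean l -> polyhedral Euclidean l' ->
  (forall i, Phi Euclidean lam l' 0 i - Phi Euclidean lam l 0 i = d) ->
  let h x := x `^ (- lam) / (- lam) in
  0 <= d * \sum_i (h (l' 0 i) - h (l 0 i)) /\
  (d * \sum_i (h (l' 0 i) - h (l 0 i)) = 0 -> exists2 c, 0 < c & l' = c *: l).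
Proof.
move=> lam1 Pl Pl' E h.
pose D c := Jsin lam (model_angle Euclidean l' c) - Jsin lam (model_angle Euclidean l c).
pose P f := forall s : corner S, s = (f, ord0) -> exists2 e, 0 < e &
  [/\ l' 0 (rank s) = e * l 0 (rank s),
  l' 0 (rank (next_corner s)) = e * l 0 (rank (next_corner s)) &
  l' 0 (rank (prev_corner s)) = e * l 0 (rank (prev_corner s))].
have [] := @edge_face_sum (fun i => h (l' 0 i) - h (l 0 i)) D P.
  move=> f; pose s : corner S := (f, ord0).
  have := euclidean_monotone lam1 ((polyhedralP _ _).1 Pl s) ((polyhedralP _ _).1 Pl' s).
  rewrite /face_sum -/s /D !model_angle_next !model_angle_prev.
  by move=> [D0 Dz]; split; [exact: D0|move=> /Dz H s' ->].
have -> : \sum_i (h (l' 0 i) - h (l 0 i)) * \sum_(c in val (enum_val i)) D c =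
    d * \sum_i (h (l' 0 i) - h (l 0 i)).
  rewrite mulr_sumr; apply: eq_bigr => i _; rewrite mulrC; congr (_ * _).
  by rewrite -(E i) (PhiE lam i Pl) (PhiE lam i Pl') -sumrB.
move=> S0 Sz; split; first exact: S0.
move=> /Sz Pf.
have [e eE] : exists e, forall i, l' 0 i = e * l 0 i.
  apply: face_ratio => [i|f]; first by rewrite gt_eqF// (good_gt0 (polyhedral_gt0 i Pl)).
  have [e e0 [h1 h2 h3]] := Pf f (f, ord0) erefl; exists e => c cf.
  exact: (@face_corner S (fun c => l' 0 (rank c) = e * l 0 (rank c)) f h1 h2 h3 c cf).
exists e; last by apply/rowP => i; rewrite eE !mxE.
have [g g'] := (good_gt0 (polyhedral_gt0 (Ordinal edge_gt0) Pl), good_gt0 (polyhedral_gt0 (Ordinal edge_gt0) Pl')).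
by rewrite eE pmulr_lgt0 in g'.
Qed.

Lemma Psi_monotone lam l l' : lam <= -1 \/ 0 <= lam ->
  polyhedral Hyperbolic l -> polyhedral Hyperbolic l' ->
  Psi Hyperbolic lam l = Psi Hyperbolic lam l' -> l = l'.
Proof.
move=> hlam Pl Pl' E; pose h x := Jtanh lam (tanh_half x).
pose D c := Jcos lam (model_defect l c) - Jcos lam (model_defect l' c).
pose P f := let s : corner S := (f, ord0) in [/\ l 0 (rank s) = l' 0 (rank s),
  l 0 (rank (next_corner s)) = l' 0 (rank (next_corner s)) &
  l 0 (rank (prev_corner s)) = l' 0 (rank (prev_corner s))].
have [] := @edge_face_sum (fun i => h (l' 0 i) - h (l 0 i)) D P.
  move=> f; pose s : corner S := (f, ord0).
  have opp (X Y : R) (Q : Prop) : X = - Y -> Y <= 0 /\ (Y = 0 -> Q) -> 0 <= X /\ (X = 0 -> Q).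
    by move=> -> [Y0 Yz]; rewrite oppr_ge0; split=> // /eqP; rewrite oppr_eq0 => /eqP.
  have alg (x y z p q r p' q' r' : R) : x * (p - p') + y * (q - q') + z * (r - r') =
    - (x * (p' - p) + y * (q' - q) + z * (r' - r)) by ring.
  apply: (opp _ _ _ _ (hyperbolic_monotone hlam ((polyhedralP _ _).1 Pl s)
    ((polyhedralP _ _).1 Pl' s))).
  rewrite /face_sum -/s /D /h !model_defect_next !model_defect_prev; exact: alg.
move=> _ Sz; apply/rowP; apply: face_eq; apply: Sz.
apply: big1 => i _.
have -> : \sum_(c in val (enum_val i)) D c = Psi Hyperbolic lam l 0 i - Psi Hyperbolic lam l' 0 i.
  by rewrite (PsiE lam i Pl) (PsiE lam i Pl') -sumrB.
by rewrite E (subrr (Psi _ _ l' 0 i)) mulr0.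
Qed.

End edge_maps.

(** * The maximum principle for circle packings *)

Section vertex_maps.
Variables (R : realType) (S : closed_surface).
Implicit Types (K : geometry) (r v : 'rV[R]_#|vertex S|) (c : corner S) (lam : R).
Local Notation vrank c := (enum_rank (vertex_of c)).

Lemma same_face c c0 : c.1 = c0.1 -> [\/ c = c0, c = next_corner c0 | c = prev_corner c0].
Proof.
case: c0 => f i; case: c => g j /= ->.
have [->|[->|->]] : j = i \/ j = ordS i \/ j = ord_pred i.
  by case: i j => [[|[|[|//]]] ilt] [[|[|[|//]]] jlt]; do ?[by left; exact: val_inj];
    right; do ?[by left; exact: val_inj]; right; exact: val_inj.
- exact: Or31.
- exact: Or32.
- exact: Or33.
Qed.

(** Equality in the maximum principle passes from a vertex to its neighbours; this spreads it over
    the connected surface. *)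
Lemma vertex_connected_ind (P : 'I_#|vertex S| -> Prop) i0 : P i0 ->
  (forall c, P (vrank c) -> P (vrank (next_corner c)) /\ P (vrank (prev_corner c))) ->
  forall i, P i.
Proof.
move: i0; apply: vertex_rank_ind => c0 P0 h; apply: vertex_rank_ind => c1.
have full c : P (vrank c) -> forall d, d.1 = c.1 -> P (vrank d).
  by move=> Pc d /same_face[->|->|->] //; have [] := h c Pc.
apply: (@face_connected_ind S (fun f => forall d : corner S, d.1 = f -> P (vrank d)) c0.1) (erefl c1.1).
  exact: full.
move=> s Ps d dE; have [n _] := vertex_of_gluing s.
have : P (vrank (next_corner s)) by exact: Ps.
rewrite n; case: (aligned s) => Pn; exact: (full _ Pn).
Qed.

Lemma vertex_gt0 : (0 < #|vertex S|)%N.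
Proof. by have /card_gt0P[f _] := face_gt0 S; apply/card_gt0P; exists (vertex_of (f, ord0)). Qed.

Lemma exists_max n (F : 'I_n -> R) : (0 < n)%N -> exists i, forall j, F j <= F i.
Proof.
move=> n0; have [i _ h] := @arg_maxP _ R _ (Ordinal n0) xpredT F erefl.
by exists i => j; exact: h.
Qed.

Section corner_sums.
Variables (i : 'I_#|vertex S|) (D : corner S -> R) (P : corner S -> Prop).
Hypothesis DP : forall c, vrank c = i -> D c <= 0 /\ (D c = 0 -> P c).

Lemma vertex_sum_le : \sum_(c in val (enum_val i)) D c <= 0 /\
  (\sum_(c in val (enum_val i)) D c = 0 -> forall c, vrank c = i -> P c).
Proof.
have ci c : c \in val (enum_val i) -> vrank c = i.
  by rewrite in_vertex => /eqP ->; rewrite enum_valK.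
split; first by rewrite -oppr_ge0 -sumrN sumr_ge0// => c /ci/DP[]; rewrite oppr_ge0.
move=> /eqP; rewrite -oppr_eq0 -sumrN psumr_eq0 => [/allP z c cE|c /ci/DP[]]; last by rewrite oppr_ge0.
have [_] := DP cE; apply; apply/eqP; rewrite -oppr_eq0.
have /implyP := z c (mem_index_enum c); apply.
by rewrite in_vertex -cE enum_rankK.
Qed.

End corner_sums.

Local Notation F K lam := (fun r => Kcurv K lam (packing_metric r)).

(** m is the maximal ratio of sn r' to sn r, attained at i: there no angle increases, and equal
    curvatures force equality in every corner, so the neighbours attain the ratio too. *)
Lemma Kcurv_max K lam r r' (m : R) i : K <> Spherical -> radii r -> radii r' -> 0 < m ->
  (K = Hyperbolic -> 1 < m) -> sn K (r' 0 i) = m * sn K (r 0 i) ->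
  (forall j, sn K (r' 0 j) <= m * sn K (r 0 j)) ->
  F K lam r' 0 i <= F K lam r 0 i /\
  (F K lam r' 0 i = F K lam r 0 i -> K = Euclidean /\ forall c, vrank c = i ->
    sn K (r' 0 (vrank (next_corner c))) = m * sn K (r 0 (vrank (next_corner c))) /\
    sn K (r' 0 (vrank (prev_corner c))) = m * sn K (r 0 (vrank (prev_corner c)))).
Proof.
move=> KS r0 r0' m0 m1 Ei hle.
pose D c := Jtan lam (corner_packing_angle K r' c) - Jtan lam (corner_packing_angle K r c).
pose P c := [/\ K = Euclidean,
  sn K (r' 0 (vrank (next_corner c))) = m * sn K (r 0 (vrank (next_corner c))) &
  sn K (r' 0 (vrank (prev_corner c))) = m * sn K (r 0 (vrank (prev_corner c)))].
have DP c : vrank c = i -> D c <= 0 /\ (D c = 0 -> P c).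
  move=> ci; have Ei' : sn K (vertex_radius r' c) = m * sn K (vertex_radius r c).
    by rewrite /vertex_radius ci.
  have [h1 h2] := packing_angle_le KS (r0 _) (r0 _) (r0 _) (r0' _) (r0' _) (r0' _) m0 m1 Ei'
    (hle (vrank (next_corner c))) (hle (vrank (prev_corner c))).
  have I := corner_packing_angle_itv c KS r0; have I' := corner_packing_angle_itv c KS r0'.
  have J := Jtan_increasing lam I' I; rewrite /D; move: h1; rewrite le_eqVlt => /predU1P[E|lt].
    have E' : corner_packing_angle K r' c = corner_packing_angle K r c := E.
    by rewrite E' subrr; split=> // _; exact: h2 E.
  have lt' := J lt; split; first by rewrite subr_le0 ltW.
  by move=> /eqP; rewrite subr_eq0 lt_eqF.
have [S0 Sz] := vertex_sum_le DP.
have E : F K lam r' 0 i - F K lam r 0 i = \sum_(c in val (enum_val i)) D c.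
  rewrite /D sumrB.
  exact: (congr2 (fun x y => x - y) (KcurvE lam i KS r0') (KcurvE lam i KS r0)).
split; first by rewrite -subr_le0 E.
move=> /eqP; rewrite -subr_eq0 E => /eqP /Sz h.
have [c ci] : exists c, vrank c = i.
  by have [c E'] := vertex_ofP (enum_val i); exists c; rewrite -E' enum_valK.
by split=> [|d /h[]//]; have [] := h c ci.
Qed.

Lemma dKcurv_max K lam r v (y : R) i : K <> Spherical -> radii r ->
  (K = Hyperbolic -> 0 < y) -> ct K (r 0 i) * v 0 i = y ->
  (forall j, ct K (r 0 j) * v 0 j <= y) ->
  ('d (F K lam) r v) 0 i <= 0 /\
  (('d (F K lam) r v) 0 i = 0 -> K = Euclidean /\ forall c, vrank c = i ->
    ct K (r 0 (vrank (next_corner c))) * v 0 (vrank (next_corner c)) = y /\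
    ct K (r 0 (vrank (prev_corner c))) * v 0 (vrank (prev_corner c)) = y).
Proof.
move=> KS r0 y0 Ei hle.
pose D c := 'D_v (fun r => Jtan lam (corner_packing_angle K r c)) r.
pose P c := [/\ K = Euclidean,
  ct K (r 0 (vrank (next_corner c))) * v 0 (vrank (next_corner c)) = y &
  ct K (r 0 (vrank (prev_corner c))) * v 0 (vrank (prev_corner c)) = y].
have DP c : vrank c = i -> D c <= 0 /\ (D c = 0 -> P c).
  move=> ci.
  have Ei' : ct K (r 0 (vrank c)) * v 0 (vrank c) = y by rewrite ci.
  have [h1 h2] := packing_dlog_le KS (r0 (vrank c)) (r0 (vrank (next_corner c)))
    (r0 (vrank (prev_corner c))) y0 Ei' (hle _) (hle _).
  have line j : is_derive (0 : R) 1 (fun s => (r + s *: v) 0 j) (v 0 j).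
    have := is_derD (is_derive_cst (r 0 j) (0 : R) 1) (is_derM (is_derive_id (0 : R) 1)
      (is_derive_cst (v 0 j) (0 : R) 1)).
    rewrite mulr0 addr0 mul1r add0r; congr is_derive.
    by apply/funext => s; rewrite !mxE.
  have l0 : r + 0 *: v = r by rewrite scale0r addr0.
  have g j : good K ((r + 0 *: v) 0 j) by rewrite l0 good_unbounded.
  have gW : good K ((r + 0 *: v) 0 (vrank c) + (r + 0 *: v) 0 (vrank (next_corner c)) +
      (r + 0 *: v) 0 (vrank (prev_corner c))) by rewrite l0 good_unbounded// !addr_gt0.
  have da := is_derive_ang (W := fun s => (r + s *: v) 0 (vrank c) +
      (r + s *: v) 0 (vrank (next_corner c)) + (r + s *: v) 0 (vrank (prev_corner c)))
    (a := fun s => (r + s *: v) 0 (vrank c)) (b := fun s => (r + s *: v) 0 (vrank (next_corner c)))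
    (c := fun s => (r + s *: v) 0 (vrank (prev_corner c))) gW (g _) (g _) (g _)
    (is_derD (is_derD (line (vrank c)) (line (vrank (next_corner c)))) (line (vrank (prev_corner c))))
    (line _) (line _) (line _).
  have I := corner_packing_angle_itv c KS r0; rewrite -l0 in I.
  have dJ := is_derc (g := fun s => corner_packing_angle K (r + s *: v) c) (is_derive_Jtan lam I) da.
  have DE : D c = tan (corner_packing_angle K r c / 2) `^ lam *
      (sin (corner_packing_angle K r c) * dlog_angle K
        (r 0 (vrank (next_corner c)) + r 0 (vrank (prev_corner c)))
        (r 0 (vrank (prev_corner c)) + r 0 (vrank c)) (r 0 (vrank c) + r 0 (vrank (next_corner c)))
        (v 0 (vrank (next_corner c)) + v 0 (vrank (prev_corner c)))
        (v 0 (vrank (prev_corner c)) + v 0 (vrank c)) (v 0 (vrank c) + v 0 (vrank (next_corner c)))).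
    have -> := derive_line_unique r0 (smooth_Jtan lam c KS) dJ : D c = _.
    rewrite l0; congr (_ * (_ * _)).
    rewrite /dlog_angle.
    have hh (p q w : R) : [/\ (w + p + (p + q) - (q + w)) / 2 = p,
      (p + q + (q + w) - (w + p)) / 2 = q, (q + w + (w + p) - (p + q)) / 2 = w &
      (q + w + (w + p) + (p + q)) / 2 = p + q + w] by split; field.
    have [-> -> -> ->] := hh (r 0 (vrank c)) (r 0 (vrank (next_corner c))) (r 0 (vrank (prev_corner c))).
    by have [-> -> -> ->] := hh (v 0 (vrank c)) (v 0 (vrank (next_corner c))) (v 0 (vrank (prev_corner c))).
  rewrite l0 in I; have t0 : 0 < tan (corner_packing_angle K r c / 2) `^ lam.
    exact/powR_gt0/tan_half_gt0.
  have s0 : 0 < sin (corner_packing_angle K r c) by exact: sin_gt0_pi.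
  rewrite DE; split; first by rewrite pmulr_rle0// pmulr_rle0.
  have z (x u : R) : 0 < x -> x * u = 0 -> u = 0.
    by move=> x0 /eqP; rewrite mulf_eq0 (gt_eqF x0) => /eqP.
  by move=> e; apply: h2; exact: z s0 (z _ _ t0 e).
have [S0 Sz] := vertex_sum_le DP.
have -> : ('d (F K lam) r v) 0 i = \sum_(c in val (enum_val i)) D c.
  exact: (diff_row_sum (F := F K lam) (A := fun i c => c \in val (enum_val i))
    (@open_radii R S) (fun c => smooth_Jtan lam c KS) (fun r i => @KcurvE R S lam K r i KS)).
split; first exact: S0.
move=> /Sz h.
have [c ci] : exists c, vrank c = i.
  by have [c E'] := vertex_ofP (enum_val i); exists c; rewrite -E' enum_valK.
by split=> [|d /h[]//]; have [] := h c ci.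
Qed.

Lemma sn_radius_gt0 K r j : K <> Spherical -> radii r -> 0 < sn K (r 0 j).
Proof. by move=> KS r0; apply: sn_gt0; rewrite good_unbounded. Qed.

(** If the maximal ratio exceeded 1, equality in [Kcurv_max] would make the geometry Euclidean. So
    the ratio is at most 1, and exchanging the two packings gives equality. *)
Lemma Kcurv_hyperbolic_inj lam r r' : radii r -> radii r' ->
  F Hyperbolic lam r = F Hyperbolic lam r' -> r = r'.
Proof.
have KS : Hyperbolic <> Spherical by [].
have key s s' : radii s -> radii s' -> F Hyperbolic lam s = F Hyperbolic lam s' ->
    forall j, sn Hyperbolic (s' 0 j) <= sn Hyperbolic (s 0 j).
  move=> s0 s0' E.
  have [i im] := exists_max (fun j => sn Hyperbolic (s' 0 j) / sn Hyperbolic (s 0 j)) vertex_gt0.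
  have g := fun j => sn_radius_gt0 j KS s0; have g' := fun j => sn_radius_gt0 j KS s0'.
  have im' j : sn Hyperbolic (s' 0 j) <=
      sn Hyperbolic (s' 0 i) / sn Hyperbolic (s 0 i) * sn Hyperbolic (s 0 j).
    by rewrite -ler_pdivrMr.
  have [m1|m1] := leP (sn Hyperbolic (s' 0 i) / sn Hyperbolic (s 0 i)) 1.
    move=> j; apply: le_trans (im' j) _; rewrite -[leRHS]mul1r.
    exact: ler_wpM2r (ltW (g j)) _ _ m1.
  have Ei : sn Hyperbolic (s' 0 i) = sn Hyperbolic (s' 0 i) / sn Hyperbolic (s 0 i) * sn Hyperbolic (s 0 i).
    exact/esym/(divfK (lt0r_neq0 (g i))).
  have [_] := Kcurv_max lam KS s0 s0' (lt_trans ltr01 m1) (fun=> m1) Ei im'.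
  by rewrite -E => /(_ erefl)[].
move=> r0 r0' E; apply/rowP => j.
apply: (@good_inj R Hyperbolic (sn Hyperbolic) (cn Hyperbolic)).
- by move=> x _; exact: is_derive_sn.
- by move=> x _; exact: cosh_gt0.
- by rewrite good_unbounded.
- by rewrite good_unbounded.
- exact: le_anti (introT andP (conj (key _ _ r0' r0 (esym E) j) (key _ _ r0 r0' E j))).
Qed.

Lemma dKcurv_hyperbolic_inj lam r v : radii r -> 'd (F Hyperbolic lam) r v = 0 -> v = 0.
Proof.
have KS : Hyperbolic <> Spherical by [].
have key u : radii r -> 'd (F Hyperbolic lam) r u = 0 -> forall j, u 0 j <= 0.
  move=> r0 E; have [i im] := exists_max (fun j => ct Hyperbolic (r 0 j) * u 0 j) vertex_gt0.
  have c0 j : 0 < ct Hyperbolic (r 0 j) by rewrite divr_gt0 ?cosh_gt0 ?sn_radius_gt0.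
  have [y0|y0] := leP (ct Hyperbolic (r 0 i) * u 0 i) 0.
    by move=> j; rewrite -(pmulr_rle0 _ (c0 j)) (le_trans (im j)).
  have [_] := dKcurv_max lam KS r0 (fun=> y0) erefl im.
  by rewrite E mxE => /(_ erefl)[].
move=> r0 E; apply/rowP => j; rewrite mxE; apply/eqP; rewrite eq_le key//=.
have := key (- v) r0; rewrite linearN E oppr0 => /(_ erefl j).
by rewrite mxE oppr_le0.
Qed.

(** Evaluating at a maximum of r' / r gives d <= 0, and exchanging the packings gives - d <= 0. Then
    d = 0, and the maximal ratio spreads to all vertices. *)
Lemma Kcurv_euclidean_inj lam r r' (d : R) : radii r -> radii r' ->
  (forall i, F Euclidean lam r' 0 i - F Euclidean lam r 0 i = d) ->
  d = 0 /\ exists2 e, 0 < e & r' = e *: r.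
Proof.
have KS : Euclidean <> Spherical by [].
have key s s' d' : radii s -> radii s' ->
    (forall i, F Euclidean lam s' 0 i - F Euclidean lam s 0 i = d') ->
    d' <= 0 /\ (d' = 0 -> exists2 e, 0 < e & s' = e *: s).
  move=> s0 s0' E; have [i im] := exists_max (fun j => s' 0 j / s 0 j) vertex_gt0.
  have m0 : 0 < s' 0 i / s 0 i by rewrite divr_gt0.
  have im' j : s' 0 j <= s' 0 i / s 0 i * s 0 j by rewrite -ler_pdivrMr.
  have Ei j : s' 0 j / s 0 j = s' 0 i / s 0 i -> s' 0 j = s' 0 i / s 0 i * s 0 j.
    by move=> <-; rewrite divfK// gt_eqF.
  have mx j : s' 0 j = s' 0 i / s 0 i * s 0 j ->
      F Euclidean lam s' 0 j <= F Euclidean lam s 0 j /\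
      (F Euclidean lam s' 0 j = F Euclidean lam s 0 j -> Euclidean = Euclidean /\
       forall c, vrank c = j ->
        s' 0 (vrank (next_corner c)) = s' 0 i / s 0 i * s 0 (vrank (next_corner c)) /\
        s' 0 (vrank (prev_corner c)) = s' 0 i / s 0 i * s 0 (vrank (prev_corner c))).
    by move=> Ej; apply: (@Kcurv_max Euclidean lam s s' _ j KS s0 s0' m0).
  split; first by rewrite -(E i) subr_le0; exact: (mx i (Ei i erefl)).1.
  move=> d0; exists (s' 0 i / s 0 i) => //; apply/rowP => j; rewrite mxE.
  apply: (@vertex_connected_ind (fun j => s' 0 j = s' 0 i / s 0 i * s 0 j) i) => [|c hc].
    exact: Ei.
  have [_] := mx _ hc; case; first by apply/eqP; rewrite -subr_eq0 E d0.
  by move=> _; apply.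
move=> r0 r0' E; have [d0 h] := key _ _ _ r0 r0' E.
have [d0' _] : - d <= 0 /\ (- d = 0 -> exists2 e, 0 < e & r = e *: r').
  by apply: (key _ _ _ r0' r0) => i; rewrite -(E i); exact/esym/opprB.
have dz : d = 0 by apply/eqP; rewrite eq_le d0 -oppr_le0.
by split=> //; exact: h.
Qed.

Lemma dKcurv_euclidean_inj lam r v (d : R) : radii r ->
  (forall i, ('d (F Euclidean lam) r v) 0 i = d) -> d = 0 /\ exists e : R, v = e *: r.
Proof.
have KS : Euclidean <> Spherical by [].
move=> r0; have key u d' : (forall i, ('d (F Euclidean lam) r u) 0 i = d') ->
    d' <= 0 /\ (d' = 0 -> exists e : R, u = e *: r).
  move=> E; have [i im] := exists_max (fun j => ct Euclidean (r 0 j) * u 0 j) vertex_gt0.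
  set y := ct Euclidean (r 0 i) * u 0 i in im.
  have y0 : Euclidean = Hyperbolic -> 0 < y by [].
  split; first by rewrite -(E i); exact: (dKcurv_max lam KS r0 y0 (i := i) erefl im).1.
  move=> d0; exists y; apply/rowP => j; rewrite mxE.
  suff : ct Euclidean (r 0 j) * u 0 j = y by move=> <-; rewrite /ct /= div1r mulrAC mulVf ?mul1r// gt_eqF.
  move: j; apply: (@vertex_connected_ind (fun j => ct Euclidean (r 0 j) * u 0 j = y) i) => // c hc.
  by have [_] := dKcurv_max lam KS r0 y0 hc im; case; [rewrite E|move=> _; apply].
move=> E; have [d0 h] := key _ _ E.
have [d0' _] : - d <= 0 /\ (- d = 0 -> exists e : R, - v = e *: r).
  by apply: key => i; rewrite linearN mxE E.
have dz : d = 0 by apply/eqP; rewrite eq_le d0 -oppr_le0.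
by split=> //; exact: h.
Qed.

End vertex_maps.

(** * Invariance under scaling and embeddings of the quotients *)

Section scaling.
Variable R : realType.

Lemma is_derive_coord_sum n (phi psi : R -> R) (x v : 'rV[R]_n) :
  (forall i, is_derive (x 0 i) 1 phi (psi (x 0 i))) ->
  is_derive x v (fun x => \sum_i phi (x 0 i)) (\sum_i psi (x 0 i) * v 0 i).
Proof.
move=> dphi; apply: is_der_sum => i.
have dx : differentiable (fun x : 'rV[R]_n => x 0 i) x by exact: differentiable_coord.
have dv : is_derive x v (fun x : 'rV[R]_n => x 0 i) (v 0 i).
  apply: DeriveDef; first exact: diff_derivable.
  have dd : derivable (id : 'rV[R]_n -> 'rV[R]_n) x v by exact: derivable_id.
  by rewrite (derivable_coord i dd) derive_id.
exact: (is_derive_comp1 (dphi i) dx dv).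
Qed.

Lemma angZ (e W a b c : R) : 0 < e ->
  ang Euclidean (e * W) (e * a) (e * b) (e * c) = ang Euclidean W a b c.
Proof.
move=> e0; rewrite /ang /tau /= (mulrACA e b e c) (mulrACA e a e W) -mulf_div.
by rewrite divff ?mul1r// mulf_neq0// gt_eqF.
Qed.

Lemma tri_scale (e a b c : R) : 0 < e -> tri Euclidean a b c ->
  tri Euclidean (e * a) (e * b) (e * c) /\
  tri_angle Euclidean (e * a) (e * b) (e * c) = tri_angle Euclidean a b c.
Proof.
move=> e0; rewrite /tri /tri_angle /deficits.
have -> : (e * b + e * c - e * a) / 2 = e * ((b + c - a) / 2) by ring.
have -> : (e * c + e * a - e * b) / 2 = e * ((c + a - b) / 2) by ring.
have -> : (e * a + e * b - e * c) / 2 = e * ((a + b - c) / 2) by ring.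
have -> : (e * a + e * b + e * c) / 2 = e * ((a + b + c) / 2) by ring.
rewrite angZ//; case=> p0 q0 w0 /andP[W0 _]; split; last by [].
by split; [exact: mulr_gt0|exact: mulr_gt0|exact: mulr_gt0|
  rewrite -!mulrDr /good andbT; exact: mulr_gt0].
Qed.

Lemma add_const_mx_eq n (A B : 'rV[R]_n) (a b : R) : A + const_mx a = B + const_mx b ->
  forall i, B 0 i - A 0 i = a - b.
Proof. by move=> /rowP E i; have := E i; rewrite !mxE => h; lra. Qed.

Variables (S : closed_surface) (lam : R).

Lemma polyhedralZ (e : R) (l : 'rV[R]_#|edge S|) : 0 < e -> polyhedral Euclidean l ->
  polyhedral Euclidean (e *: l) /\ Phi Euclidean lam (e *: l) = Phi Euclidean lam l.
Proof.
move=> e0 Pl; have Pl' := (polyhedralP _ _).1 Pl.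
have sZ c : side_length (e *: l) c = e * side_length l c by rewrite /side_length mxE.
have Pe : polyhedral Euclidean (e *: l).
  by apply/polyhedralP => c; rewrite /corner_tri !sZ; exact: (tri_scale e0 (Pl' c)).1.
split; first exact: Pe.
apply/rowP => i; rewrite (PhiE lam i Pe) (PhiE lam i Pl); apply: eq_bigr => c _.
by congr (Jsin lam _); rewrite /model_angle !sZ; exact: (tri_scale e0 (Pl' c)).2.
Qed.

Lemma radiiZ (e : R) (r : 'rV[R]_#|vertex S|) : 0 < e -> radii r ->
  radii (e *: r) /\ Kcurv Euclidean lam (packing_metric (e *: r)) =
    Kcurv Euclidean lam (packing_metric r).
Proof.
move=> e0 r0; have KS : Euclidean <> Spherical by [].
have re : radii (e *: r) by move=> v; rewrite mxE mulr_gt0.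
split; first exact: re.
apply/rowP => i; apply: etrans (KcurvE lam i KS re) (etrans _ (esym (KcurvE lam i KS r0))).
apply: eq_bigr => c _.
congr (Jtan lam _); rewrite /corner_packing_angle /packing_angle /vertex_radius !mxE -!mulrDr.
exact: angZ.
Qed.

(** rho is the sum of the coordinates t of the edges. If two metrics have the same value of Phi +
    rho.(1, ..., 1), the nonnegative pairing of the increments of t and Phi equals minus the square
    of the increment of rho, so both vanish; the infinitesimal version is the same. *)
Lemma Phi_embedding_mod_scaling : lam <= -1 ->
  smooth_embedding_mod_scaling (@polyhedral R S Euclidean) (@Phi R S Euclidean lam).
Proof.
move=> lam1; have n0 : 0 < - lam by lra.
pose phi (x : R) := x `^ (- lam) / (- lam); pose psi (x : R) := x `^ (- lam - 1).
have dphi (x : R) : 0 < x -> is_derive x 1 phi (psi x).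
  move=> x0; have := is_derMl (- lam)^-1 (is_derive1_powR (- lam) x0).
  rewrite mulrA mulVf ?gt_eqF// mul1r => dd.
  by move: dd; under eq_fun do rewrite mulrC.
have g (l : 'rV[R]_#|edge S|) i : polyhedral Euclidean l -> 0 < l 0 i.
  by move=> Pl; exact: good_gt0 (polyhedral_gt0 i Pl).
have dr (l v : 'rV[R]_#|edge S|) : polyhedral Euclidean l ->
    is_derive l v (fun l => \sum_i phi (l 0 i)) (\sum_i psi (l 0 i) * v 0 i).
  by move=> Pl; apply: is_derive_coord_sum => i; apply: dphi; exact: g.
have posum (u : R -> R) (l : 'rV[R]_#|edge S|) : (forall x, 0 < x -> 0 < u x) ->
    polyhedral Euclidean l -> 0 < \sum_i u (l 0 i).
  move=> u0 Pl; rewrite lt_neqAle eq_sym sumr_ge0 ?andbT; last by move=> i _; rewrite ltW// u0// g.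
  rewrite psumr_eq0; last by move=> i _; rewrite ltW// u0// g.
  apply/negP => /allP /(_ (Ordinal (edge_gt0 S)) (mem_index_enum _)).
  by rewrite /= gt_eqF// u0// g.
have phi0 x : 0 < x -> 0 < phi x by move=> x0; rewrite divr_gt0// powR_gt0.
have sumZ (c : R) (l : 'rV[R]_#|edge S|) : 0 < c -> polyhedral Euclidean l ->
    \sum_i phi ((c *: l) 0 i) = c `^ (- lam) * \sum_i phi (l 0 i).
  move=> c0 Pl; rewrite mulr_sumr; apply: eq_bigr => i _.
  by rewrite mxE /phi powRM ?mulrA// ltW// g.
have root (c : R) : 0 < c -> (c `^ (- lam)^-1) `^ (- lam) = c.
  by move=> c0; rewrite -powRrM mulVf ?gt_eqF// powRr1// ltW.
apply: (@embedding_mod_scaling _ _ _ _ (fun l => \sum_i phi (l 0 i))).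
- exact: open_polyhedral.
- by move=> c x c0 Px; exact: (polyhedralZ c0 Px).1.
- exact: smooth_Phi.
- by move=> c x c0 Px; exact: (polyhedralZ c0 Px).2.
- move=> k; have oP := @open_polyhedral R S Euclidean; apply: Ck_sum => // i _.
  apply: CkM => //; last exact: Ck_cst.
  by apply: Ck_powR => //; [by move=> l Pl; exact: g|exact: Ck_coord].
- move=> x y Px Py; have [sx sy] := (posum _ _ phi0 Px, posum _ _ phi0 Py).
  have q0 := divr_gt0 sx sy.
  exists (((\sum_i phi (x 0 i)) / \sum_i phi (y 0 i)) `^ (- lam)^-1); first exact: powR_gt0.
  by rewrite sumZ ?powR_gt0// root// divfK// gt_eqF.
- move=> x Px; have [_ ->] := dr x x Px; rewrite gt_eqF//.
  apply: (posum (fun x => psi x * x)) => // u u0; by rewrite mulr_gt0// powR_gt0.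
- move=> x v Px; have [_ ->] := dr x v Px; set t := \sum_i _ => E.
  have [S0 Sz] := dPhi_form lam v (K := Euclidean) ltac:(by []) Px.
  have SE : dPhi_sum lam Euclidean x v = - t ^+ 2.
    rewrite expr2 -mulNr mulr_sumr; apply: eq_bigr => i _.
    have /rowP/(_ i) := E; rewrite !mxE => /eqP; rewrite addr_eq0 => /eqP ->.
    by rewrite /psi /=; ring.
  have t0 : t = 0.
    by apply/eqP; rewrite -sqrf_eq0 eq_le sqr_ge0 andbT -oppr_ge0 -SE.
  have [_ /(_ erefl)[e ve]] := Sz (etrans SE ltac:(by rewrite t0 expr0n oppr0)).
  have : e * \sum_i psi (x 0 i) * x 0 i = 0.
    by apply: etrans t0; rewrite mulr_sumr; apply: eq_bigr => i _; rewrite ve mxE mulrCA.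
  move/eqP; rewrite mulf_eq0 => /orP[/eqP e0|]; first by rewrite ve e0 scale0r.
  rewrite gt_eqF//; apply: (posum (fun x => psi x * x)) => // u u0.
  by rewrite mulr_gt0// powR_gt0.
- move=> x y Px Py E; pose d := \sum_i phi (x 0 i) - \sum_i phi (y 0 i).
  have dE i : Phi Euclidean lam y 0 i - Phi Euclidean lam x 0 i = d := add_const_mx_eq E i.
  have [S0 Sz] := Phi_monotone_mod_scaling lam1 Px Py dE.
  have sE : \sum_i (phi (y 0 i) - phi (x 0 i)) = - d by rewrite sumrB /d opprB.
  rewrite sE in S0 Sz; have d0 : d = 0.
    by apply/eqP; rewrite -sqrf_eq0 eq_le sqr_ge0 andbT expr2 -oppr_ge0 -mulrN.
  have [c c0 yE] := Sz ltac:(by rewrite d0 mul0r).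
  move: d0; rewrite /d yE sumZ// => /eqP; rewrite subr_eq0 -subr_eq0 -[X in X - _]mul1r -mulrBl.
  rewrite mulf_eq0 (gt_eqF (posum _ _ phi0 Px)) orbF subr_eq0 => /eqP c1.
  have -> : c = 1; last by rewrite scale1r.
  have -> : c = (c `^ (- lam)) `^ (- lam)^-1 by rewrite -powRrM divff ?gt_eqF// powRr1// ltW.
  by rewrite -c1 powR1.
Qed.

(** The maximum principle already shows that curvatures differing by a constant are equal, so rho
    only has to detect the scale; the sum of logarithms grows by #|V| ln c under scaling by c. *)
Lemma Kcurv_embedding_mod_scaling :
  smooth_embedding_mod_scaling (@radii R S)
    (fun r => @Kcurv R S Euclidean lam (packing_metric r)).
Proof.
have KS : Euclidean <> Spherical by [].
pose n : R := #|vertex S|%:R; have n0 : 0 < n by rewrite ltr0n vertex_gt0.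
have dr (r v : 'rV[R]_#|vertex S|) : radii r ->
    is_derive r v (fun r => \sum_i ln (r 0 i)) (\sum_i (r 0 i)^-1 * v 0 i).
  by move=> r0; apply: is_derive_coord_sum => i; apply: is_derive1_ln; exact: r0.
have radial (r : 'rV[R]_#|vertex S|) : radii r -> \sum_i (r 0 i)^-1 * r 0 i = n.
  move=> r0; rewrite (eq_bigr (fun=> 1)) => [|i _]; last by rewrite mulVf// gt_eqF.
  by rewrite sumr_const card_ord.
have sumZ (c : R) (r : 'rV[R]_#|vertex S|) : 0 < c -> radii r ->
    \sum_i ln ((c *: r) 0 i) = n * ln c + \sum_i ln (r 0 i).
  move=> c0 r0; rewrite (eq_bigr (fun i => ln c + ln (r 0 i))) => [|i _].
    by rewrite big_split/= sumr_const card_ord mulr_natl.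
  by rewrite mxE lnM// posrE.
apply: (@embedding_mod_scaling _ _ _ _ (fun r => \sum_i ln (r 0 i))).
- exact: open_radii.
- by move=> c x c0 Px; exact: (radiiZ c0 Px).1.
- exact: smooth_Kcurv.
- by move=> c x c0 Px; exact: (radiiZ c0 Px).2.
- move=> k; have oR := @open_radii R S; apply: Ck_sum => // i _.
  by apply: Ck_ln => //; exact: Ck_coord.
- move=> x y Px Py.
  exists (expR ((\sum_i ln (x 0 i) - \sum_i ln (y 0 i)) / n)); first exact: expR_gt0.
  by rewrite sumZ ?expR_gt0// expRK mulrC divfK ?subrK// gt_eqF.
- by move=> x Px; have [_ ->] := dr x x Px; rewrite radial// gt_eqF.
- move=> x v Px; have [_ ->] := dr x v Px; set t := \sum_i _ => E.
  have dE i : ('d (fun r => Kcurv Euclidean lam (packing_metric r)) x v) 0 i = - t.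
    by have /rowP/(_ i) := E; rewrite !mxE => /eqP; rewrite addr_eq0 => /eqP.
  have [/eqP t0 [e ve]] := dKcurv_euclidean_inj Px dE.
  have : e * n = 0.
    move: t0; rewrite oppr_eq0 => /eqP t0; apply: etrans t0; rewrite -(radial x Px) mulr_sumr.
    by apply: eq_bigr => i _; rewrite ve mxE mulrCA.
  by move=> /eqP; rewrite mulf_eq0 (gt_eqF n0) orbF => /eqP e0; rewrite ve e0 scale0r.
- move=> x y Px Py E; pose d := \sum_i ln (x 0 i) - \sum_i ln (y 0 i).
  have dE i : Kcurv Euclidean lam (packing_metric y) 0 i -
      Kcurv Euclidean lam (packing_metric x) 0 i = d := add_const_mx_eq E i.
  have [d0 [c c0 yE]] := Kcurv_euclidean_inj Px Py dE.
  move: d0; rewrite /d yE sumZ// opprD addrCA subrr addr0 => /eqP.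
  by rewrite oppr_eq0 mulf_eq0 (gt_eqF n0) ln_eq0// => /eqP ->; rewrite scale1r.
Qed.

End scaling.

Theorem theorem6p2 (R : realType) (T : closed_surface) (lambda : R) :
  (* (a) *)
  (local_diffeomorphism (@polyhedral R T Spherical)
     (@Phi R T Spherical lambda) /\
   (0 <= lambda \/ lambda <= -1 ->
    smooth_embedding (@polyhedral R T Spherical)
      (@Phi R T Spherical lambda))) /\
  (* (b) *)
  immersion_mod_scaling (@polyhedral R T Euclidean)
    (@Phi R T Euclidean lambda) /\
  (* (c) *)
  (lambda <= -1 ->
   smooth_embedding_mod_scaling (@polyhedral R T Euclidean)
     (@Phi R T Euclidean lambda)) /\
  (* (d) *)
  smooth_embedding (@radii R T)
    (fun r => @Kcurv R T Hyperbolic lambda (packing_metric r)) /\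
  (* (e) *)
  smooth_embedding_mod_scaling (@radii R T)
    (fun r => @Kcurv R T Euclidean lambda (packing_metric r)) /\
  (* (f) *)
  (local_diffeomorphism (@polyhedral R T Hyperbolic)
     (@Psi R T Hyperbolic lambda) /\
   (lambda <= -1 \/ 0 <= lambda ->
    smooth_embedding (@polyhedral R T Hyperbolic)
      (@Psi R T Hyperbolic lambda))).
Proof.
have immS : immersion_on (@polyhedral R T Spherical) (@Phi R T Spherical lambda).
  move=> l v Pl E; have [_ h] := dPhi_form lambda v (K := Spherical) ltac:(by []) Pl.
  have [h0 _] := h ltac:(by apply: big1 => i _; rewrite E mxE mulr0).
  exact: h0.
have immH : immersion_on (@polyhedral R T Hyperbolic) (@Psi R T Hyperbolic lambda).
  move=> l v Pl E; have [_ h] := dPsi_form lambda v Pl.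
  by apply: h; apply: big1 => i _; rewrite E mxE mulr0.
split; last split; last split; last split; last split.
- split=> [|hlam].
    exact: inverse_function_theorem (@open_polyhedral _ _ _) (@smooth_Phi _ _ _ _) immS.
  apply: injective_embedding (@open_polyhedral _ _ _) (@smooth_Phi _ _ _ _) immS _.
  by move=> l l' Pl Pl'; exact: Phi_monotone.
- apply: immersion_mod_scalingP.
  + by move=> c x c0 Px; exact: (polyhedralZ lambda c0 Px).1.
  + exact: smooth_Phi.
  + by move=> c x c0 Px; exact: (polyhedralZ lambda c0 Px).2.
  + move=> l v Pl E; have [_ h] := dPhi_form lambda v (K := Euclidean) ltac:(by []) Pl.
    have [_ h0] := h ltac:(by apply: big1 => i _; rewrite E mxE mulr0).
    exact: h0.
- exact: Phi_embedding_mod_scaling.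
- have KS : Hyperbolic <> Spherical by [].
  apply: injective_embedding (@open_radii _ _) (@smooth_Kcurv _ _ _ _ KS) _ _.
    by move=> r v r0; exact: dKcurv_hyperbolic_inj.
  by move=> r r' r0 r0'; exact: Kcurv_hyperbolic_inj.
- exact: Kcurv_embedding_mod_scaling.
- split=> [|hlam].
    exact: inverse_function_theorem (@open_polyhedral _ _ _) (@smooth_Psi _ _ _) immH.
  apply: injective_embedding (@open_polyhedral _ _ _) (@smooth_Psi _ _ _) immH _.
  by move=> l l' Pl Pl'; exact: Psi_monotone.
Qed.
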